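(* Let $\alpha\in[0,1]$, $\mu>0$ and $\varphi\in L^2(\mathbb{R})\cap L^1(\mathbb{R})$. Set $\Phi^\mu_{p;\alpha}(\omega)=\sum_{\eta\in\mu I_{\alpha;p}}\hat\varphi(\omega-\eta)$ for $p\in\mathbb{Z}$. Suppose that $$a\le\sum_{p\in\mathbb{Z}}|\Phi^\mu_{p;\alpha}(\omega)|^2\le b\qquad\text{for all }\omega\in\mathbb{R},$$ for suitable constants $a,b>0$. Moreover, assume that $$|\hat\varphi(\omega)|\le\frac{C_N}{(1+|\omega|)^N}\qquad\text{for all }\omega\in\mathbb{R},$$ for some $N>2$ (and some constant $C_N>0$). Then there exist $A,B>0$ and $\nu_0>0$ such that for all $f\in L^2(\mathbb{R})$ $$A\|f\|_2^2\le|\langle S^{\alpha;\mu,\nu}_{\varphi,\varphi}f,f\rangle|\le B\|f\|_2^2\qquad\text{for } 0<\nu<\nu_0 .$$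
   Context: Fourier transform: $\hat f(\omega)=\int e^{-2\pi \mathrm{i} x\omega}f(x)\,dx$. Fix $\alpha\in[0,1]$. Define integers by $i_{\alpha;0}=0$, $s_{\alpha;0}=1$, $\beta_\alpha(0)=1$ and, for $p\ge1$, $i_{\alpha;p}=s_{\alpha;p-1}$, $\beta_\alpha(p)=\lfloor (i_{\alpha;p})^\alpha\rfloor$, $s_{\alpha;p}=i_{\alpha;p}+\lfloor (i_{\alpha;p})^\alpha\rfloor$. For $p\ge0$ let $I_{\alpha;p}=[i_{\alpha;p},s_{\alpha;p})\cap\mathbb{Z}$; for $p<0$ let $I_{\alpha;p}=-I_{\alpha;-p}$ and $\beta_\alpha(p)=\beta_\alpha(-p)$. For $\mu>0$, $\mu I_{\alpha;p}=\{\mu m: m\in I_{\alpha;p}\}$. For $\nu>0$ and $(p,k)\in\mathbb{Z}^2$ set $$\varphi^\alpha_{p,k}(t)=\frac{1}{\sqrt{\beta_\alpha(p)}}\sum_{\eta\in\mu I_{\alpha;p}}e^{2\pi \mathrm{i}\,\eta\left(t-k\frac{\nu}{\beta_\alpha(p)}\right)}\varphi\left(t-k\frac{\nu}{\beta_\alpha(p)}\right).$$ The frame operator is $S^{\alpha;\mu,\nu}_{\varphi,\varphi}f=\sum_{(p,k)\in\mathbb{Z}^2}\langle f,\varphi^\alpha_{p,k}\rangle\varphi^\alpha_{p,k}$, so that $\langle S^{\alpha;\mu,\nu}_{\varphi,\varphi}f,f\rangle=\sum_{(p,k)\in\mathbb{Z}^2}|\langle f,\varphi^\alpha_{p,k}\rangle|^2$;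 for a given $\nu$, the asserted inequality says that $\{\varphi^\alpha_{p,k}\}_{(p,k)\in\mathbb{Z}^2}$ is a frame of $L^2(\mathbb{R})$.
   Formalization: The upper bound B is allowed to depend on ν (A and ν₀ remain uniform), because ⟨Sf,f⟩ grows like 1/ν as ν→0, so no single B can serve all 0<ν<ν₀. *)

(* Defs.v *)
From HB Require Import structures.
From mathcomp Require Import all_boot all_order all_algebra.
From mathcomp Require Import finmap.
From mathcomp Require Import all_classical all_reals all_analysis.
From mathcomp Require Import complex.

Set Implicit Arguments.
Unset Strict Implicit.
Unset Printing Implicit Defensive.
Import Order.TTheory GRing.Theory Num.Theory.
Import numFieldNormedType.Exports.

Local Open Scope classical_set_scope.
Local Open Scope ring_scope.
Local Open Scope complex_scope.

(* The R-valued modulus; the generic norm on R[i] is R[i]-valued. *)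
Notation cabs := ComplexField.Normc.normc.

Section ComplexLebesgue.
Context {R : realType}.
Implicit Types f g : R -> R[i].

Definition cexpi (x : R) : R[i] := cos x +i* sin x.

Definition cintegral f : R[i] :=
  (\int[lebesgue_measure]_x complex.Re (f x)) +i*
  (\int[lebesgue_measure]_x complex.Im (f x)).

Definition Lpnorm (p : \bar R) f : \bar R :=
  Lnorm lebesgue_measure p (fun x : R => (cabs (f x))%:E).

(* Elements of L^p are handled through Borel representatives. *)
Definition in_Lp (p : \bar R) f : Prop :=
  [/\ measurable_fun [set: R] (fun x => complex.Re (f x)),
      measurable_fun [set: R] (fun x => complex.Im (f x)) &
      (Lpnorm p f < +oo)%E].

Definition norm2 f : R := fine (Lpnorm 2%:E f).

Definition inner f g : R[i] := cintegral (fun x => f x * (g x)^*).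

Definition fourier f (w : R) : R[i] :=
  cintegral (fun x => cexpi (- (2 * pi * x * w)) * f x).

Definition L2_has_sum (I : choiceType) (u : I -> R -> R[i]) g : Prop :=
  in_Lp 2%:E g /\
  forall e : R, 0 < e -> exists J0 : {fset I}, forall J : {fset I},
    (J0 `<=` J)%fset ->
    (Lpnorm 2%:E (fun t => ((\sum_(i <- J) u i t) - g t)%R) < e%:E)%E.

End ComplexLebesgue.

Section AlphaModulation.
Context {R : realType}.
Implicit Types (alpha mu nu : R) (phi f : R -> R[i]) (p k : int).

(* [s_idx alpha n] is s_(alpha;n) and [i_idx alpha n] is i_(alpha;n), n >= 0. *)
Fixpoint s_idx alpha (n : nat) : nat :=
  if n is m.+1 then (s_idx alpha m + Num.truncn ((s_idx alpha m)%:R `^ alpha))%N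
  else 1%N.

Definition i_idx alpha (n : nat) : nat :=
  if n is m.+1 then s_idx alpha m else 0%N.

Definition beta alpha p : nat :=
  let n := `|p|%N in
  if n is 0 then 1%N else Num.truncn ((i_idx alpha n)%:R `^ alpha).

(* Duplicate-free enumeration of I_(alpha;p); for p < 0 it is -I_(alpha;-p). *)
Definition I_seq alpha p : seq int :=
  let n := `|p|%N in
  [seq (if (0 <= p)%R then m%:Z else - m%:Z)
     | m <- index_iota (i_idx alpha n) (s_idx alpha n)].

Definition Phi alpha mu phi p (w : R) : R[i] :=
  \sum_(m <- I_seq alpha p) fourier phi (w - mu * m%:~R).

Definition atom alpha mu nu phi p k (t : R) : R[i] :=
  let u := t - k%:~R * (nu / (beta alpha p)%:R) in
  ((Num.sqrt (beta alpha p)%:R)^-1)%:C *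
  \sum_(m <- I_seq alpha p) cexpi (2 * pi * (mu * m%:~R) * u) * phi u.

(* The sum of the frame series, understood as an unconditional L^2 limit (which
   is unique up to a null set); the junk value 0 is taken if the series
   diverges, so that a lower frame bound for [f <> 0] forces convergence. *)
Definition frame_op alpha mu nu phi f : R -> R[i] :=
  xget (fun=> 0) [set g | L2_has_sum (fun (pk : int * int) t =>
    inner f (atom alpha mu nu phi pk.1 pk.2) *
    atom alpha mu nu phi pk.1 pk.2 t) g].

End AlphaModulation.

(* Main.v *)
Require Import Defs.
From HB Require Import structures.
From mathcomp Require Import all_boot all_order all_algebra.
From mathcomp Require Import finmap.
From mathcomp Require Import all_classical all_reals all_analysis.
From mathcomp Require Import complex.
From mathcomp Require Import measurable_realfun zify ring lra.

(**
Put [c = nu / beta p] and [F_p = fourier f * (Phi p)^*]. By Parseval the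
coefficients of [f] along the atoms [(p, k)] are, up to [1 / sqrt (beta p)], the
samples at [k c] of the Fourier transform of [F_p]. Poisson summation, obtained
here by Fejer means, gives
  [c * \sum_k |fourier F_p (k c)|^2 = ||F_p||^2 + O(\int |F_p| \sum_(j != 0) |F_p (. + j / c)|)].
The main terms add up to [\int |fourier f|^2 \sum_p |Phi p|^2], which lies between
[a ||f||^2] and [b ||f||^2] by Plancherel. By AM-GM the error terms are at most
[\int |fourier f|^2 W] with [W w = \sum_p |Phi p w| \sum_(j != 0) |Phi p (w + j / c)|].
Since [I_p] has [beta p] elements at distance at most [mu * beta p] whereas aliases
are [beta p / nu] apart, half of the decay exponent [N > 2] pays for the separation
and the other half for the lattice sums: [W = O(nu ^ (N / 2))] uniformly, hence the
errors are absorbed for small [nu]. The bounds pass from L1 /\ L2 to L2 by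
truncation, and the Bessel bound makes the frame series unconditionally convergent.
*)

Set Implicit Arguments.
Unset Strict Implicit.
Unset Printing Implicit Defensive.
Import Order.TTheory GRing.Theory Num.Theory.
Import numFieldNormedType.Exports.
Local Open Scope classical_set_scope.
Local Open Scope ring_scope.
Local Open Scope complex_scope.

(** * Complex-valued Lebesgue integration *)

Section Modulus.
Context {R : realType}.
Implicit Types (z u v : R[i]) (x y : R).

(** Poisson summation enters only as an inequality. [F_p] is continuous with decay, but its
    transform is not known to be summable at the samples; hence the Fejer means. Positivity of the
    kernel gives both a bound uniform in [n], as needed for dominated convergence, and the pointwise
    estimate limsup |mean - F| <= alias sum. Pairing the means with [F] produces Cesaro means of the
    nonnegative sample energies, which determine the full sum in both directions. Plancherel comes
    from the same inequality: for compact support and a fine enough grid nothing is aliased,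
    whatever the offset of the grid. Uniformity in [p] rests on two cancellations. The [beta p]
    cross terms attached to one frequency are offset by a factor [1 / beta p] from the separation of
    the aliases, which uses [N / 2 >= 1]. The blocks [I_p] are disjoint, so their lattice sums add
    up to a single one, finite because [N / 2 > 1]. *)

Lemma cabs_ge0 z : 0 <= cabs z.
Proof. by case: z => a b /=; exact: sqrtr_ge0. Qed.

Lemma cabs_sqr z : cabs z ^+ 2 = complex.Re z ^+ 2 + complex.Im z ^+ 2.
Proof. by case: z => a b /=; rewrite sqr_sqrtr// addr_ge0 ?sqr_ge0. Qed.

Lemma cabsM u v : cabs (u * v) = cabs u * cabs v.
Proof. exact: ComplexField.Normc.normcM. Qed.

Lemma cabsD u v : cabs (u + v) <= cabs u + cabs v.
Proof. exact: le_normcD. Qed.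

Lemma cabsN z : cabs (- z) = cabs z.
Proof. exact: normcN. Qed.

Lemma cabsB u v : cabs (u - v) <= cabs u + cabs v.
Proof. by rewrite (le_trans (cabsD _ _))// cabsN. Qed.

Lemma cabsC u v : cabs (u - v) = cabs (v - u).
Proof. by rewrite -cabsN opprB. Qed.

Lemma cabs0 : cabs (0 : R[i]) = 0.
Proof. exact: ComplexField.Normc.normc0. Qed.

Lemma cabs0_eq0 z : cabs z = 0 -> z = 0.
Proof. exact: ComplexField.Normc.eq0_normc. Qed.

Lemma cabs_conj z : cabs z^* = cabs z.
Proof. by case: z => a b /=; rewrite sqrrN. Qed.

Lemma cabs_real x : cabs x%:C = `|x|.
Proof. by rewrite /= expr0n/= addr0 sqrtr_sqr. Qed.

Lemma cabs_Re z : `|complex.Re z| <= cabs z.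
Proof.
rewrite -(@ler_pXn2r _ 2)// ?nnegrE ?cabs_ge0// cabs_sqr -normrX ger0_norm ?sqr_ge0//.
by rewrite lerDl sqr_ge0.
Qed.

Lemma cabs_Im z : `|complex.Im z| <= cabs z.
Proof.
rewrite -(@ler_pXn2r _ 2)// ?nnegrE ?cabs_ge0// cabs_sqr -normrX ger0_norm ?sqr_ge0//.
by rewrite lerDr sqr_ge0.
Qed.

Lemma cabs_le_ReIm z : cabs z <= `|complex.Re z| + `|complex.Im z|.
Proof.
rewrite -(@ler_pXn2r _ 2)// ?nnegrE ?cabs_ge0 ?addr_ge0//.
rewrite cabs_sqr sqrrD -(real_normK (num_real (complex.Re z))).
rewrite -(real_normK (num_real (complex.Im z))).
by rewrite lerD2r lerDl mulrn_wge0// mulr_ge0.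
Qed.

Lemma cabs_sum (I : Type) (s : seq I) (P : pred I) (F : I -> R[i]) :
  cabs (\sum_(i <- s | P i) F i) <= \sum_(i <- s | P i) cabs (F i).
Proof.
elim/big_rec2 : _ => [|i x y _ h]; first by rewrite cabs0.
by rewrite (le_trans (cabsD _ _))// lerD2l.
Qed.

Lemma mulcJ z : z * z^* = (cabs z ^+ 2)%:C.
Proof.
rewrite cabs_sqr; case: z => a b /=; simpc; rewrite -!expr2.
by rewrite mulrC addNr.
Qed.

Lemma cabs_dist_le u v : `|cabs u - cabs v| <= cabs (u - v).
Proof.
have H (a b : R[i]) : cabs a - cabs b <= cabs (a - b).
  by rewrite lerBlDr (le_trans _ (cabsD _ _))// subrK.
by rewrite ler_norml H andbT lerNl opprB cabsC H.
Qed.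

Lemma cReD u v : complex.Re (u + v) = complex.Re u + complex.Re v.
Proof. by case: u v => a b [c d]. Qed.
Lemma cImD u v : complex.Im (u + v) = complex.Im u + complex.Im v.
Proof. by case: u v => a b [c d]. Qed.
Lemma cReM u v : complex.Re (u * v) =
  complex.Re u * complex.Re v - complex.Im u * complex.Im v.
Proof. by case: u v => a b [c d]. Qed.
Lemma cImM u v : complex.Im (u * v) =
  complex.Re u * complex.Im v + complex.Im u * complex.Re v.
Proof. by case: u v => a b [c d]. Qed.
Lemma cReJ z : complex.Re z^* = complex.Re z. Proof. by case: z. Qed.
Lemma cImJ z : complex.Im z^* = - complex.Im z. Proof. by case: z. Qed.

Lemma cReN z : complex.Re (- z) = - complex.Re z. Proof. by case: z. Qed.
Lemma cImN z : complex.Im (- z) = - complex.Im z. Proof. by case: z. Qed.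

Lemma cexpiD x y : cexpi (x + y) = cexpi x * cexpi y.
Proof.
by rewrite /cexpi cosD sinD; simpc; congr (_ +i* _); ring.
Qed.

Lemma cexpi0 : cexpi (0 : R) = 1.
Proof. by rewrite /cexpi cos0 sin0. Qed.

Lemma cexpiJ x : (cexpi x)^* = cexpi (- x).
Proof. by rewrite /cexpi cosN sinN. Qed.

Lemma cabs_cexpi x : cabs (cexpi x) = 1.
Proof. by rewrite /= cos2Dsin2 sqrtr1. Qed.

Lemma eq_complexP u v : complex.Re u = complex.Re v ->
  complex.Im u = complex.Im v -> u = v.
Proof. by case: u v => a b [c d] /= -> ->. Qed.

End Modulus.

Local Arguments ComplexField.Normc.normc : simpl never.
Local Arguments cexpi : simpl never.
Local Arguments cintegral : simpl never.

Section ComplexIntegral.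
Context {R : realType}.
Implicit Types (f g : R -> R[i]) (z : R[i]).
Notation mu := (@lebesgue_measure R).

Definition cmeas f := measurable_fun [set: R] (fun x => complex.Re (f x)) /\
  measurable_fun [set: R] (fun x => complex.Im (f x)).

Definition cL1 f := cmeas f /\ (\int[mu]_x (cabs (f x))%:E < +oo)%E.

(** Squared and extended-real valued, so that Tonelli and monotonicity apply to it directly, without
    square roots or finiteness side conditions. *)
Definition sqnorm f := (\int[mu]_x (cabs (f x) ^+ 2)%:E)%E.

Definition cL2 f := cmeas f /\ (sqnorm f < +oo)%E.

Lemma cmeasD f g : cmeas f -> cmeas g -> cmeas (fun x => f x + g x).
Proof.
move=> [f1 f2] [g1 g2]; split.
  by under eq_fun do rewrite cReD; exact: measurable_funD.
by under eq_fun do rewrite cImD; exact: measurable_funD.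
Qed.

Lemma cmeasM f g : cmeas f -> cmeas g -> cmeas (fun x => f x * g x).
Proof.
move=> [f1 f2] [g1 g2]; split.
  by under eq_fun do rewrite cReM; apply: measurable_funB; exact: measurable_funM.
by under eq_fun do rewrite cImM; apply: measurable_funD; exact: measurable_funM.
Qed.

Lemma cmeasJ f : cmeas f -> cmeas (fun x => (f x)^*).
Proof.
move=> [f1 f2]; split; first by under eq_fun do rewrite cReJ.
by under eq_fun do rewrite cImJ; exact: measurableT_comp.
Qed.

Lemma cmeas_cst z : cmeas (fun=> z).
Proof. by split; exact: measurable_cst. Qed.

Lemma cmeasN f : cmeas f -> cmeas (fun x => - f x).
Proof.
move=> mf; under eq_fun do rewrite -mulN1r.
by apply: cmeasM => //; exact: cmeas_cst.
Qed.

Lemma cmeasB f g : cmeas f -> cmeas g -> cmeas (fun x => f x - g x).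
Proof. by move=> mf mg; apply: cmeasD => //; exact: cmeasN. Qed.

Lemma cmeas_sum (I : Type) (s : seq I) (F : I -> R -> R[i]) :
  (forall i, cmeas (F i)) -> cmeas (fun x => \sum_(i <- s) F i x).
Proof.
move=> mF; elim: s => [|i s ih].
  by under eq_fun do rewrite big_nil; exact: cmeas_cst.
by under eq_fun do rewrite big_cons; exact: cmeasD.
Qed.

Lemma cmeas_real (h : R -> R) : measurable_fun [set: R] h -> cmeas (fun x => (h x)%:C).
Proof. by move=> mh; split => //=; exact: measurable_cst. Qed.

Lemma cmeas_cexpi (h : R -> R) : measurable_fun [set: R] h ->
  cmeas (fun x => cexpi (h x)).
Proof.
move=> mh; split => /=; apply: measurableT_comp => //; apply: continuous_measurable_fun.
  exact: continuous_cos.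
exact: continuous_sin.
Qed.

Lemma cmeas_comp f (h : R -> R) : cmeas f -> measurable_fun [set: R] h ->
  cmeas (fun x => f (h x)).
Proof.
move=> [f1 f2] mh; split.
  exact: (measurableT_comp f1 mh).
exact: (measurableT_comp f2 mh).
Qed.

Lemma measurable_cabs f : cmeas f -> measurable_fun [set: R] (fun x => cabs (f x)).
Proof.
move=> [f1 f2].
have -> : (fun x => cabs (f x)) =
    Num.sqrt \o (fun x => complex.Re (f x) ^+ 2 + complex.Im (f x) ^+ 2).
  by apply/funext => x /=; case: (f x).
apply: measurableT_comp.
  by apply: continuous_measurable_fun => x; exact: sqrt_continuous.
by apply: measurable_funD; exact: measurable_funX.
Qed.

Lemma measurable_cabsE f : cmeas f -> measurable_fun [set: R] (fun x => (cabs (f x))%:E).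
Proof. by move=> mf; apply/measurable_EFinP; exact: measurable_cabs. Qed.

Lemma measurable_sqcabsE f : cmeas f ->
  measurable_fun [set: R] (fun x => (cabs (f x) ^+ 2)%:E).
Proof.
by move=> mf; apply/measurable_EFinP; apply: measurable_funX; exact: measurable_cabs.
Qed.

Lemma cL1_integrable f : cL1 f -> mu.-integrable setT (fun x => (cabs (f x))%:E).
Proof.
move=> [mf If]; apply/integrableP; split; first exact: measurable_cabsE.
by under eq_integral do rewrite gee0_abs ?lee_fin ?cabs_ge0//.
Qed.

Lemma cL1_Re f : cL1 f -> mu.-integrable setT (EFin \o (fun x => complex.Re (f x))).
Proof.
move=> If; apply: (le_integrable _ _ _ (cL1_integrable If)) => //.
  by apply/measurable_EFinP; exact: If.1.1.
by move=> x _ /=; rewrite lee_fin (ger0_norm (cabs_ge0 _)) cabs_Re.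
Qed.

Lemma cL1_Im f : cL1 f -> mu.-integrable setT (EFin \o (fun x => complex.Im (f x))).
Proof.
move=> If; apply: (le_integrable _ _ _ (cL1_integrable If)) => //.
  by apply/measurable_EFinP; exact: If.1.2.
by move=> x _ /=; rewrite lee_fin (ger0_norm (cabs_ge0 _)) cabs_Im.
Qed.

Lemma cL1_le f (h : R -> \bar R) : cmeas f ->
  measurable_fun [set: R] h ->
  (forall x, (cabs (f x))%:E <= h x)%E ->
  (\int[mu]_x h x < +oo)%E -> cL1 f.
Proof.
move=> mf mh fh hoo; split => //; apply: le_lt_trans hoo.
apply: ge0_le_integral => //; first by move=> x _; rewrite lee_fin cabs_ge0.
exact: measurable_cabsE.
Qed.

Lemma cL1D f g : cL1 f -> cL1 g -> cL1 (fun x => f x + g x).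
Proof.
move=> [mf fi] [mg gi].
apply: (@cL1_le _ (fun x => (cabs (f x))%:E + (cabs (g x))%:E)%E).
- exact: cmeasD.
- by apply: emeasurable_funD; exact: measurable_cabsE.
- by move=> x; rewrite -EFinD lee_fin cabsD.
- rewrite ge0_integralD//; last 4 first.
  + by move=> x _; rewrite lee_fin cabs_ge0.
  + exact: measurable_cabsE.
  + by move=> x _; rewrite lee_fin cabs_ge0.
  + exact: measurable_cabsE.
  by rewrite lte_add_pinfty.
Qed.

Lemma cL1_bM f g (M : R) : cmeas f -> (forall x, cabs (f x) <= M) -> cL1 g ->
  cL1 (fun x => f x * g x).
Proof.
move=> mf fM [mg gi].
have M0 : 0 <= M by exact: le_trans (cabs_ge0 (f 0)) (fM 0).
apply: (@cL1_le _ (fun x => M%:E * (cabs (g x))%:E)%E).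
- exact: cmeasM.
- by apply: emeasurable_funM; [exact: measurable_cst|exact: measurable_cabsE].
- by move=> x; rewrite -EFinM lee_fin cabsM ler_wpM2r// cabs_ge0.
- rewrite ge0_integralZl//.
  + by rewrite lte_mul_pinfty// ge0_fin_numE.
  + exact: measurable_cabsE.
  + by move=> x _; rewrite lee_fin cabs_ge0.
Qed.

Lemma cL1Z z f : cL1 f -> cL1 (fun x => z * f x).
Proof. by apply: (@cL1_bM _ _ (cabs z)) => //; exact: cmeas_cst. Qed.

Lemma cL1N f : cL1 f -> cL1 (fun x => - f x).
Proof. by move=> fi; under eq_fun do rewrite -mulN1r; exact: cL1Z. Qed.

Lemma cL1B f g : cL1 f -> cL1 g -> cL1 (fun x => f x - g x).
Proof. by move=> fi gi; apply: cL1D => //; exact: cL1N. Qed.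

Lemma cL1J f : cL1 f -> cL1 (fun x => (f x)^*).
Proof.
move=> [mf fi]; split; first exact: cmeasJ.
by under eq_integral do rewrite cabs_conj.
Qed.

Lemma cL10 : cL1 (fun=> 0).
Proof.
split; first exact: cmeas_cst.
by under eq_integral do rewrite cabs0; rewrite integral0.
Qed.

Lemma cL1_sum (I : Type) (s : seq I) (F : I -> R -> R[i]) :
  (forall i, cL1 (F i)) -> cL1 (fun x => \sum_(i <- s) F i x).
Proof.
move=> mF; elim: s => [|i s ih].
  by under eq_fun do rewrite big_nil; exact: cL10.
by under eq_fun do rewrite big_cons; exact: cL1D.
Qed.

Lemma eq_cintegral f g : f =1 g -> cintegral f = cintegral g.
Proof. by move=> /funext ->. Qed.

Lemma cintegralD f g : cL1 f -> cL1 g ->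
  cintegral (fun x => f x + g x) = cintegral f + cintegral g.
Proof.
move=> fi gi; rewrite /cintegral; simpc.
congr (_ +i* _).
  under eq_Rintegral do rewrite cReD.
  by rewrite RintegralD//; exact: cL1_Re.
under eq_Rintegral do rewrite cImD.
by rewrite RintegralD//; exact: cL1_Im.
Qed.

Lemma cintegralZ z f : cL1 f ->
  cintegral (fun x => z * f x) = z * cintegral f.
Proof.
move=> fi; have fR := cL1_Re fi; have fI := cL1_Im fi.
have iZ (c : R) h : mu.-integrable setT (EFin \o h) ->
    mu.-integrable setT (EFin \o (fun x => c * h x)).
  by move=> hi; exact: (integrableZl measurableT c hi).
rewrite /cintegral; case: z => a b; simpc; congr (_ +i* _).
  under eq_Rintegral do rewrite cReM /=.
  by rewrite RintegralB ?RintegralZl//; exact: iZ.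
under eq_Rintegral do rewrite cImM /=.
by rewrite RintegralD ?RintegralZl//; exact: iZ.
Qed.

Lemma cintegral0 : cintegral (fun=> 0 : R[i]) = 0.
Proof. by rewrite /cintegral /Rintegral !integral0. Qed.

Lemma cintegralN f : cL1 f -> cintegral (fun x => - f x) = - cintegral f.
Proof.
move=> fi; under eq_cintegral do rewrite -mulN1r.
by rewrite cintegralZ// mulN1r.
Qed.

Lemma cintegralB f g : cL1 f -> cL1 g ->
  cintegral (fun x => f x - g x) = cintegral f - cintegral g.
Proof. by move=> fi gi; rewrite cintegralD ?cintegralN//; exact: cL1N. Qed.

Lemma cintegralJ f : cL1 f -> cintegral (fun x => (f x)^*) = (cintegral f)^*.
Proof.
move=> fi; rewrite /cintegral /=; congr (_ +i* _).
  by under eq_Rintegral do rewrite cReJ.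
under eq_Rintegral do rewrite cImJ -mulN1r.
by rewrite RintegralZl ?mulN1r//; exact: cL1_Im.
Qed.

Lemma cintegral_sum (I : Type) (s : seq I) (F : I -> R -> R[i]) :
  (forall i, cL1 (F i)) ->
  cintegral (fun x => \sum_(i <- s) F i x) = \sum_(i <- s) cintegral (F i).
Proof.
move=> mF; elim: s => [|i s ih].
  by under eq_cintegral do rewrite big_nil; rewrite cintegral0 big_nil.
under eq_cintegral do rewrite big_cons.
by rewrite cintegralD// ?ih ?big_cons//; exact: cL1_sum.
Qed.

(* Rotating by the phase of the integral makes it a real number. *)
Lemma le_cabs_cintegral f : cL1 f ->
  ((cabs (cintegral f))%:E <= \int[mu]_x (cabs (f x))%:E)%E.
Proof.
move=> fi; have [->|c0] := eqVneq (cintegral f) 0.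
  by rewrite cabs0 integral_ge0// => x _; rewrite lee_fin cabs_ge0.
set c := cabs (cintegral f).
have cn0 : c != 0 by apply: contra_neq c0 => /cabs0_eq0.
pose z := (cintegral f)^* * (c^-1)%:C.
have zE : complex.Re (z * cintegral f) = c.
  rewrite mulrAC [_^* * _]mulrC mulcJ -/c -rmorphM /=.
  by rewrite expr2 -mulrA divff// mulr1.
have z1 : cabs z = 1.
  by rewrite cabsM cabs_conj cabs_real ger0_norm ?invr_ge0 ?cabs_ge0// divff.
rewrite -zE -cintegralZ// /cintegral/=.
have zfi := cL1Z z fi.
rewrite /Rintegral fineK; last by apply: integrable_fin_num => //; exact: cL1_Re zfi.
apply: le_integral => //; [exact: cL1_Re zfi|exact: cL1_integrable|].
move=> x _; rewrite lee_fin (le_trans (ler_norm _))// (le_trans (cabs_Re _))//.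
by rewrite cabsM z1 mul1r.
Qed.

End ComplexIntegral.

(** * Translation and reflection invariance of the integral *)

Section Translation.
Context {R : realType}.
Notation mu := (@lebesgue_measure R).

Definition shiftr (a : R) : R -> R := fun x => x + a.

Lemma measurable_shiftr (a : R) : measurable_fun [set: R] (shiftr a).
Proof. by apply: measurable_funD => //; exact: measurable_cst. Qed.

(** The pushforward agrees with [mu] on half-open intervals, and these determine Lebesgue
    measure. *)
Lemma lebesgue_measure_shiftr (a : R) (A : set R) : measurable A ->
  pushforward mu (shiftr a : _ -> measurableTypeR R) A = mu A.
Proof.
move=> mA; apply/esym/lebesgue_measure_unique => //=.
  exact: measurable_shiftr.
move=> _ _ [[x y]] _ <-.
rewrite /pushforward.
have -> : shiftr a @^-1` `]x, y]%classic = `]x - a, y - a]%classic.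
  by apply/seteqP; split => z /=; rewrite !in_itv/= /shiftr ltrBlDr lerBrDr.
rewrite !lebesgue_measure_itv/= !lte_fin ltrD2r; case: ifPn => // _.
by rewrite -!EFinB; congr EFin; ring.
Qed.

Lemma ge0_integral_shiftr (a : R) (f : R -> \bar R) (D : set R) :
  measurable D -> measurable_fun [set: R] f ->
  (forall x, 0 <= f x)%E ->
  (\int[mu]_(x in [set x | D (x + a)%R]) f (x + a)%R = \int[mu]_(x in D) f x)%E.
Proof.
move=> mD mf f0.
rewrite (_ : [set x | D (x + a)%R] = (shiftr a : _ -> measurableTypeR R) @^-1` D)//.
rewrite -(@ge0_integral_pushforward _ _ (measurableTypeR R) (measurableTypeR R)
  R (shiftr a) (measurable_shiftr a) mu D f)//.
  apply: eq_measure_integral => //=; first exact: measurable_shiftr.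
  by move=> mf' A mA AS; exact: lebesgue_measure_shiftr.
exact: measurable_funS mf.
Qed.

Lemma ge0_integral_shiftrT (a : R) (f : R -> \bar R) :
  measurable_fun [set: R] f -> (forall x, 0 <= f x)%E ->
  (\int[mu]_x f (x + a)%R = \int[mu]_x f x)%E.
Proof. by move=> mf f0; rewrite -(ge0_integral_shiftr a _ mf). Qed.

Lemma ge0_integral_opp (f : R -> \bar R) :
  measurable_fun [set: R] f -> (forall x, 0 <= f x)%E ->
  (\int[mu]_x f (- x)%R = \int[mu]_x f x)%E.
Proof.
move=> mf f0.
rewrite -[in LHS](@preimage_setT _ _ (-%R : R -> measurableTypeR R)).
rewrite -(@ge0_integral_pushforward _ _ (measurableTypeR R) (measurableTypeR R)
  R -%R _ mu setT f)//.
by apply: eq_measure_integral => //= A mA AS; exact: lebesgue_measureN.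
Qed.

Lemma integral_shiftr (a : R) (f : R -> \bar R) :
  mu.-integrable setT f ->
  (\int[mu]_x f (x + a)%R = \int[mu]_x f x)%E.
Proof.
move=> fi; have mf := measurable_int _ fi.
rewrite integralE [RHS]integralE; congr (_ - _)%E.
  rewrite -(ge0_integral_shiftrT a (f := f^\+%E))//.
    by apply: eq_integral => x _; rewrite !funeposE.
  exact: measurable_funepos.
rewrite -(ge0_integral_shiftrT a (f := f^\-%E))//.
  by apply: eq_integral => x _; rewrite !funenegE.
exact: measurable_funeneg.
Qed.

Lemma cL1_shiftr (a : R) (f : R -> R[i]) : cL1 f -> cL1 (fun x => f (x + a)).
Proof.
move=> [mf fi]; split; first exact: (cmeas_comp mf (measurable_shiftr a)).
rewrite (@ge0_integral_shiftrT _ (fun x => (cabs (f x))%:E))//.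
  exact: measurable_cabsE.
by move=> x; rewrite lee_fin cabs_ge0.
Qed.

Lemma cintegral_shiftr (a : R) (f : R -> R[i]) : cL1 f ->
  cintegral (fun x => f (x + a)) = cintegral f.
Proof.
move=> fi; rewrite /cintegral /Rintegral; congr (fine _ +i* fine _).
  by rewrite (@integral_shiftr _ (fun x => (complex.Re (f x))%:E))//; exact: cL1_Re.
by rewrite (@integral_shiftr _ (fun x => (complex.Im (f x))%:E))//; exact: cL1_Im.
Qed.

Lemma sqnorm_shiftr (a : R) (f : R -> R[i]) : cmeas f ->
  sqnorm (fun x => f (x + a)) = sqnorm f.
Proof.
move=> mf; apply: (@ge0_integral_shiftrT _ (fun x => (cabs (f x) ^+ 2)%:E)).
  exact: measurable_sqcabsE.
by move=> x; rewrite lee_fin sqr_ge0.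
Qed.

End Translation.

(** * Unordered sums *)

Section Esum.
Context {R : realType}.

(** Enumerating a countable type turns the unordered sum into a series over [nat], where
    measurability and monotone convergence are at hand; numbers that encode no index contribute
    0. *)
Lemma esum_pickle (I : countType) (a : I -> \bar R) : (forall i, 0 <= a i)%E ->
  \esum_(i in [set: I]) a i =
  (\sum_(n <oo) (if @pickle_inv I n is Some i then a i else 0))%E.
Proof.
move=> a0; pose b (n : nat) := (if @pickle_inv I n is Some i then a i else 0)%E.
have b0 n : (0 <= b n)%E by rewrite /b; case: pickle_inv.
rewrite (nneseries_esumT b0).
transitivity (\esum_(n in range (@choice.pickle I)) b n).
  rewrite (@reindex_esum _ _ _ [set: I] _ (@choice.pickle I)).
    by apply: eq_esum => i _; rewrite /b pickleK_inv.
  split => //.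
rewrite esum_mkcond; apply: eq_esum => n _; case: ifPn => // nr.
rewrite /b; case E : pickle_inv => [i|//]; case/negP: nr; rewrite inE.
by exists i => //; have := @pickle_invK I n; rewrite E.
Qed.

Lemma esum_subset (I : choiceType) (A B : set I) (a : I -> \bar R) :
  (forall j, 0 <= a j)%E -> A `<=` B ->
  (\esum_(j in A) a j <= \esum_(j in B) a j)%E.
Proof.
move=> a0 AB; rewrite esum_mkcond [leRHS]esum_mkcond; apply: le_esum => i _.
case: ifPn => [/set_mem/AB iB|_]; first by rewrite mem_set.
by case: ifP.
Qed.

Lemma esumZ (I : countType) (A : set I) (a : I -> \bar R) (c : R) :
  0 <= c -> (forall j, 0 <= a j)%E ->
  \esum_(j in A) (c%:E * a j)%E = (c%:E * \esum_(j in A) a j)%E.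
Proof.
move=> c0 a0; rewrite esum_mkcond [in RHS]esum_mkcond.
have b0 j : (0 <= if j \in A then a j else 0)%E by case: ifP.
rewrite !esum_pickle//; last by move=> j; case: ifP; rewrite // mule_ge0.
rewrite -nneseriesZl; last by move=> i _; case: pickle_inv.
apply: eq_eseriesr => n _; case: pickle_inv => [i|]; last by rewrite mule0.
by case: ifP => //; rewrite mule0.
Qed.

(* A summable family has tails that are small uniformly over everything it dominates. *)
Lemma esum_tail (I : choiceType) (M : I -> \bar R) (e : R) :
  (forall i, 0 <= M i)%E -> (\esum_(i in [set: I]) M i < +oo)%E -> 0 < e ->
  exists2 J : set I, finite_set J & forall a : I -> \bar R,
    (forall i, 0 <= a i <= M i)%E ->
    (\esum_(i in [set: I]) a i <= \sum_(i \in J) a i + e%:E)%E.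
Proof.
move=> M0 Moo e0.
have Mfin : \esum_(i in [set: I]) M i \is a fin_num by rewrite ge0_fin_numE ?esum_ge0.
have [_ [J [finJ _] <-] JM] := ub_ereal_sup_adherent e0 Mfin.
exists J => // a aM; have a0 i : (0 <= a i)%E by case/andP: (aM i).
rewrite (esumID J) // setTI [X in (X + _)%E]esum_fset//.
rewrite leeD2l// setTI (@le_trans _ _ (\esum_(i in ~` J) M i))//.
  by apply: le_esum => i _; case/andP: (aM i).
move: JM; rewrite -/(esum [set: I] M) (esumID J) // !setTI esum_fset//.
have SJ0 : (0 <= \sum_(i \in J) M i)%E by rewrite fsume_ge0.
have SJ : \sum_(i \in J) M i \is a fin_num.
  rewrite ge0_fin_numE// (le_lt_trans _ Moo)// (esumID J)// !setTI esum_fset//.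
  by rewrite leeDl// esum_ge0.
rewrite lteBlDr// => h; apply: ltW; move: h.
by rewrite lteD2lE.
Qed.

Lemma esum_int_shift (a : int -> \bar R) (k : int) :
  \esum_(j in [set: int]) a (j + k) = \esum_(j in [set: int]) a j.
Proof.
rewrite [RHS](@reindex_esum _ _ _ [set: int] _ (fun j => j + k))//.
split => //; first by move=> x y _ _ /addIr.
by move=> j _; exists (j - k) => //; rewrite subrK.
Qed.

Lemma esum_int_opp (A : set int) (a : int -> \bar R) :
  (forall j, A j <-> A (- j)) ->
  \esum_(j in A) a (- j) = \esum_(j in A) a j.
Proof.
move=> AN; rewrite [RHS](@reindex_esum _ _ _ A _ (fun j => - j))//.
split => //; first by move=> j /AN.
  by move=> x y _ _ /oppr_inj.
by move=> j /AN Aj; exists (- j) => //; rewrite opprK.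
Qed.

Section IntegralEsum.
Context {d : measure_display} {T : measurableType d} (mu : {measure set T -> \bar R}).
Context (I : countType) (A : set I) (f : I -> T -> \bar R) (D : set T).
Hypothesis mD : measurable D.
Hypothesis mf : forall i, measurable_fun D (f i).
Hypothesis f0 : forall i x, (0 <= f i x)%E.

Let g n x := (if @pickle_inv I n is Some i then (if i \in A then f i x else 0) else 0)%E.

Let g0 n x : (0 <= g n x)%E.
Proof. by rewrite /g; case: pickle_inv => // i; case: ifP. Qed.

Let mg n : measurable_fun D (g n).
Proof.
rewrite /g; case: pickle_inv => [i|]; last exact: measurable_cst.
by case: (i \in A) => //; exact: measurable_cst.
Qed.

Let esum_g x : \esum_(i in A) f i x = (\sum_(n <oo) g n x)%E.
Proof.
by rewrite esum_mkcond esum_pickle// => j; case: ifP.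
Qed.

Lemma measurable_esum : measurable_fun D (fun x => \esum_(i in A) f i x).
Proof.
under eq_fun do rewrite esum_g.
have := @ge0_emeasurable_sum _ _ _ D g predT (fun k x _ _ => g0 k x) (fun k _ => mg k).
by [].
Qed.

(** Tonelli for counting measure on [A], reduced to monotone convergence along the enumeration. *)
Lemma ge0_integral_esum :
  (\int[mu]_(x in D) (\esum_(i in A) f i x)%R)%E =
  \esum_(i in A) (\int[mu]_(x in D) f i x)%E.
Proof.
under eq_integral do rewrite esum_g.
rewrite integral_nneseries// esum_mkcond esum_pickle.
  apply: eq_eseriesr => n _; rewrite /g; case: pickle_inv => [i|].
    by case: ifP => // _; rewrite integral0.
  by rewrite integral0.
by move=> i; case: ifP => // _; rewrite integral_ge0.
Qed.

End IntegralEsum.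

End Esum.

(** * Tiling the line by cells *)

Section Cells.
Context {R : realType}.
Notation mu := (@lebesgue_measure R).

Lemma esum_single (I : choiceType) (a : I -> \bar R) (i : I) : (0 <= a i)%E ->
  (forall j, j != i -> a j = 0%E) -> \esum_(j in [set: I]) a j = a i.
Proof.
move=> ai0 aj0; rewrite -(esum_set1 ai0) [RHS]esum_mkcond.
apply: eq_esum => j _; case: ifPn => //; rewrite notin_setE/= => ji.
by rewrite aj0//; apply/eqP.
Qed.

(** This unfolding drives every periodization argument below; the free origin [a] allows a cell
    centred at 0. *)
Lemma ge0_integral_cells (a c : R) (f : R -> \bar R) : 0 < c ->
  measurable_fun [set: R] f -> (forall x, 0 <= f x)%E ->
  (\int[mu]_x f x)%E = \esum_(k in [set: int])
    (\int[mu]_(x in `[a, (a + c)%R[) f (x + k%:~R * c)%R)%E.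
Proof.
move=> c0 mf f0.
pose E (k : int) := `[a + k%:~R * c, a + k%:~R * c + c[%classic.
have mE k : measurable (E k) by exact: measurable_itv.
(* Exactly one tile contains [x], that of index [floor ((x - a) / c)]. *)
have fE x : f x = \esum_(k in [set: int]) (f \_ (E k)) x.
  pose k0 := Num.floor ((x - a) / c).
  have E0 : E k0 x.
    have /andP[] := floor_itv ((x - a) / c).
    rewrite ler_pdivlMr// ltr_pdivrMr// -/k0 /E /= in_itv/= => h1 h2.
    apply/andP; split; first by lra.
    by move: h2; rewrite rmorphD/= mulrDl mul1r; lra.
  rewrite (@esum_single _ _ k0).
  - by rewrite patchE mem_set.
  - by rewrite patchE; case: ifP.
  move=> k kk0; rewrite patchE memNset// /E/= in_itv/= => /andP[h1 h2].
  case/eqP: kk0; apply/esym/eqP; rewrite floor_eq//.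
  by rewrite ler_pdivlMr// ltr_pdivrMr// rmorphD/= mulrDl mul1r; apply/andP; split; lra.
rewrite [in LHS](funext fE).
rewrite ge0_integral_esum//.
- apply: eq_esum => k _; rewrite -integral_mkcond.
  rewrite -(@ge0_integral_shiftr _ (k%:~R * c) f (E k))//.
  suff -> : [set x | E k (x + k%:~R * c)] = `[a, a + c[%classic by [].
  apply/seteqP; split => x; rewrite /E/= !in_itv/= => /andP[h1 h2]; apply/andP; split; lra.
- move=> k; apply/(measurable_restrictT _ _).1; first exact: mE.
  exact: measurable_funS mf.
- by move=> k x; rewrite patchE; case: ifP.
Qed.

End Cells.

(** * Dominated convergence *)

Section Convergence.
Context {R : realType}.
Notation mu := (@lebesgue_measure R).
Implicit Types (f g : R -> R[i]).

Lemma cvge0_lt (u : nat -> \bar R) (e : R) : u @ \oo --> 0%E -> 0 < e ->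
  \forall n \near \oo, (u n < e%:E)%E.
Proof.
move=> /fine_cvgP[ufin /cvgr0Pnorm_lt u0] e0; have ue := u0 _ e0.
near=> n; rewrite -[u n]fineK; last by near: n.
by rewrite lte_fin (le_lt_trans (ler_norm _))//; near: n.
Unshelve. all: by end_near. Qed.

Lemma cvg_integral0 (u : nat -> R -> R) (h : R -> R) (D : set R) : measurable D ->
  (forall n, measurable_fun [set: R] (u n)) ->
  measurable_fun [set: R] h ->
  (forall n x, 0 <= u n x <= h x) ->
  (\int[mu]_(x in D) (h x)%:E < +oo)%E ->
  (forall x, D x -> (fun n => u n x) @ \oo --> (0 : R)) ->
  (fun n => \int[mu]_(x in D) (u n x)%:E)%E @ \oo --> (0 : \bar R).
Proof.
move=> mD mu_ mh uh hoo u0.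
have h0 x : 0 <= h x by have /andP[/le_trans] := uh 0%N x; apply.
have [] := @dominated_convergence _ _ _ mu D mD (fun n x => (u n x)%:E) (cst 0%E) (fun x => (h x)%:E).
- by move=> n; apply/measurable_EFinP; exact: measurable_funS (mu_ n).
- exact: measurable_cst.
- by apply: aeW => x Dx; apply: cvg_EFin; [exact: nearW|exact: u0].
- apply/integrableP; split; first by apply/measurable_EFinP; exact: measurable_funS mh.
  by under eq_integral do rewrite gee0_abs ?lee_fin//.
- apply: aeW => x n _; rewrite gee0_abs ?lee_fin; first by case/andP: (uh n x).
  by case/andP: (uh n x).
- by move=> _ _; rewrite integral0.
Qed.

Lemma cvg_cintegral (F : nat -> R -> R[i]) f (h : R -> R) :
  (forall n, cmeas (F n)) -> cmeas f -> measurable_fun [set: R] h ->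
  (forall n x, cabs (F n x) <= h x) ->
  (\int[mu]_x (h x)%:E < +oo)%E ->
  (forall x, (fun n => cabs (F n x - f x)) @ \oo --> (0 : R)) ->
  (fun n => cabs (cintegral (F n) - cintegral f)) @ \oo --> (0 : R).
Proof.
move=> mF mf mh Fh hoo Ff.
have fh x : cabs (f x) <= h x.
  apply/ler_addgt0Pr => e e0; have /cvgr0Pnorm_lt/(_ e e0) [n _ /(_ n (leqnn n))/=] := Ff x.
  rewrite ger0_norm ?cabs_ge0// => hn.
  rewrite -(subKr (F n x) (f x)) (le_trans (cabsB _ _))// lerD//.
  exact: ltW.
have F1 n : cL1 (F n).
  apply: (@cL1_le _ _ (fun x => (h x)%:E)) => //; first exact/measurable_EFinP.
  by move=> x; rewrite lee_fin.
have f1 : cL1 f.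
  by apply: (@cL1_le _ _ (fun x => (h x)%:E)) => //; exact/measurable_EFinP.
have h0 x : 0 <= h x by exact: le_trans (cabs_ge0 (f x)) (fh x).
have : (fun n => \int[mu]_x (cabs (F n x - f x))%:E)%E @ \oo --> (0 : \bar R).
  apply: (@cvg_integral0 _ (fun x => 2 * h x)) => //.
  - by move=> n; apply: measurable_cabs; exact: cmeasB.
  - by apply: measurable_funM => //; exact: measurable_cst.
  - move=> n x; rewrite cabs_ge0/= (le_trans (cabsB _ _))//.
    by rewrite mulr2n mulrDl mul1r lerD.
  - under eq_integral do rewrite EFinM.
    rewrite ge0_integralZl//; first by rewrite lte_mul_pinfty// ge0_fin_numE ?integral_ge0.
    + exact/measurable_EFinP.
    + by move=> x _; rewrite lee_fin.
move=> H0; apply/cvgr0Pnorm_lt => e e0.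
have [N _ HN] : \forall n \near \oo, (\int[mu]_x (cabs (F n x - f x))%:E < e%:E)%E.
  exact: cvge0_lt.
exists N => // n /HN /= hn; rewrite ger0_norm ?cabs_ge0//.
rewrite -lte_fin (le_lt_trans _ hn)// -cintegralB//.
by apply: le_cabs_cintegral; exact: cL1B.
Qed.

End Convergence.

(** * Square-integrable functions *)

Section L2.
Context {R : realType}.
Implicit Types (f g : R -> R[i]) (z : R[i]).
Notation mu := (@lebesgue_measure R).

Lemma sqnorm_ge0 f : (0 <= sqnorm f)%E.
Proof. by apply: integral_ge0 => x _; rewrite lee_fin sqr_ge0. Qed.

Lemma Lpnorm2E f : Lpnorm 2%:E f = ((sqnorm f) `^ 2^-1)%E.
Proof.
rewrite /Lpnorm unlock /sqnorm; congr (_ `^ _)%E; apply: eq_integral => x _.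
by rewrite gee0_abs ?lee_fin ?cabs_ge0// poweR_EFin powR_mulrn// cabs_ge0.
Qed.

Lemma in_Lp2P f : in_Lp 2%:E f <-> cL2 f.
Proof.
rewrite /in_Lp Lpnorm2E; split => [[m1 m2 h]|[[m1 m2] h]]; split => //.
  by apply: (@lty_poweRy _ _ 2^-1).
exact: poweR_lty.
Qed.

Lemma in_Lp1P f : in_Lp 1%:E f <-> cL1 f.
Proof.
have E : Lpnorm 1%:E f = (\int[mu]_x (cabs (f x))%:E)%E.
  rewrite /Lpnorm Lnorm1; apply: eq_integral => x _.
  by rewrite gee0_abs ?lee_fin ?cabs_ge0.
by rewrite /in_Lp E; split => [[m1 m2 h]|[[m1 m2] h]]; split.
Qed.

Lemma cL2_fin_num f : cL2 f -> sqnorm f \is a fin_num.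
Proof. by case=> _ h; rewrite ge0_fin_numE// sqnorm_ge0. Qed.

Lemma sqnorm_fine f : cL2 f -> sqnorm f = (fine (sqnorm f))%:E.
Proof. by move=> /cL2_fin_num/fineK. Qed.

Lemma fine_sqnorm_ge0 f : 0 <= fine (sqnorm f).
Proof. by rewrite fine_ge0// sqnorm_ge0. Qed.

Lemma norm2_sqr f : norm2 f ^+ 2 = fine (sqnorm f).
Proof.
rewrite /norm2 Lpnorm2E; have := sqnorm_ge0 f; case: (sqnorm f) => [r r0||]//=.
  by rewrite -powR_mulrn ?powR_ge0// -powRrM mulVf// powRr1.
by rewrite ifN ?invr_eq0 ?expr0n.
Qed.

Lemma sqnormZ z f : cmeas f -> sqnorm (fun x => z * f x) = ((cabs z ^+ 2)%:E * sqnorm f)%E.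
Proof.
move=> mf; rewrite /sqnorm -ge0_integralZl//.
- by apply: eq_integral => x _; rewrite cabsM exprMn EFinM.
- exact: measurable_sqcabsE.
- by move=> x _; rewrite lee_fin sqr_ge0.
- by rewrite lee_fin sqr_ge0.
Qed.

Lemma sqnormN f : sqnorm (fun x => - f x) = sqnorm f.
Proof. by apply: eq_integral => x _; rewrite cabsN. Qed.

Lemma sqr_cabsD z w : cabs (z + w) ^+ 2 <= 2 * cabs z ^+ 2 + 2 * cabs w ^+ 2 :> R.
Proof.
have h : cabs (z + w) ^+ 2 <= (cabs z + cabs w) ^+ 2.
  by rewrite ler_pXn2r// ?nnegrE ?addr_ge0 ?cabs_ge0// cabsD.
by rewrite (le_trans h)//; have := sqr_ge0 (cabs z - cabs w); nra.
Qed.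

Lemma le_sqnormD f g : cmeas f -> cmeas g ->
  (sqnorm (fun x => f x + g x)%R <= 2%:E * sqnorm f + 2%:E * sqnorm g)%E.
Proof.
move=> mf mg.
have sq0 (h : R -> R[i]) x : (0 <= (cabs (h x) ^+ 2)%:E)%E by rewrite lee_fin sqr_ge0.
rewrite /sqnorm -!ge0_integralZl//; try exact: measurable_sqcabsE.
rewrite -ge0_integralD//; first last.
- by apply: emeasurable_funM; [exact: measurable_cst|exact: measurable_sqcabsE].
- by move=> x _; rewrite mule_ge0.
- by apply: emeasurable_funM; [exact: measurable_cst|exact: measurable_sqcabsE].
- by move=> x _; rewrite mule_ge0.
apply: ge0_le_integral => //.
- by move=> x _; rewrite lee_fin sqr_ge0.
- by apply: measurable_sqcabsE; exact: cmeasD.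
- apply: emeasurable_funD; apply: emeasurable_funM;
    by [exact: measurable_cst|exact: measurable_sqcabsE].
- by move=> x _; rewrite -!EFinM -EFinD lee_fin sqr_cabsD.
Qed.

Lemma cL2D f g : cL2 f -> cL2 g -> cL2 (fun x => f x + g x).
Proof.
move=> [mf fi] [mg gi]; split; first exact: cmeasD.
by rewrite (le_lt_trans (le_sqnormD mf mg))// lte_add_pinfty// lte_mul_pinfty//
  ge0_fin_numE ?sqnorm_ge0.
Qed.

Lemma cL2Z z f : cL2 f -> cL2 (fun x => z * f x).
Proof.
move=> [mf fi]; split; first by apply: cmeasM => //; exact: cmeas_cst.
by rewrite sqnormZ// lte_mul_pinfty ?lee_fin ?sqr_ge0// ge0_fin_numE ?sqnorm_ge0.
Qed.

Lemma cL2N f : cL2 f -> cL2 (fun x => - f x).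
Proof. by move=> [mf fi]; split; [exact: cmeasN|rewrite sqnormN]. Qed.

Lemma cL2B f g : cL2 f -> cL2 g -> cL2 (fun x => f x - g x).
Proof. by move=> fi gi; apply: cL2D => //; exact: cL2N. Qed.

Lemma cL20 : cL2 (fun=> 0 : R[i]).
Proof.
split; first exact: cmeas_cst.
by rewrite /sqnorm; under eq_integral do rewrite cabs0 expr0n/=; rewrite integral0.
Qed.

Lemma cL2_sum (I : Type) (s : seq I) (F : I -> R -> R[i]) :
  (forall i, cL2 (F i)) -> cL2 (fun x => \sum_(i <- s) F i x).
Proof.
move=> mF; elim: s => [|i s ih].
  by under eq_fun do rewrite big_nil; exact: cL20.
by under eq_fun do rewrite big_cons; exact: cL2D.
Qed.

Lemma cL2_shiftr (a : R) f : cL2 f -> cL2 (fun x => f (x + a)).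
Proof.
move=> [mf fi]; split; first exact: (cmeas_comp mf (measurable_shiftr a)).
by rewrite sqnorm_shiftr.
Qed.

Lemma le_sqnorm f g : cmeas f -> cmeas g -> (forall x, cabs (f x) <= cabs (g x)) ->
  (sqnorm f <= sqnorm g)%E.
Proof.
move=> mf mg fg; apply: ge0_le_integral => //.
- by move=> x _; rewrite lee_fin sqr_ge0.
- exact: measurable_sqcabsE.
- exact: measurable_sqcabsE.
- by move=> x _; rewrite lee_fin ler_pXn2r// ?nnegrE ?cabs_ge0.
Qed.

Lemma cL2_bM f g : cmeas f -> (forall x, cabs (f x) = 1) -> cL2 g ->
  cL2 (fun x => f x * g x).
Proof.
move=> mf f1 [mg gi]; split; first exact: cmeasM.
rewrite (le_lt_trans _ gi)//; apply: le_sqnorm => //; first exact: cmeasM.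
by move=> x; rewrite cabsM f1 mul1r.
Qed.

Lemma cL2J f : cL2 f -> cL2 (fun x => (f x)^*).
Proof.
move=> [mf fi]; split; first exact: cmeasJ.
by rewrite /sqnorm; under eq_integral do rewrite cabs_conj.
Qed.

Lemma le_integral_cabsM f g : cmeas f -> cmeas g ->
  (\int[mu]_x (cabs (f x) * cabs (g x))%:E <= sqnorm f `^ 2^-1 * sqnorm g `^ 2^-1)%E.
Proof.
move=> mf mg.
have := @hoelder _ _ _ mu (fun x => cabs (f x)) (fun x => cabs (g x)) 2 2
  (measurable_cabs mf) (measurable_cabs mg).
have h2 : 2^-1 + 2^-1 = 1 :> R by rewrite [RHS]splitr !div1r.
move=> /(_ ltac:(by []) ltac:(by []) h2).
rewrite -!Lpnorm2E /Lpnorm Lnorm1; apply: le_trans; apply: ge0_le_integral => //.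
- by move=> x _; rewrite lee_fin mulr_ge0 ?cabs_ge0.
- by apply/measurable_EFinP; apply: measurable_funM; exact: measurable_cabs.
- apply: measurableT_comp => //; apply/measurable_EFinP.
  by apply: measurable_funM; exact: measurable_cabs.
- by move=> x _; rewrite gee0_abs// lee_fin mulr_ge0 ?cabs_ge0.
Qed.

Lemma cL2M f g : cL2 f -> cL2 g -> cL1 (fun x => f x * g x).
Proof.
move=> [mf fi] [mg gi]; split; first exact: cmeasM.
under eq_integral do rewrite cabsM.
apply: (le_lt_trans (le_integral_cabsM mf mg)).
by rewrite lte_mul_pinfty ?poweR_ge0 ?poweR_lty// ge0_fin_numE ?poweR_ge0// poweR_lty.
Qed.

Lemma cL2MJ f g : cL2 f -> cL2 g -> cL1 (fun x => f x * (g x)^*).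
Proof. by move=> fi gi; apply: cL2M => //; exact: cL2J. Qed.

Lemma cauchy_schwarz f g : cL2 f -> cL2 g ->
  cabs (inner f g) ^+ 2 <= fine (sqnorm f) * fine (sqnorm g).
Proof.
move=> fi gi.
have h : ((cabs (inner f g))%:E <= sqnorm f `^ 2^-1 * sqnorm g `^ 2^-1)%E.
  apply: le_trans (le_cabs_cintegral (cL2MJ fi gi)) _.
  under eq_integral do rewrite cabsM cabs_conj.
  exact: le_integral_cabsM fi.1 gi.1.
move: h; rewrite (sqnorm_fine fi) (sqnorm_fine gi) !poweR_EFin -EFinM lee_fin /= => h.
have f0 := fine_sqnorm_ge0 f; have g0 := fine_sqnorm_ge0 g.
rewrite -powRM// in h.
have -> : fine (sqnorm f) * fine (sqnorm g) =
    ((fine (sqnorm f) * fine (sqnorm g)) `^ 2^-1) ^+ 2.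
  by rewrite -powR_mulrn ?powR_ge0// -powRrM mulVf// powRr1// mulr_ge0.
by rewrite ler_pXn2r// ?nnegrE ?cabs_ge0 ?powR_ge0.
Qed.

Lemma innerDl f g h : cL2 f -> cL2 g -> cL2 h ->
  inner (fun x => f x + g x) h = inner f h + inner g h.
Proof.
move=> fi gi hi; rewrite /inner -cintegralD; [|exact: cL2MJ..].
by apply: eq_cintegral => x; rewrite mulrDl.
Qed.

Lemma innerZl z f h : cL2 f -> cL2 h ->
  inner (fun x => z * f x) h = z * inner f h.
Proof.
move=> fi hi; rewrite /inner -cintegralZ; last exact: cL2MJ.
by apply: eq_cintegral => x; rewrite mulrA.
Qed.

Lemma innerBl f g h : cL2 f -> cL2 g -> cL2 h ->
  inner (fun x => f x - g x) h = inner f h - inner g h.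
Proof.
move=> fi gi hi; rewrite /inner -cintegralB; [|exact: cL2MJ..].
by apply: eq_cintegral => x; rewrite mulrBl.
Qed.

Lemma inner_suml (I : Type) (s : seq I) (F : I -> R -> R[i]) h :
  (forall i, cL2 (F i)) -> cL2 h ->
  inner (fun x => \sum_(i <- s) F i x) h = \sum_(i <- s) inner (F i) h.
Proof.
move=> Fi hi; rewrite /inner -cintegral_sum; last by move=> i; exact: cL2MJ.
by apply: eq_cintegral => x; rewrite mulr_suml.
Qed.

Lemma innerC f g : cL2 f -> cL2 g -> inner g f = (inner f g)^*.
Proof.
move=> fi gi; rewrite /inner -cintegralJ; last exact: cL2MJ.
by apply: eq_cintegral => x; rewrite rmorphM/= conjcK mulrC.
Qed.

Lemma inner_self f : cL2 f -> inner f f = (fine (sqnorm f))%:C.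
Proof.
move=> fi; rewrite /inner; under eq_cintegral do rewrite mulcJ.
rewrite /cintegral /=; congr (_ +i* _).
by rewrite /Rintegral integral0.
Qed.

End L2.

(** * Polynomial decay and lattice sums *)

Section Decay.
Context {R : realType}.
Notation mu := (@lebesgue_measure R).
Implicit Types (s t x b : R).

Definition decay s t : R := (1 + `|t|) `^ (- s).

Lemma decay_ge0 s t : 0 <= decay s t.
Proof. exact: powR_ge0. Qed.

Lemma decayN s t : decay s (- t) = decay s t.
Proof. by rewrite /decay normrN. Qed.

Lemma powRN_le (x y s : R) : 0 <= s -> 0 < x -> x <= y -> y `^ (- s) <= x `^ (- s).
Proof.
move=> s0 x0 xy; have y0 := lt_le_trans x0 xy.
rewrite !powRN lef_pV2 ?posrE ?powR_gt0//.
by apply: ge0_ler_powR; rewrite // nnegrE ltW.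
Qed.

Lemma decay_le s t u : 0 <= s -> `|t| <= `|u| -> decay s u <= decay s t.
Proof. by move=> s0 tu; rewrite powRN_le// ?lerD2l// ltr_wpDr. Qed.

Lemma decay_le1 s t : 0 <= s -> decay s t <= 1.
Proof.
move=> s0; have -> : (1 : R) = decay s 0 by rewrite /decay normr0 addr0 powR1.
by apply: decay_le => //; rewrite normr0.
Qed.

Lemma decay_lerD (s t : R) x : s <= t -> decay t x <= decay s x.
Proof. by move=> st; rewrite ler_powR ?lerN2// lerDl. Qed.

Lemma ler_sum_powRN (b s : R) n : 0 < b -> 1 < s ->
  \sum_(0 <= i < n) (1 + b * i.+1%:R) `^ (- s) <= ((s - 1) * b)^-1.
Proof.
move=> b0 s1; have sg0 : 0 < s - 1 by lra.
pose u i : R := (1 + b * i%:R) `^ (- (s - 1)).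
have p0 (i : nat) : 0 < 1 + b * i%:R by rewrite ltr_pwDl// mulr_ge0// ltW.
have step i : (s - 1) * b * (1 + b * i.+1%:R) `^ (- s) <= - (u i.+1 - u i).
  set y := 1 + b * i.+1%:R; have y0 : 0 < y by exact: p0.
  have xy : 1 + b * i%:R = y - b by rewrite /y -natr1; ring.
  have x0 : 0 < y - b by rewrite -xy.
  have E : y `^ (- s) = y `^ (- (s - 1)) * y^-1.
    rewrite -(powR_inv1 (ltW y0)) -powRD; first by congr (_ `^ _); ring.
    by rewrite (gt_eqF y0) implybT.
  rewrite opprB /u xy -/y E.
  (* Bernoulli's inequality for a negative exponent, from [1 + x <= expR x] and
     [ln (1 + x) <= x]. *)
  have L : (y - b) `^ (- (s - 1)) >= y `^ (- (s - 1)) * (1 + (s - 1) * (b / y)).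
    have -> : y - b = y * (1 - b / y) by rewrite mulrBr mulr1 mulrCA divff ?gt_eqF// mulr1.
    have z0 : 0 < 1 - b / y by rewrite subr_gt0 ltr_pdivrMr// mul1r -subr_gt0.
    rewrite powRM ?(ltW y0) ?(ltW z0)// ler_wpM2l ?powR_ge0//.
    rewrite /powR (gt_eqF z0) (le_trans (expR_ge1Dx _))//=.
    rewrite ler_expR mulNr -mulrN ler_wpM2l ?(ltW sg0)//.
    rewrite lerNr; apply: le_ln1Dx.
    by rewrite ltrN2 ltr_pdivrMr// mul1r -subr_gt0.
  by move: L; rewrite mulrDr mulr1; lra.
rewrite -(ler_pM2l (mulr_gt0 sg0 b0)) mulfV ?gt_eqF ?mulr_gt0//.
rewrite mulr_sumr (le_trans (ler_sum _ (fun i _ => step i)))//.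
rewrite sumrN telescope_sumr// opprB /u mulr0 addr0 powR1.
by rewrite gerBl powR_ge0.
Qed.

(* Translating by a multiple of [b] one may take [0 <= x < b]. *)
Lemma lattice_sum_decay (b s : R) : 0 < b -> 1 < s ->
  exists2 C : R, 0 < C & forall x,
    (\esum_(j in [set: int]) (decay s (x + j%:~R * b))%:E <= C%:E)%E.
Proof.
move=> b0 s1; have s0 : 0 <= s by lra.
pose h (n : nat) : R := (1 + b * n%:R) `^ (- s).
have h0 n : 0 <= h n by exact: powR_ge0.
have hS : (\sum_(n <oo) (h n)%:E <= (1 + ((s - 1) * b)^-1)%:E)%E.
  apply: lime_le; first by apply: is_cvg_nneseries => n _ _; rewrite lee_fin.
  apply: nearW => n; rewrite sumEFin lee_fin; case: n => [|n].
    rewrite big_nil addr_ge0// invr_ge0 mulr_ge0 ?(ltW b0)//; lra.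
  rewrite big_nat_recl//= lerD//; first by rewrite /h mulr0 addr0 powR1.
  exact: ler_sum_powRN.
(* Once [0 <= r < b], the point [r + j * b] has modulus at least [m j * b]; for [j = Negz n], that
   is [-(n + 1)], one step is lost to [r]. Each half-line thus contributes one copy of [h], whence
   the factor 2 in the constant. *)
pose m (j : int) : nat := match j with Posz n => n | Negz n => n end.
exists (2 * (1 + ((s - 1) * b)^-1)).
  rewrite mulr_gt0// ltr_pwDl// invr_ge0 mulr_ge0 ?(ltW b0)//; lra.
move=> x; pose q := Num.floor (x / b); pose r := x - q%:~R * b.
have /andP[r0 rb] : 0 <= r < b.
  have /andP[] := floor_itv (x / b).
  rewrite ler_pdivlMr// ltr_pdivrMr// -/q rmorphD/= mulrDl mul1r /r => ? ?.
  by apply/andP; split; lra.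
have -> : \esum_(j in [set: int]) (decay s (x + j%:~R * b))%:E =
    \esum_(j in [set: int]) (decay s (r + j%:~R * b))%:E.
  rewrite -(esum_int_shift (fun j => (decay s (r + j%:~R * b))%:E) q).
  by apply: eq_esum => j _; rewrite /r rmorphD/= mulrDl; congr (decay s _)%:E; ring.
clearbody r; apply: (@le_trans _ _ (\esum_(j in [set: int]) (h (m j))%:E)).
  apply: le_esum => j _; rewrite lee_fin /h /decay powRN_le//.
    by rewrite ltr_pwDl// mulr_ge0// ltW.
  rewrite lerD2l; case: j => n /=.
    rewrite -[n%:~R]/(n%:R : R) ger0_norm ?addr_ge0 ?mulr_ge0 ?(ltW b0)//.
    by rewrite mulrC lerDr.
  rewrite NegzE mulrNz -[(n.+1)%:~R]/(n.+1%:R : R).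
  rewrite -normrN ler_normr; apply/orP; left.
  by rewrite -natr1; nra.
have -> : \esum_(j in [set: int]) (h (m j))%:E =
    (\esum_(n in [set: nat]) (h n)%:E + \esum_(n in [set: nat]) (h n)%:E)%E.
  rewrite (esumID [set j : int | (0 <= j)%R]); last by move=> j _; rewrite lee_fin.
  rewrite !setTI; congr (_ + _)%E.
    rewrite (@reindex_esum _ _ _ [set: nat] _ Posz)//.
    by split => //; [move=> n p _ _ []|case=> // n _; exists n].
  rewrite (@reindex_esum _ _ _ [set: nat] _ Negz)//.
  split => //; [move=> n p _ _ []//|case=> [n|n _]; last by exists n].
  by case.
rewrite -nneseries_esumT; last by move=> n; rewrite lee_fin.
by rewrite mulr2n mulrDl mul1r EFinD leeD.
Qed.

Lemma measurable_decay s : measurable_fun [set: R] (decay s).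
Proof.
apply: (measurableT_comp (measurable_powR (- s))).
by apply: measurable_funD => //; exact: measurable_cst.
Qed.

(** Folding onto the unit cell turns the integral into that of a bounded lattice sum. *)
Lemma decay_integrable s : 1 < s -> (\int[mu]_x (decay s x)%:E < +oo)%E.
Proof.
move=> s1; have [C C0 CP] := lattice_sum_decay ltr01 s1.
rewrite (@ge0_integral_cells _ 0 1)//.
- rewrite -ge0_integral_esum//.
  + apply: (@le_lt_trans _ _ (\int[mu]_(x in `[0%R, (0 + 1)%R[) C%:E)%E).
      apply: ge0_le_integral => //.
      * by move=> x _; apply: esum_ge0 => k _; rewrite lee_fin decay_ge0.
      * apply: measurable_esum => //; last by move=> k x; rewrite lee_fin decay_ge0.
        move=> k; apply/measurable_EFinP/(@measurable_funS _ _ _ _ setT) => //.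
        exact: (measurableT_comp (measurable_decay s) (measurable_shiftr _)).
    rewrite integral_cst//= lebesgue_measure_itv/= add0r lte_fin ltr01 -EFinD -EFinM.
    by rewrite ltry.
  + move=> k; apply/measurable_EFinP/(@measurable_funS _ _ _ _ setT) => //.
    exact: (measurableT_comp (measurable_decay s) (measurable_shiftr _)).
  + by move=> k x; rewrite lee_fin decay_ge0.
- by apply/measurable_EFinP; exact: measurable_decay.
- by move=> x; rewrite lee_fin decay_ge0.
Qed.

Lemma decay_cL1 (f : R -> R[i]) (C s : R) : 1 < s -> cmeas f ->
  (forall t, cabs (f t) <= C * decay s t) -> cL1 f.
Proof.
move=> s1 mf fC; apply: (@cL1_le _ _ (fun t => C%:E * (decay s t)%:E)%E) => //.
- by apply: emeasurable_funM; [exact: measurable_cst|apply/measurable_EFinP; exact: measurable_decay].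
- have C0 : 0 <= C.
    have := le_trans (cabs_ge0 _) (fC 0).
    by rewrite pmulr_lge0// /decay normr0 addr0 powR1.
  rewrite ge0_integralZl//.
  + rewrite lte_mul_pinfty// ?decay_integrable// ge0_fin_numE ?decay_integrable//.
  + by apply/measurable_EFinP; exact: measurable_decay.
  + by move=> x _; rewrite lee_fin decay_ge0.
Qed.

End Decay.

(** * The Fourier transform of integrable functions *)

Section Fourier.
Context {R : realType}.
Notation mu := (@lebesgue_measure R).
Implicit Types (f g F G : R -> R[i]) (w x y s t : R).

Definition ccont F := continuous (fun x => complex.Re (F x)) /\
  continuous (fun x => complex.Im (F x)).

Lemma ccont_dist F s (e : R) : ccont F -> 0 < e ->
  exists2 d : R, 0 < d & forall t, `|t - s| < d -> cabs (F t - F s) < e.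
Proof.
move=> [F1 F2] e0; have e20 : 0 < e / 2 by rewrite divr_gt0.
have /cvgrPdist_lt/(_ _ e20) h1 := F1 s.
have /cvgrPdist_lt/(_ _ e20) h2 := F2 s.
have /nbhs_ballP[d d0 dP] : \forall t \near s,
    `|complex.Re (F s) - complex.Re (F t)| < e / 2 /\
    `|complex.Im (F s) - complex.Im (F t)| < e / 2.
  by near=> t; split; near: t.
exists d => // t ts; have [|a b] := dP t; first by rewrite /ball/= distrC.
rewrite cabsC (le_lt_trans (cabs_le_ReIm _))// cReD cImD cReN cImN.
by rewrite [ltRHS]splitr ltrD.
Unshelve. all: by end_near. Qed.

Lemma ccont_seq F (u : nat -> R) s : ccont F -> u @ \oo --> s ->
  (fun n => cabs (F (u n) - F s)) @ \oo --> (0 : R).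
Proof.
move=> Fc us; apply/cvgr0Pnorm_lt => e e0; have [d d0 dP] := ccont_dist s Fc e0.
have /cvgrPdist_lt/(_ _ d0) h := us.
near=> n; rewrite ger0_norm ?cabs_ge0// dP//.
by rewrite distrC; near: n.
Unshelve. all: by end_near. Qed.

Lemma ccont_cmeas F : ccont F -> cmeas F.
Proof. by move=> [F1 F2]; split; exact: continuous_measurable_fun. Qed.

Lemma ccontD F G : ccont F -> ccont G -> ccont (fun x => F x + G x).
Proof.
move=> [F1 F2] [G1 G2]; split => x.
  by under eq_fun do rewrite cReD; apply: cvgD; [exact: F1|exact: G1].
by under eq_fun do rewrite cImD; apply: cvgD; [exact: F2|exact: G2].
Qed.

Lemma ccontM F G : ccont F -> ccont G -> ccont (fun x => F x * G x).
Proof.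
move=> [F1 F2] [G1 G2]; split => x.
  under eq_fun do rewrite cReM; apply: cvgB; apply: cvgM;
    by [exact: F1|exact: G1|exact: F2|exact: G2].
under eq_fun do rewrite cImM; apply: cvgD; apply: cvgM;
  by [exact: F1|exact: G1|exact: F2|exact: G2].
Qed.

Lemma ccontJ F : ccont F -> ccont (fun x => (F x)^*).
Proof.
move=> [F1 F2]; split => x; first by under eq_fun do rewrite cReJ; exact: F1.
by under eq_fun do rewrite cImJ; apply: cvgN; exact: F2.
Qed.

Lemma ccont_cst (z : R[i]) : ccont (fun=> z).
Proof. by split => x; exact: cvg_cst. Qed.

Lemma ccont_sum (I : Type) (s : seq I) (F : I -> R -> R[i]) :
  (forall i, ccont (F i)) -> ccont (fun x => \sum_(i <- s) F i x).
Proof.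
move=> Fc; elim: s => [|i s ih].
  by under eq_fun do rewrite big_nil; exact: ccont_cst.
by under eq_fun do rewrite big_cons; exact: ccontD.
Qed.

Lemma ccont_comp F (h : R -> R) : ccont F -> continuous h -> ccont (fun x => F (h x)).
Proof.
move=> [F1 F2] hc; split => x.
  by apply: (@continuous_comp _ _ _ h (fun y => complex.Re (F y))); [exact: hc|exact: F1].
by apply: (@continuous_comp _ _ _ h (fun y => complex.Im (F y))); [exact: hc|exact: F2].
Qed.

Lemma ccont_cexpi (h : R -> R) : continuous h -> ccont (fun x => cexpi (h x)).
Proof.
move=> hc; apply: (@ccont_comp (@cexpi R)) => //; split => x.
  exact: continuous_cos.
exact: continuous_sin.
Qed.

Lemma continuous_mull (a : R) : continuous (fun x : R => a * x).
Proof. by move=> x; apply: cvgM; [exact: cvg_cst|exact: cvg_id]. Qed.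

Definition L1norm f : R := fine (\int[mu]_x (cabs (f x))%:E).

Lemma L1norm_fine f : cL1 f -> (\int[mu]_x (cabs (f x))%:E)%E = (L1norm f)%:E.
Proof.
move=> [mf fi]; rewrite /L1norm fineK// ge0_fin_numE// integral_ge0// => x _.
by rewrite lee_fin cabs_ge0.
Qed.

Lemma L1norm_ge0 f : 0 <= L1norm f.
Proof. by rewrite fine_ge0// integral_ge0// => x _; rewrite lee_fin cabs_ge0. Qed.

Lemma measurable_mull (a : R) : measurable_fun [set: R] (fun x : R => a * x).
Proof. by apply: measurable_funM => //; exact: measurable_cst. Qed.

Lemma cmeas_character (a : R) : cmeas (fun x => cexpi (- (2 * pi * x * a))).
Proof.
apply: cmeas_cexpi; under eq_fun do rewrite -mulrA [_ * a]mulrC -mulNr mulrA.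
exact: measurable_mull.
Qed.

Lemma cL1_char f w : cL1 f -> cL1 (fun x => cexpi (- (2 * pi * x * w)) * f x).
Proof.
apply: (@cL1_bM _ _ _ 1); first exact: cmeas_character.
by move=> x; rewrite cabs_cexpi.
Qed.

Lemma fourier_le f w : cL1 f -> cabs (fourier f w) <= L1norm f.
Proof.
move=> fi; rewrite -lee_fin -L1norm_fine//.
apply: le_trans (le_cabs_cintegral (cL1_char w fi)) _.
by under eq_integral do rewrite cabsM cabs_cexpi mul1r.
Qed.

Lemma fourierD f g w : cL1 f -> cL1 g ->
  fourier (fun x => f x + g x) w = fourier f w + fourier g w.
Proof.
move=> fi gi; rewrite /fourier -cintegralD; [|exact: cL1_char..].
by apply: eq_cintegral => x; rewrite mulrDr.
Qed.

Lemma fourierZ z f w : cL1 f ->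
  fourier (fun x => z * f x) w = z * fourier f w.
Proof.
move=> fi; rewrite /fourier -cintegralZ; last exact: cL1_char.
by apply: eq_cintegral => x; rewrite mulrCA.
Qed.

Lemma fourierB f g w : cL1 f -> cL1 g ->
  fourier (fun x => f x - g x) w = fourier f w - fourier g w.
Proof.
move=> fi gi; rewrite /fourier -cintegralB; [|exact: cL1_char..].
by apply: eq_cintegral => x; rewrite mulrBr.
Qed.

Lemma fourier_sum (I : Type) (r : seq I) (F : I -> R -> R[i]) w :
  (forall i, cL1 (F i)) ->
  fourier (fun x => \sum_(i <- r) F i x) w = \sum_(i <- r) fourier (F i) w.
Proof.
move=> Fi; rewrite /fourier -cintegral_sum; last by move=> i; exact: cL1_char.
by apply: eq_cintegral => x; rewrite mulr_sumr.
Qed.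

Lemma fourier_modulation f (a w : R) :
  fourier (fun x => cexpi (2 * pi * a * x) * f x) w = fourier f (w - a).
Proof.
apply: eq_cintegral => x; rewrite mulrA -cexpiD; congr (cexpi _ * _); ring.
Qed.

Lemma fourier_translation f (a w : R) : cL1 f ->
  fourier (fun x => f (x - a)) w = cexpi (- (2 * pi * a * w)) * fourier f w.
Proof.
move=> fi; rewrite /fourier -cintegralZ; last exact: cL1_char.
rewrite -[RHS](cintegral_shiftr (- a)); last exact/cL1Z/cL1_char.
apply: eq_cintegral => x; rewrite mulrA -cexpiD; congr (cexpi _ * _); ring.
Qed.

(** Sequential continuity follows from dominated convergence with majorant [|f|]; it passes to the
    real and imaginary parts because both are additive and bounded by the modulus. *)
Lemma ccont_fourier f : cL1 f -> ccont (fourier f).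
Proof.
move=> fi.
have seqc (u : nat -> R) p : u @ \oo --> p ->
    (fun n => cabs (fourier f (u n) - fourier f p)) @ \oo --> (0 : R).
  move=> up; apply: (@cvg_cintegral _ _ _ (fun x => cabs (f x))).
  - by move=> n; exact: (cL1_char _ fi).1.
  - exact: (cL1_char _ fi).1.
  - exact: measurable_cabs fi.1.
  - by move=> n x; rewrite cabsM cabs_cexpi mul1r.
  - exact: fi.2.
  move=> x.
  have hc : ccont (fun t => cexpi (- (2 * pi * x * t))).
    by apply: ccont_cexpi => t; apply: cvgN; exact: continuous_mull.
  have h : cabs (cexpi (- (2 * pi * x * u n)) - cexpi (- (2 * pi * x * p))) * cabs (f x)
      @[n --> \oo] --> 0 * cabs (f x).
    by apply: cvgM; [exact: (ccont_seq hc up)|exact: cvg_cst].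
  move: h; rewrite mul0r; apply: cvg_trans; apply: near_eq_cvg.
  by apply: nearW => n; rewrite -mulrBl cabsM.
have key (P : R[i] -> R) : (forall z, `|P z| <= cabs z) -> {morph P : a b / a - b} ->
    continuous (fun w => P (fourier f w)).
  move=> PC PB p; apply/(@cvg_nbhsP _ R^o) => u up; apply/cvgrPdist_lt => e e0.
  have /cvgr0Pnorm_lt/(_ _ e0) h := seqc u p up.
  near=> n; rewrite distrC -PB (le_lt_trans (PC _))//.
  by rewrite (le_lt_trans (ler_norm _))//; near: n.
split; apply: key.
- exact: cabs_Re.
- by move=> a b; rewrite cReD cReN.
- exact: cabs_Im.
- by move=> a b; rewrite cImD cImN.
Unshelve. all: by end_near. Qed.

Lemma cmeas_fourier f : cL1 f -> cmeas (fourier f).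
Proof. by move=> fi; exact/ccont_cmeas/ccont_fourier. Qed.

End Fourier.

(** * Fejer means and sampling *)

Section FejerKernel.
Context {R : realType}.
Notation mu := (@lebesgue_measure R).
Implicit Types (c x y : R) (n : nat).

Lemma cexpi_int (m : int) : cexpi (2 * pi * m%:~R) = 1 :> R[i].
Proof.
have E (p : nat) : cexpi (2 * pi * p%:R) = 1 :> R[i].
  elim: p => [|p ih]; first by rewrite mulr0 cexpi0.
  rewrite -[p.+1%:R]natr1 mulrDr mulr1 cexpiD ih mul1r mulr_natl.
  by rewrite /cexpi cos2pi sin2pi.
case: m => p; first exact: E.
by rewrite NegzE mulrNz mulrN -cexpiJ E conjc1.
Qed.

(** One-sided rather than symmetric: only the modulus matters, and its square divided by [n] is the
    Fejer kernel of period [1 / c]. *)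
Definition dirichlet c n y : R[i] :=
  \sum_(0 <= k < n) cexpi (2 * pi * (k%:R * c) * y).

Definition fejer c n y : R := cabs (dirichlet c n y) ^+ 2 / n%:R.

Lemma fejer_ge0 c n y : 0 <= fejer c n y.
Proof. by rewrite divr_ge0// sqr_ge0. Qed.

Lemma ccont_dirichlet c n : ccont (dirichlet c n).
Proof.
by apply: ccont_sum => k; apply: ccont_cexpi; exact: continuous_mull.
Qed.

Lemma measurable_fejer c n : measurable_fun [set: R] (fejer c n).
Proof.
apply: measurable_funM; last exact: measurable_cst.
apply: measurable_funX; apply: measurable_cabs; apply: ccont_cmeas.
exact: ccont_dirichlet.
Qed.

Lemma fejer_periodic c n y (j : int) : c != 0 ->
  fejer c n (y + j%:~R * c^-1) = fejer c n y.
Proof.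
move=> c0; rewrite /fejer; congr (cabs _ ^+ 2 / _); apply: eq_bigr => k _.
rewrite mulrDr cexpiD.
have -> : 2 * pi * (k%:R * c) * (j%:~R / c) = 2 * pi * (k%:Z * j)%:~R.
  by rewrite rmorphM/= -[k%:~R]/(k%:R : R); field.
by rewrite cexpi_int mulr1.
Qed.

Lemma fejerE c n y : (cabs (dirichlet c n y) ^+ 2)%:C =
  \sum_(0 <= k < n) \sum_(0 <= l < n) cexpi (2 * pi * ((k%:R - l%:R) * c) * y).
Proof.
rewrite -mulcJ {1}/dirichlet mulr_suml; apply: eq_bigr => k _.
rewrite /dirichlet rmorph_sum/= mulr_sumr; apply: eq_bigr => l _.
transitivity (cexpi (2 * pi * (k%:R * c) * y) * cexpi (- (2 * pi * (l%:R * c) * y))).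
  by congr (_ * _); exact: cexpiJ.
by rewrite -cexpiD; congr cexpi; ring.
Qed.

Lemma fejer_cos c n y : cabs (dirichlet c n y) ^+ 2 =
  \sum_(0 <= k < n) \sum_(0 <= l < n) cos (2 * pi * ((k%:R - l%:R) * c) * y).
Proof.
have := fejerE c n y => /(congr1 (@complex.Re R)) /= ->.
rewrite (big_morph _ (@cReD R) (erefl _)); apply: eq_bigr => k _.
by rewrite (big_morph _ (@cReD R) (erefl _)).
Qed.

Lemma integral_cos_cell c a (m : int) : 0 < c ->
  (\int[mu]_(y in `[a, (a + c^-1)%R[) (cos (2 * pi * (m%:~R * c) * y))%:E)%E =
  (if m == 0 then c^-1 else 0)%:E.
Proof.
move=> c0; have ci0 : 0 < c^-1 by rewrite invr_gt0.
have [->|m0] := eqVneq m 0.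
  under eq_integral do rewrite mul0r mulr0 mul0r cos0.
  rewrite integral_cst//= lebesgue_measure_itv/= lte_fin ltrDl ci0 -EFinD mul1e.
  by congr EFin; ring.
set w := 2 * pi * (m%:~R * c).
have w0 : w != 0.
  by rewrite !mulf_neq0 ?intr_eq0 ?(gt_eqF c0) ?(gt_eqF (pi_gt0 R)) ?pnatr_eq0.
pose F y := w^-1 * sin (w * y).
have dF y : is_derive y 1 F (cos (w * y)).
  have h : is_derive y 1 (fun x => w * x) w.
    by rewrite -[X in is_derive _ _ _ X]mulr1; exact: (is_deriveZ w (is_derive_id y 1)).
  have h2 : is_derive y 1 (sin \o (fun x => w * x)) (cos (w * y) * w).
    by apply: is_derive1_comp.
  have := is_deriveZ w^-1 h2.
  by rewrite [X in is_derive _ _ _ X](_ : _ = cos (w * y))// /GRing.scale/= mulrCA mulVf// mulr1.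
have dF1 y : derivable F y 1 by have [] := dF y.
have cF : continuous F by move=> y; apply/differentiable_continuous/derivable1_diffP.
have cc : continuous (fun y => cos (w * y)).
  move=> y; apply: (@continuous_comp _ _ _ (fun x => w * x) cos); last exact: continuous_cos.
  exact: continuous_mull.
rewrite integral_itv_bndo_bndc; last first.
  apply/measurable_EFinP/(@measurable_funS _ _ _ _ setT) => //.
  exact: continuous_measurable_fun.
rewrite (@continuous_FTC2 _ (fun y => cos (w * y)) F)//.
- rewrite -EFinB /F mulrDr; congr EFin.
  (* The cell spans a whole number of periods, so the antiderivative takes the same value at both
     ends. *)
  have -> : w / c = 2 * pi * m%:~R by rewrite /w; field; rewrite gt_eqF.
  have := cexpiD (w * a) (2 * pi * m%:~R).
  by rewrite cexpi_int mulr1 => /(congr1 (@complex.Im R)) /= ->; rewrite subrr.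
- by rewrite ltrDl.
- exact: continuous_subspaceT.
- split; [by move=> x _; exact: dF1| |].
    by apply: cvg_at_right_filter; exact: cF.
  by apply: cvg_at_left_filter; exact: cF.
- by move=> x _; rewrite derive1E; have [] := dF x.
Qed.

(** Only the [n] diagonal frequencies [k = l] survive, each contributing [1 / c]; this fixes the
    normalization [c]. *)
Lemma integral_fejer_cell c a n : 0 < c -> (0 < n)%N ->
  (\int[mu]_(y in `[a, (a + c^-1)%R[) (c * fejer c n y)%:E)%E = 1%E.
Proof.
move=> c0 n0; have ci0 : 0 < c^-1 by rewrite invr_gt0.
have nR : n%:R != 0 :> R by rewrite pnatr_eq0 -lt0n.
pose h (k l : nat) y := cos (2 * pi * ((k%:Z - l%:Z)%:~R * c) * y).
have ih k l : mu.-integrable `[a, (a + c^-1)%R[ (EFin \o h k l).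
  apply: measurable_bounded_integrable => //.
  - by rewrite /= lebesgue_measure_itv/= lte_fin ltrDl ci0 -EFinD ltry.
  - apply: (@measurable_funS _ _ _ _ setT) => //.
    apply: continuous_measurable_fun => y.
    apply: (@continuous_comp _ _ _ (fun x => _ * x) cos); last exact: continuous_cos.
    exact: continuous_mull.
  - exists 1; split; first exact: num_real.
    move=> x x1 y _; apply: (le_trans _ (ltW x1)); rewrite /= /h.
    by rewrite ler_norml cos_geN1 cos_le1.
have -> : (fun y => (c * fejer c n y)%:E) = fun y =>
    ((c / n%:R)%:E * \sum_(0 <= k < n) \sum_(0 <= l < n) (h k l y)%:E)%E.
  apply/funext => y; rewrite /fejer fejer_cos.
  under [in RHS]eq_bigr do rewrite sumEFin.
  rewrite sumEFin -EFinM; congr EFin; rewrite mulrA mulrAC; congr (_ * _).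
  by apply: eq_bigr => k _; apply: eq_bigr => l _; rewrite /h rmorphB.
have isum k : mu.-integrable `[a, (a + c^-1)%R[
    (fun y => \sum_(0 <= l < n) (h k l y)%:E)%E.
  by apply: (@integrable_sum _ _ _ mu _ _ _ _ _ (fun l y => (h k l y)%:E)) => // l _; exact: ih.
rewrite integralZl//; last first.
  exact: (@integrable_sum _ _ _ mu _ _ _ _ _ (fun k y => \sum_(0 <= l < n) (h k l y)%:E)%E).
rewrite (@integral_sum _ _ _ mu _ _ _ (fun k y => \sum_(0 <= l < n) (h k l y)%:E)%E)//.
have isumE k : (k < n)%N -> (\int[mu]_(y in `[a, (a + c^-1)%R[)
    (\sum_(0 <= l < n) (h k l y)%:E) = (c^-1)%:E)%E.
  move=> kn; rewrite (@integral_sum _ _ _ mu _ _ _ (fun l y => (h k l y)%:E))//; last first.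
    by move=> l; exact: ih.
  under eq_bigr do rewrite integral_cos_cell// subr_eq0 eqz_nat.
  rewrite sumEFin (bigD1_seq k) ?iota_uniq ?mem_index_iota//= eqxx.
  by rewrite big1 ?addr0// => l lk; rewrite eq_sym (negbTE lk).
rewrite (@eq_big_nat _ _ _ _ _ _ (fun=> (c^-1)%:E)); last first.
  by move=> k /andP[_ kn]; exact: isumE.
rewrite sumEFin big_const_nat subn0 iter_addr_0 -EFinM.
by congr EFin; rewrite -mulr_natr; field; rewrite nR gt_eqF.
Qed.

(** The first factor telescopes the geometric sum. Keeping a product avoids a division that would
    fail on the lattice of zeros of that factor. *)
Lemma dirichlet_le c n y : cabs (1 - cexpi (2 * pi * c * y)) * cabs (dirichlet c n y) <= 2.
Proof.
rewrite -cabsM.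
have -> : (1 - cexpi (2 * pi * c * y)) * dirichlet c n y = 1 - cexpi (2 * pi * (n%:R * c) * y).
  elim: n => [|n ih].
    by rewrite /dirichlet big_nil mulr0 mul0r mulr0 mul0r cexpi0 subrr.
  rewrite /dirichlet big_nat_recr//= mulrDr -/(dirichlet c n y) ih.
  have -> : 2 * pi * (n.+1%:R * c) * y = 2 * pi * c * y + 2 * pi * (n%:R * c) * y.
    by rewrite -[n.+1%:R]natr1; ring.
  by rewrite cexpiD; ring.
rewrite (le_trans (cabsB _ _))// cabs_cexpi.
by rewrite -(cexpi0 (R := R)) cabs_cexpi.
Qed.

Lemma sqr_cabs_1Bcexpi y : cabs (1 - cexpi y) ^+ 2 = 2 - 2 * cos y :> R.
Proof.
rewrite cabs_sqr cReD cImD cReN cImN /= sub0r sqrrN.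
have := cos2Dsin2 y; nra.
Qed.

(** [|1 - cexpi x|^2 = 2 - 2 * cos x] increases with [|x|] up to [pi], so on the half-cell outside
    []-d, d[] it is smallest at distance [d]; there the kernel is [O(1 / n)]. *)
Lemma fejer_off0 c (d : R) n y : 0 < c -> 0 < d -> (0 < n)%N ->
  d <= `|y| <= c^-1 / 2 ->
  fejer c n y <= 4 / (2 - 2 * cos (2 * pi * c * d)) / n%:R.
Proof.
move=> c0 d0 n0 /andP[dy yb].
have pi0 := pi_gt0 R; have d2 : d <= c^-1 / 2 by exact: le_trans dy yb.
have tp0 : 0 < 2 * pi * c by rewrite !mulr_gt0.
have E : 2 * pi * c * (c^-1 / 2) = pi by field; rewrite gt_eqF.
have itv x : 0 <= x -> x <= c^-1 / 2 -> 2 * pi * c * x \in `[0, pi].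
  by move=> x0 xb; rewrite in_itv/= mulr_ge0 ?(ltW tp0)//= -[leRHS]E ler_wpM2l// ltW.
have cd1 : cos (2 * pi * c * d) < 1.
  by rewrite -[ltRHS]cos0 ltr_cos ?itv ?(ltW d0)// ?in_itv/= ?lexx ?ltW// mulr_gt0.
have cy : cos (2 * pi * c * y) <= cos (2 * pi * c * d).
  have -> : cos (2 * pi * c * y) = cos (2 * pi * c * `|y|).
    by case: (ger0P y) => // _; rewrite mulrN cosN.
  rewrite leNgt ltr_cos ?itv ?(ltW d0)//.
  by rewrite -leNgt ler_wpM2l// ltW.
rewrite ler_wpM2r ?invr_ge0// ler_pdivlMr; last by lra.
have h : (cabs (1 - cexpi (2 * pi * c * y)) * cabs (dirichlet c n y)) ^+ 2 <= 2 ^+ 2.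
  by rewrite ler_pXn2r// ?nnegrE ?mulr_ge0 ?cabs_ge0// dirichlet_le.
move: h; rewrite exprMn sqr_cabs_1Bcexpi => h.
have := sqr_ge0 (cabs (dirichlet c n y)); nra.
Qed.

End FejerKernel.

(** * The Fejer kernel as a one-sided approximate identity *)

Section FejerLimit.
Context {R : realType}.
Notation mu := (@lebesgue_measure R).
Context (c : R) (Q : R -> R).
Hypothesis c0 : 0 < c.
Hypothesis mQ : measurable_fun [set: R] Q.
Hypothesis Q0 : forall y, 0 <= Q y.

Definition periodization (y : R) : \bar R :=
  \esum_(j in [set: int]) (Q (y + j%:~R * c^-1))%:E.

Lemma periodization_ge0 y : (0 <= periodization y)%E.
Proof. by apply: esum_ge0 => j _; rewrite lee_fin. Qed.

Lemma measurable_periodization (D : set R) : measurable D ->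
  measurable_fun D periodization.
Proof.
move=> mD; apply: (@measurable_funS _ _ _ _ setT) => //; apply: measurable_esum => //.
  move=> j; apply/measurable_EFinP.
  exact: (measurableT_comp mQ (measurable_shiftr _)).
by move=> j x; rewrite lee_fin.
Qed.

Let mK n (D : set R) : measurable D -> measurable_fun D (fun y => (c * fejer c n y)%:E).
Proof.
move=> mD; apply: (@measurable_funS _ _ _ _ setT) => //.
apply/measurable_EFinP; apply: measurable_funM; first exact: measurable_cst.
exact: measurable_fejer.
Qed.

Let K0 n y : (0 <= (c * fejer c n y)%:E)%E.
Proof. by rewrite lee_fin mulr_ge0 ?fejer_ge0// ltW. Qed.

(** The kernel has period [1 / c], so folding the line onto a cell only replaces [Q] by its
    periodization. *)
Lemma integral_fejer_fold n (a : R) :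
  (\int[mu]_y (Q y * (c * fejer c n y))%:E =
   \int[mu]_(y in `[a, (a + c^-1)%R[) (periodization y * (c * fejer c n y)%:E))%E.
Proof.
have mQK : measurable_fun [set: R] (fun y => (Q y * (c * fejer c n y))%:E).
  apply/measurable_EFinP; apply: measurable_funM => //.
  by apply/measurable_EFinP; exact: mK.
have QK0 y : (0 <= (Q y * (c * fejer c n y))%:E)%E.
  by rewrite EFinM mule_ge0 ?lee_fin// mulr_ge0 ?fejer_ge0// ltW.
rewrite (@ge0_integral_cells _ a c^-1) ?invr_gt0//.
rewrite -ge0_integral_esum//.
- apply: eq_integral => y _; rewrite /periodization muleC -esumZ.
  + apply: eq_esum => j _; rewrite fejer_periodic ?gt_eqF//.
    by rewrite -EFinM mulrC.
  + by rewrite mulr_ge0 ?fejer_ge0// ltW.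
  + by move=> j; rewrite lee_fin.
- move=> j; apply: (@measurable_funS _ _ _ _ setT) => //.
  exact: (measurableT_comp mQK (measurable_shiftr _)).
Qed.

Context (B : R).
Hypothesis QB : forall y, (periodization y <= B%:E)%E.

Lemma integral_fejer_le n : (0 < n)%N ->
  (\int[mu]_y (Q y * (c * fejer c n y))%:E <= B%:E)%E.
Proof.
move=> n0; have B0 : 0 <= B by rewrite -lee_fin (le_trans (periodization_ge0 0)).
rewrite (integral_fejer_fold n 0).
rewrite -[leRHS]mule1 -(integral_fejer_cell 0 c0 n0) -ge0_integralZl//.
- apply: ge0_le_integral => //.
  + by move=> y _; rewrite mule_ge0 ?periodization_ge0.
  + by apply: emeasurable_funM; [exact: measurable_periodization|exact: mK].
  + by apply: emeasurable_funM; [exact: measurable_cst|exact: mK].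
  + by move=> y _; rewrite lee_wpmul2r.
- exact: mK.
Qed.

(** Near 0 the kernel has mass at most 1 and the periodization is at most [p0 + e / 2]; farther away
    the kernel is [O(1 / n)] against the bound [B]. Only an upper estimate near 0 is assumed, since
    the aliases need not vanish there. *)
Lemma integral_fejer_limsup (p0 : R) : 0 <= p0 ->
  (forall e : R, 0 < e -> exists2 d : R, 0 < d & forall y, `|y| < d ->
     (periodization y <= (p0 + e)%:E)%E) ->
  forall e : R, 0 < e -> \forall n \near \oo,
  (\int[mu]_y (Q y * (c * fejer c n y))%:E <= (p0 + e)%:E)%E.
Proof.
move=> p00 Pc e e0; have e20 : 0 < e / 2 by rewrite divr_gt0.
have B0 : 0 <= B by rewrite -lee_fin (le_trans (periodization_ge0 0)).
have [d' d'0 d'P] := Pc _ e20.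
have ci0 : 0 < c^-1 by rewrite invr_gt0.
pose d := Num.min d' (c^-1 / 4).
have d0 : 0 < d by rewrite lt_min d'0/= divr_gt0.
have dd' : d <= d' by rewrite ge_min lexx.
have dc : d <= c^-1 / 4 by rewrite ge_min lexx orbT.
pose kap := 4 / (2 - 2 * cos (2 * pi * c * d)).
have kap0 : 0 <= kap by rewrite divr_ge0// subr_ge0 ler_piMr// cos_le1.
(* The cell centred at 0: outside []-d, d[] its points satisfy [d <= |y| <= 1 / (2 c)], the range of
   [fejer_off0]. *)
pose a := - (c^-1 / 2).
pose M := B * c * kap * c^-1.
have M0 : 0 <= M by rewrite !mulr_ge0// ltW.
near=> n.
have n0 : (0 < n)%N by near: n; exists 1%N.
have nR : 0 < n%:R :> R by rewrite ltr0n.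
rewrite (integral_fejer_fold n a).
apply: (@le_trans _ _ (\int[mu]_(y in `[a, (a + c^-1)%R[)
   ((p0 + e / 2)%:E * (c * fejer c n y)%:E + (B * (c * (kap / n%:R)))%:E))%E).
  apply: ge0_le_integral => //.
  - by move=> y _; rewrite mule_ge0 ?periodization_ge0.
  - by apply: emeasurable_funM; [exact: measurable_periodization|exact: mK].
  - apply: emeasurable_funD; last exact: measurable_cst.
    by apply: emeasurable_funM; [exact: measurable_cst|exact: mK].
  move=> y /=; rewrite in_itv/= => /andP[ay yb].
  have BK0 : 0 <= B * (c * (kap / n%:R)) by rewrite !mulr_ge0 ?invr_ge0// ltW.
  have [yd|yd] := ltP `|y| d.
    rewrite (@le_trans _ _ ((p0 + e / 2)%:E * (c * fejer c n y)%:E))%E//.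
      by rewrite lee_wpmul2r// d'P// (lt_le_trans yd).
    by rewrite leeDl// lee_fin.
  rewrite (@le_trans _ _ (B * (c * (kap / n%:R)))%:E)//.
    rewrite [leRHS]EFinM; apply: lee_pmul; rewrite ?periodization_ge0//.
    rewrite lee_fin ler_wpM2l ?(ltW c0)// fejer_off0// yd/= ler_norml; apply/andP; split.
      exact: ay.
    by move: yb; rewrite /a => yb; apply: ltW; apply: lt_le_trans yb _; lra.
  by rewrite leeDr// mule_ge0// lee_fin addr_ge0// ltW.
rewrite ge0_integralD//; first last.
- by move=> y _; rewrite lee_fin !mulr_ge0 ?invr_ge0// ltW.
- by apply: emeasurable_funM; [exact: measurable_cst|exact: mK].
- by move=> y _; rewrite mule_ge0// lee_fin addr_ge0// ltW.
rewrite ge0_integralZl//; last 2 first.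
- exact: mK.
- by rewrite lee_fin addr_ge0// ltW.
rewrite integral_fejer_cell// mule1 integral_cst//= lebesgue_measure_itv/=.
rewrite lte_fin ltrDl ci0.
have -> : ((a + c^-1)%:E + (- a)%:E = (c^-1)%:E)%E by rewrite -EFinD addrAC subrr add0r.
rewrite -EFinM -EFinD lee_fin.
have -> : B * (c * (kap / n%:R)) * c^-1 = M / n%:R.
  by rewrite /M; field; rewrite !gt_eqF.
have : M / n%:R <= e / 2; last by lra.
rewrite ler_pdivrMr// -ler_pdivrMl//.
by near: n; exact: nbhs_infty_ger.
Unshelve. all: by end_near. Qed.

End FejerLimit.

(** * Fejer means of continuous functions with decay *)

Section FejerMeans.
Context {R : realType}.
Notation mu := (@lebesgue_measure R).

(** Peetre's inequality, from [1 + |x| <= (1 + |x + y|) (1 + |y|)]. *)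
Lemma decayD (s x y : R) : 0 <= s -> decay s (x + y) <= (1 + `|y|) `^ s * decay s x.
Proof.
move=> s0; have p (t : R) : 0 < 1 + `|t| by rewrite ltr_pwDl.
rewrite /decay; have -> : (1 + `|y|) `^ s = (1 + `|y|)^-1 `^ (- s).
  by rewrite -powR_inv1 ?(ltW (p y))// -powRrM mulrNN mul1r.
rewrite -powRM ?invr_ge0 ?(ltW (p _))// powRN_le//.
rewrite mulrC ler_pdivrMr//.
have := ler_normB (x + y) y; rewrite addrK => h.
by have := normr_ge0 (x + y); have := normr_ge0 y; nra.
Qed.

Lemma ge0_integral_reflect (x : R) (f : R -> \bar R) :
  measurable_fun [set: R] f -> (forall y, 0 <= f y)%E ->
  (\int[mu]_t f (x - t)%R = \int[mu]_t f t)%E.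
Proof.
move=> mf f0; rewrite -[RHS](ge0_integral_shiftrT x)//.
rewrite -[RHS](@ge0_integral_opp _ (fun t => f (t + x)))//.
  by apply: eq_integral => t _; rewrite addrC.
exact: (measurableT_comp mf (measurable_shiftr x)).
Qed.

Lemma cintegral_real (h : R -> R) : cintegral (fun x => (h x)%:C) = (\int[mu]_x h x)%:C.
Proof. by rewrite /cintegral /= /Rintegral integral0. Qed.

Context (c : R) (F : R -> R[i]) (C s : R).
Hypothesis c0 : 0 < c.
Hypothesis s1 : 1 < s.
Hypothesis Fc : ccont F.
Hypothesis FC : forall t, cabs (F t) <= C * decay s t.

(** Cesaro mean of the series with terms [c * fourier F (m c) * cexpi (2 pi m c x)], which Poisson
    summation formally sums to the [1 / c]-periodization of [F]. Writing [m = k - l] matches the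
    expansion of the squared Dirichlet sum. *)
Definition fejer_mean n (x : R) : R[i] :=
  (c / n%:R)%:C * \sum_(0 <= k < n) \sum_(0 <= l < n)
    fourier F ((k%:R - l%:R) * c) * cexpi (2 * pi * ((k%:R - l%:R) * c) * x).

(** Majorizes the distance from [F] to its periodization, hence the part of the error that survives
    as [n] grows. *)
Definition alias_sum (x : R) : \bar R :=
  \esum_(j in [set j : int | j != 0]) (cabs (F (x + j%:~R * c^-1)))%:E.

Let s0 : 0 <= s. Proof. by rewrite ltW// (lt_trans ltr01). Qed.

Let mF : cmeas F. Proof. exact: ccont_cmeas. Qed.

Let F1 : cL1 F. Proof. exact: decay_cL1 FC. Qed.

Let C0 : 0 <= C.
Proof.
have := le_trans (cabs_ge0 _) (FC 0).
by rewrite /decay normr0 addr0 powR1 mulr1.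
Qed.

Let ci0 : 0 < c^-1. Proof. by rewrite invr_gt0. Qed.

Let K n (y : R) := c * fejer c n y.

Let mK n : measurable_fun [set: R] (K n).
Proof. by apply: measurable_funM; [exact: measurable_cst|exact: measurable_fejer]. Qed.

Let K0 n y : 0 <= K n y. Proof. by rewrite mulr_ge0 ?fejer_ge0// ltW. Qed.

Let measurable_reflect (x : R) : measurable_fun [set: R] (fun t => x - t).
Proof. by apply: measurable_funB => //; exact: measurable_cst. Qed.

Let K_bounded n y : K n y <= c * n%:R.
Proof.
rewrite ler_wpM2l ?(ltW c0)// /fejer.
have [->|n0] := eqVneq n 0%N; first by rewrite invr0 mulr0.
rewrite ler_pdivrMr ?ltr0n ?lt0n// -expr2 ler_pXn2r// ?nnegrE ?cabs_ge0//.
rewrite (le_trans (cabs_sum _ _ _))// (eq_bigr (fun=> 1)); last by move=> k _; rewrite cabs_cexpi.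
by rewrite big_const_nat subn0 iter_addr_0.
Qed.

(** As a convolution with a positive kernel, the mean can be estimated by taking moduli inside the
    integral. *)
Lemma fejer_meanE n x :
  fejer_mean n x = cintegral (fun t => F t * (K n (x - t))%:C).
Proof.
have E t : F t * (K n (x - t))%:C = (c / n%:R)%:C * \sum_(0 <= k < n) \sum_(0 <= l < n)
    cexpi (2 * pi * ((k%:R - l%:R) * c) * x) *
    (cexpi (- (2 * pi * t * ((k%:R - l%:R) * c))) * F t).
  have -> : (K n (x - t))%:C = (c / n%:R)%:C * (cabs (dirichlet c n (x - t)) ^+ 2)%:C.
    by rewrite /K /fejer -rmorphM/=; congr (_%:C); ring.
  rewrite mulrCA fejerE mulr_sumr; congr (_ * _); apply: eq_bigr => k _.
  rewrite mulr_sumr; apply: eq_bigr => l _.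
  by rewrite mulrA -cexpiD mulrC; congr (cexpi _ * _); ring.
have i1 k l : cL1 (fun t => cexpi (2 * pi * ((k%:R - l%:R) * c) * x) *
    (cexpi (- (2 * pi * t * ((k%:R - l%:R) * c))) * F t)).
  by apply: cL1Z; exact: cL1_char.
under eq_cintegral do rewrite E.
rewrite cintegralZ; last by apply: cL1_sum => k; apply: cL1_sum => l; exact: i1.
rewrite cintegral_sum; last by move=> k; apply: cL1_sum => l; exact: i1.
congr (_ * _); apply: eq_bigr => k _; rewrite cintegral_sum; last by move=> l; exact: i1.
apply: eq_bigr => l _; rewrite cintegralZ; last exact: cL1_char.
by rewrite mulrC.
Qed.

Lemma fejer_mean_cmeas n : cmeas (fejer_mean n).
Proof.
apply: cmeasM; first exact: cmeas_cst.
apply: cmeas_sum => k; apply: cmeas_sum => l; apply: cmeasM; first exact: cmeas_cst.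
by apply: cmeas_cexpi; exact: measurable_mull.
Qed.

Let cmeasFK n x (G : R -> R[i]) : cmeas G -> cmeas (fun t => G t * (K n (x - t))%:C).
Proof.
move=> mG; apply: cmeasM => //; apply: cmeas_real.
exact: (measurableT_comp (mK n) (measurable_reflect x)).
Qed.

Let FK1 n x : cL1 (fun t => F t * (K n (x - t))%:C).
Proof.
apply: (@decay_cL1 _ _ (C * (c * n%:R)) s) => //; first exact: cmeasFK.
move=> t; rewrite cabsM cabs_real ger0_norm// mulrAC.
by apply: ler_pM; rewrite ?cabs_ge0.
Qed.

(** The kernel has unit mass on a cell, so the periodization of [|F|], a bounded lattice sum, bounds
    the means uniformly in [n]. *)
Lemma fejer_mean_bounded : exists2 B : R, 0 <= B & forall n x, (0 < n)%N ->
  cabs (fejer_mean n x) <= B.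
Proof.
have [L L0 LP] := lattice_sum_decay ci0 s1.
exists (C * L) => [|n x n0]; first by rewrite mulr_ge0// ltW.
rewrite -lee_fin fejer_meanE (le_trans (le_cabs_cintegral (FK1 n x)))//.
pose Q y := cabs (F (x - y)).
have mQ : measurable_fun [set: R] Q.
  exact: (measurableT_comp (measurable_cabs mF) (measurable_reflect x)).
have -> : (\int[mu]_t (cabs (F t * (K n (x - t))%:C))%:E =
    \int[mu]_y (Q y * (c * fejer c n y))%:E)%E.
  rewrite -[RHS](ge0_integral_reflect x).
  - apply: eq_integral => t _; rewrite cabsM cabs_real ger0_norm// /Q.
    by rewrite subKr.
  - by apply/measurable_EFinP; apply: measurable_funM => //; exact: mK.
  - by move=> y; rewrite lee_fin mulr_ge0 ?cabs_ge0//; exact: K0.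
apply: integral_fejer_le => //; first by move=> y; exact: cabs_ge0.
move=> y; rewrite /periodization /Q.
apply: (@le_trans _ _ (\esum_(j in [set: int]) (C%:E * (decay s (x - y + - j%:~R * c^-1))%:E)%E)).
  apply: le_esum => j _; rewrite -EFinM lee_fin.
  by rewrite (_ : x - y + - j%:~R / c = x - (y + j%:~R / c))//; ring.
rewrite esumZ//; last by move=> j; rewrite lee_fin decay_ge0.
rewrite EFinM lee_wpmul2l ?lee_fin// (le_trans _ (LP (x - y)))//.
rewrite -(esum_int_opp _ (A := [set: int])) //; apply: le_esum => j _.
by rewrite rmorphN.
Qed.

(** The periodic kernel has infinite mass on the line but mass 1 on this cell; [F x] is therefore
    compared with the kernel truncated here. *)
Let cell (y : R) : R := \1_(`[- (c^-1 / 2), (- (c^-1 / 2) + c^-1)%R[%classic : set R) y.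

Let mcell : measurable_fun [set: R] cell.
Proof. exact: measurable_indic. Qed.

Let cell01 y : 0 <= cell y <= 1.
Proof. by rewrite /cell indicE; case: (_ \in _); rewrite /= ?lexx ?ler01. Qed.

Let cellE y : `|y| < c^-1 / 2 -> cell y = 1.
Proof.
rewrite ltr_norml => /andP[h1 h2]; rewrite /cell indicE mem_set//= in_itv/=.
by apply/andP; split; lra.
Qed.

Let cell_off y (j : int) : `|y| < c^-1 / 2 -> j != 0 -> cell (y + j%:~R * c^-1) = 0.
Proof.
rewrite ltr_norml => /andP[h1 h2] j0; rewrite /cell indicE memNset//= in_itv/=.
move=> /andP[h3 h4]; have ci := ci0.
have [j1|j1] : (1 <= j) \/ (j <= -1) by case: (ltgtP j 0) j0 => // h _; [right|left]; move: h; rewrite -lezD1 => h; lra.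
  have : (1 : R) <= j%:~R by rewrite -[1]/(1%:~R) ler_int.
  move=> j1R; have q : 0 <= (j%:~R - 1) * c^-1 by rewrite mulr_ge0 ?subr_ge0 ?(ltW ci).
  by lra.
have : j%:~R <= (-1 : R) by rewrite -[-1]/((-1)%:~R) ler_int.
move=> j1R; have q : 0 <= (-1 - j%:~R) * c^-1 by rewrite mulr_ge0 ?subr_ge0 ?(ltW ci).
by lra.
Qed.

Let cell_decay y : cell y <= (1 + c^-1 / 2) `^ s * decay s y.
Proof.
have c2 : 0 <= c^-1 / 2 by rewrite divr_ge0// ltW.
rewrite /cell indicE; case: (boolP (y \in _)) => [|_]; last first.
  by rewrite mulr_ge0 ?decay_ge0 ?powR_ge0.
rewrite inE/= in_itv/= => /andP[h1 h2].
have y2 : `|y| <= c^-1 / 2 by rewrite ler_norml; apply/andP; split; lra.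
have := decayD y (- y) s0; rewrite subrr normrN {1}/decay normr0 addr0 powR1 => h.
rewrite (le_trans h)// ler_wpM2r ?decay_ge0//.
by apply: ge0_ler_powR => //; rewrite ?nnegrE ?addr_ge0// lerD2l.
Qed.

Let integral_K_cell n x : (0 < n)%N ->
  cintegral (fun t => (cell (x - t) * K n (x - t))%:C) = 1.
Proof.
move=> n0; rewrite cintegral_real /Rintegral.
have -> : (\int[mu]_t (cell (x - t) * K n (x - t))%:E = 1)%E; last by [].
rewrite (ge0_integral_reflect x (f := fun y => (cell y * K n y)%:E)); last 2 first.
- by apply/measurable_EFinP; apply: measurable_funM.
- by move=> y; rewrite lee_fin mulr_ge0//; case/andP: (cell01 y).
rewrite -(integral_fejer_cell (- (c^-1 / 2)) c0 n0) [RHS]integral_mkcond.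
apply: eq_integral => y _; rewrite patchE /cell indicE; case: (_ \in _).
  by rewrite mul1r.
by rewrite mul0r.
Qed.

(** For small [y], its periodization consists of the increment [|F (x - y) - F x|] and the moduli of
    the aliases of [F (x - y)]: truncation leaves the aliases untouched. *)
Let D x y : R := cabs (F (x - y) - (cell y)%:C * F x).

Let mD x : measurable_fun [set: R] (D x).
Proof.
apply: measurable_cabs; apply: cmeasB; first exact: (cmeas_comp mF (measurable_reflect x)).
by apply: cmeasM; [exact: cmeas_real|exact: cmeas_cst].
Qed.

Let D_decay x y : D x y <= (C * (1 + `|x|) `^ s + (1 + c^-1 / 2) `^ s * cabs (F x)) * decay s y.
Proof.
rewrite /D (le_trans (cabsB _ _))// mulrDl; apply: lerD.
  rewrite (le_trans (FC _))// -mulrA ler_wpM2l// addrC.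
  by rewrite (le_trans (decayD _ _ s0))// decayN.
rewrite cabsM cabs_real ger0_norm; last by case/andP: (cell01 y).
by rewrite mulrAC ler_wpM2r ?cabs_ge0.
Qed.

Lemma alias_sum_le : exists2 B : R, 0 <= B & forall x, (alias_sum x <= B%:E)%E.
Proof.
have [L L0 LP] := lattice_sum_decay ci0 s1.
exists (C * L) => [|x]; first by rewrite mulr_ge0// ltW.
apply: (@le_trans _ _ (\esum_(j in [set: int]) (C%:E * (decay s (x + j%:~R * c^-1))%:E)%E)).
  apply: (@le_trans _ _ (\esum_(j in [set: int]) (cabs (F (x + j%:~R * c^-1)))%:E)).
    by apply: esum_subset => // j; rewrite lee_fin cabs_ge0.
  by apply: le_esum => j _; rewrite -EFinM lee_fin.
rewrite esumZ//; last by move=> j; rewrite lee_fin decay_ge0.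
by rewrite EFinM lee_wpmul2l ?lee_fin.
Qed.

Lemma alias_sum_ge0 x : (0 <= alias_sum x)%E.
Proof. by apply: esum_ge0 => j _; rewrite lee_fin cabs_ge0. Qed.

Lemma alias_sum_fine x : alias_sum x = (fine (alias_sum x))%:E.
Proof.
have [B _ BP] := alias_sum_le.
by rewrite fineK// ge0_fin_numE ?alias_sum_ge0// (le_lt_trans (BP x))// ltry.
Qed.

Lemma measurable_alias_sum : measurable_fun [set: R] alias_sum.
Proof.
apply: measurable_esum => //; last by move=> j x; rewrite lee_fin cabs_ge0.
move=> j; apply: (measurableT_comp (measurable_cabsE mF)).
exact: measurable_shiftr.
Qed.

(* The samples of the aliases are continuous jointly up to a uniformly small tail. *)
Let periodization_D x (e : R) : 0 < e -> exists2 d : R, 0 < d & forall y, `|y| < d ->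
  (periodization c (D x) y <= (fine (alias_sum x) + e)%:E)%E.
Proof.
move=> e0; have e30 : 0 < e / 3 by rewrite divr_gt0.
have c2 : 0 < c^-1 / 2 by rewrite divr_gt0.
pose a y (j : int) : \bar R :=
  if j == 0 then 0%E else (cabs (F (x - (y + j%:~R * c^-1))))%:E.
have a0 y j : (0 <= a y j)%E by rewrite /a; case: ifP; rewrite // lee_fin cabs_ge0.
pose M (j : int) : \bar R := ((C * (1 + c^-1 / 2) `^ s) * decay s (x - j%:~R * c^-1))%:E.
have M0 j : (0 <= M j)%E by rewrite lee_fin !mulr_ge0 ?powR_ge0// decay_ge0.
have aM y j : `|y| < c^-1 / 2 -> (0 <= a y j <= M j)%E.
  move=> yc; rewrite a0/= /a; case: ifP => _; first exact: M0.
  rewrite lee_fin (le_trans (FC _))// -mulrA ler_wpM2l//.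
  have -> : x - (y + j%:~R / c) = (x - j%:~R / c) + - y by ring.
  rewrite (le_trans (decayD _ _ s0))// ler_wpM2r ?decay_ge0// normrN.
  by apply: ge0_ler_powR; rewrite ?nnegrE ?addr_ge0 ?(ltW c2)// lerD2l ltW.
have MS : (\esum_(j in [set: int]) M j < +oo)%E.
  have [L L0 LP] := lattice_sum_decay ci0 s1.
  under eq_esum do rewrite /M EFinM.
  rewrite esumZ; last 2 first.
  - by rewrite mulr_ge0// powR_ge0.
  - by move=> j; rewrite lee_fin decay_ge0.
  apply: (@le_lt_trans _ _ ((C * (1 + c^-1 / 2) `^ s)%:E * L%:E)%E); last by rewrite -EFinM ltry.
  rewrite lee_wpmul2l ?lee_fin ?mulr_ge0 ?powR_ge0// (le_trans _ (LP x))//.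
  rewrite -(esum_int_opp _ (A := [set: int])) //; apply: le_esum => j _.
  by rewrite rmorphN/= mulNr.
(* Beyond [J] the aliases total at most [e / 3] for every [y] in the half-cell; on the finite set
   [J] continuity of [F] suffices, and the last third pays for the increment at [j = 0]. *)
have [J finJ JP] := esum_tail M0 MS e30.
have sumJ (r : seq int) (f : R) : 0 < f -> exists2 d : R, 0 < d & forall y, `|y| < d ->
    (\sum_(j <- r) a y j <= \sum_(j <- r) a 0%R j + f%:E)%E.
  elim: r f => [|j r ih] f f0.
    by exists 1 => // y _; rewrite !big_nil add0e lee_fin ltW.
  have f20 : 0 < f / 2 by rewrite divr_gt0.
  have [d d0 dP] := ih _ f20.
  have [d' d'0 d'P] := ccont_dist (x - j%:~R * c^-1) Fc f20.
  exists (Num.min d d') => [|y]; first by rewrite lt_min d0.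
  rewrite lt_min => /andP[yd yd']; rewrite !big_cons.
  rewrite [in leRHS](splitr f) EFinD addeACA leeD ?dP// /a; case: ifP => _.
    by rewrite add0e lee_fin ltW.
  rewrite add0r -EFinD lee_fin -lerBlDl (le_trans _ (ltW (d'P (x - (y + j%:~R / c)) _)))//.
    by rewrite (le_trans (ler_norm _))// cabs_dist_le.
  rewrite (_ : x - (y + j%:~R / c) - (x - j%:~R / c) = - y); last by ring.
  by rewrite normrN.
have [d d0 dP] := sumJ (fset_set J) _ e30.
have [d' d'0 d'P] := ccont_dist x Fc e30.
exists (Num.min (c^-1 / 2) (Num.min d d')) => [|y]; first by rewrite !lt_min c2 d0.
rewrite !lt_min => /and3P[yc yd yd'].
have DE : periodization c (D x) y = ((D x y)%:E + \esum_(j in [set: int]) a y j)%E.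
  rewrite /periodization (esumID [set 0]); last by move=> j _; rewrite lee_fin cabs_ge0.
  rewrite setTI esum_set1 ?lee_fin ?cabs_ge0// mul0r addr0; congr (_ + _)%E.
  rewrite setTI esum_mkcond; apply: eq_esum => j _; rewrite /a.
  have [->|j0] := eqVneq j 0; first by rewrite memNset//=; apply; by [].
  rewrite mem_set/=; last by move/eqP; apply/negP.
  by rewrite /D cell_off// mul0r subr0.
rewrite DE.
have h1 : ((D x y)%:E <= (e / 3)%:E)%E.
  rewrite lee_fin /D cellE// mul1r ltW// d'P//.
  by rewrite addrAC subrr add0r normrN.
have h2 : (\esum_(j in [set: int]) a y j <= alias_sum x + (e / 3)%:E + (e / 3)%:E)%E.
  rewrite (le_trans (JP _ (fun j => aM y j yc)))// leeD2r//.
  rewrite fsbig_finite//= (le_trans (dP _ yd))// leeD2r//.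
  rewrite -fsbig_finite//=; apply: (@le_trans _ _ (\esum_(j in [set: int]) a 0%R j)).
    by apply: esum_ge; exists J.
  (* [a 0 j] samples at [x - j / c], [alias_sum] at [x + j / c]; reflection of [j] reconciles
     them. *)
  rewrite -(esum_int_opp _ (A := [set: int]))// esum_mkcond.
  rewrite /alias_sum [leRHS]esum_mkcond; apply: le_esum => j _.
  rewrite mem_set//= /a oppr_eq0; case: eqVneq => [->|j0].
    by rewrite memNset//=; apply.
  by rewrite mem_set//= rmorphN/= add0r mulNr opprK.
rewrite (le_trans (leeD h1 h2))// alias_sum_fine/= -!EFinD lee_fin; lra.
Qed.

(** Multiplying [F x] by the unit mass of the truncated kernel puts both terms under one integral,
    of modulus at most that of [D x] against the kernel; the one-sided approximate identity then
    applies. *)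
Lemma fejer_mean_limsup x (e : R) : 0 < e -> \forall n \near \oo,
  cabs (fejer_mean n x - F x) <= fine (alias_sum x) + e.
Proof.
move=> e0.
pose C' := C * (1 + `|x|) `^ s + (1 + c^-1 / 2) `^ s * cabs (F x).
have C'0 : 0 <= C' by rewrite addr_ge0// mulr_ge0 ?powR_ge0 ?cabs_ge0.
have [L L0 LP] := lattice_sum_decay ci0 s1.
have QB y : (periodization c (D x) y <= (C' * L)%:E)%E.
  apply: (@le_trans _ _ (\esum_(j in [set: int]) (C'%:E * (decay s (y + j%:~R * c^-1))%:E)%E)).
    by apply: le_esum => j _; rewrite -EFinM lee_fin; exact: D_decay.
  rewrite esumZ//; last by move=> j; rewrite lee_fin decay_ge0.
  by rewrite EFinM lee_wpmul2l ?lee_fin.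
have D0 y : 0 <= D x y by exact: cabs_ge0.
have R0 : 0 <= fine (alias_sum x) by rewrite fine_ge0// alias_sum_ge0.
have H := @integral_fejer_limsup _ c (D x) c0 (mD x) D0 _ QB _ R0 (periodization_D x) e e0.
near=> n; have n0 : (0 < n)%N by near: n; exists 1%N.
rewrite -lee_fin.
apply: (@le_trans _ _ (\int[mu]_y (D x y * (c * fejer c n y))%:E)%E); last by near: n.
have iF : cL1 (fun t => (cell (x - t) * K n (x - t))%:C).
  apply: (@decay_cL1 _ _ ((c * n%:R) * (1 + c^-1 / 2) `^ s * (1 + `|x|) `^ s) s) => //.
    apply: cmeas_real; apply: measurable_funM.
      exact: (measurableT_comp mcell (measurable_reflect x)).
    exact: (measurableT_comp (mK n) (measurable_reflect x)).
  move=> t; rewrite cabs_real ger0_norm; last first.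
    by rewrite mulr_ge0//; case/andP: (cell01 (x - t)).
  rewrite (_ : _ * decay s t = (1 + c^-1 / 2) `^ s * ((1 + `|x|) `^ s * decay s t) *
    (c * n%:R)); last by ring.
  apply: ler_pM => //.
  rewrite (le_trans (cell_decay _))// ler_wpM2l ?powR_ge0// addrC.
  by rewrite (le_trans (decayD _ _ s0))// decayN.
rewrite fejer_meanE -[F x]mulr1 -(integral_K_cell x n0) -cintegralZ//.
rewrite -cintegralB//; last exact: cL1Z.
apply: le_trans (le_cabs_cintegral _) _; first by apply: cL1B => //; exact: cL1Z.
rewrite -(ge0_integral_reflect x (f := fun y => (D x y * (c * fejer c n y))%:E)); last 2 first.
- by apply/measurable_EFinP; apply: measurable_funM => //; exact: mK.
- by move=> y; rewrite lee_fin mulr_ge0//; exact: K0.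
rewrite le_eqVlt; apply/orP; left; apply/eqP; apply: eq_integral => t _; congr EFin.
rewrite /D subKr -/(K n (x - t)) -[in RHS](ger0_norm (K0 n (x - t))) -cabs_real -cabsM.
congr (cabs _).
rewrite (_ : (cell (x - t) * K n (x - t))%:C = (cell (x - t))%:C * (K n (x - t))%:C).
  by rewrite mulrBl mulrA [F x * _]mulrC.
exact: rmorphM.
Unshelve. all: by end_near. Qed.

End FejerMeans.

(** * Cesaro means of nonnegative two-sided series *)

Section Cesaro.
Context {R : realType}.

Lemma esum_int (a : int -> \bar R) : (forall j, 0 <= a j)%E ->
  \esum_(j in [set: int]) a j = (\sum_(n <oo) (a (Posz n) + a (Negz n)))%E.
Proof.
move=> a0; rewrite nneseriesD; [|by move=> n _ _; exact: a0..].
rewrite (esumID [set j : int | (0 <= j)%R]); last by move=> j _; exact: a0.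
rewrite !setTI !nneseries_esumT//; congr (_ + _)%E.
  rewrite (@reindex_esum _ _ _ [set: nat] _ Posz)//.
  by split => //; [move=> n p _ _ []|case=> // n _; exists n].
rewrite (@reindex_esum _ _ _ [set: nat] _ Negz)//.
split => //; [move=> n p _ _ []//|case=> [n|n _]; last by exists n].
by case.
Qed.

Context (u : int -> R).
Hypothesis u0 : forall m, 0 <= u m.

Let v n := u (Posz n) + u (Negz n).

Let v0 n : 0 <= v n. Proof. by rewrite addr_ge0. Qed.

Let P M := \sum_(0 <= i < M) v i.

(** Cutting at [l = k]: the differences [k - l] run down from [k] to 0, then from [-1] to
    [-(n - k - 1)], the latter being [Negz 0] up to [Negz (n - k - 2)]. *)
Let row_sum (k n : nat) : (k < n)%N -> \sum_(0 <= l < n) u (k%:Z - l%:Z) =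
  \sum_(0 <= i < k.+1) u (Posz i) + \sum_(0 <= i < n - k.+1) u (Negz i).
Proof.
move=> kn; rewrite (big_cat_nat (n := k.+1))//=; congr (_ + _).
  rewrite big_nat_rev/= add0n; apply: eq_big_nat => i /andP[_ ik].
  by rewrite subSS subzn ?leq_subr// subKn.
rewrite -{1}[k.+1]add0n big_addn; apply: eq_big_nat => i _; congr u.
by rewrite NegzE; lia.
Qed.

Let sum_le (f : nat -> R) (m n : nat) : (forall i, 0 <= f i) -> (m <= n)%N ->
  \sum_(0 <= i < m) f i <= \sum_(0 <= i < n) f i.
Proof.
move=> f0 mn; rewrite [leRHS](big_cat_nat (n := m))//= lerDl.
by rewrite sumr_ge0.
Qed.

(** Every one of the [n] rows is a subsum of the two-sided partial sum [P n]. *)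
Lemma double_sum_le n : ((\sum_(0 <= k < n) \sum_(0 <= l < n) u (k%:Z - l%:Z))%:E <=
  n%:R%:E * \esum_(m in [set: int]) (u m)%:E)%E.
Proof.
rewrite esum_int; last by move=> j; rewrite lee_fin.
apply: (@le_trans _ _ (n%:R%:E * (P n)%:E)%E).
  rewrite -EFinM lee_fin.
  apply: (@le_trans _ _ (\sum_(0 <= k < n) P n)); last first.
    by rewrite big_const_nat subn0 iter_addr_0 mulr_natl.
  apply: ler_sum_nat => k /andP[_ kn]; rewrite row_sum// /P big_split/=.
  by rewrite lerD// sum_le// leq_subr.
rewrite lee_wpmul2l ?lee_fin// /P -sumEFin.
by apply: nneseries_lim_ge => i _ _; rewrite lee_fin.
Qed.

(** The rows [M <= k < n - M] contain all of [P M], and there are [n - 2 M] of them; as [n] grows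
    with [M] fixed, the proportion of lost rows vanishes. *)
Lemma esum_le_double_sum (X : R) :
  (forall e : R, 0 < e -> \forall n \near \oo,
     (\sum_(0 <= k < n) \sum_(0 <= l < n) u (k%:Z - l%:Z)) / n%:R <= X + e) ->
  (\esum_(m in [set: int]) (u m)%:E <= X%:E)%E.
Proof.
move=> H; rewrite esum_int; last by move=> j; rewrite lee_fin.
apply: lime_le; first by apply: is_cvg_nneseries => n _ _; rewrite -EFinD lee_fin addr_ge0.
apply: nearW => M; under eq_bigr do rewrite -EFinD; rewrite sumEFin lee_fin -/(P M).
have P0 : 0 <= P M by rewrite sumr_ge0.
apply/ler_addgt0Pr => e e0; have e20 : 0 < e / 2 by rewrite divr_gt0.
suff [n [n2 nH nb]] : exists n, [/\ (2 * M < n)%N,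
    (\sum_(0 <= k < n) \sum_(0 <= l < n) u (k%:Z - l%:Z)) / n%:R <= X + e / 2 &
    (2 * M)%:R * P M / n%:R <= e / 2].
  have n0 : 0 < n%:R :> R by rewrite ltr0n (leq_ltn_trans _ n2).
  have h : (n - 2 * M)%:R * P M <= \sum_(0 <= k < n) \sum_(0 <= l < n) u (k%:Z - l%:Z).
    apply: (@le_trans _ _ (\sum_(M <= k < n - M) \sum_(0 <= l < n) u (k%:Z - l%:Z))).
      apply: (@le_trans _ _ (\sum_(M <= k < n - M) P M)).
        by rewrite big_const_nat iter_addr_0 mulr_natl -subnDA addnn -mul2n.
      apply: ler_sum_nat => k /andP[Mk kM]; have kn : (k < n)%N by lia.
      rewrite row_sum// /P big_split/= lerD// sum_le//; lia.
    rewrite [leRHS](big_cat_nat (n := M))//=; last by lia.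
    rewrite [X in _ + X](big_cat_nat (n := (n - M)))//=; [|by lia..].
    rewrite ler_wpDl ?ler_wpDr// sumr_ge0// => k _; exact: sumr_ge0.
  have : (n - 2 * M)%:R * P M / n%:R <= X + e / 2.
    by rewrite (le_trans _ nH)// ler_wpM2r// invr_ge0 ltW.
  rewrite natrB; last exact: ltnW.
  rewrite mulrBl mulrBl mulrAC divff ?gt_eqF// mul1r; lra.
near \oo => n; exists n; split.
- by near: n; exists (2 * M).+1.
- by near: n; exact: H.
- have n0 : 0 < n%:R :> R by rewrite ltr0n; near: n; exists 1%N.
  rewrite ler_pdivrMr// -ler_pdivrMl//.
  by near: n; exact: nbhs_infty_ger.
Unshelve. all: by end_near. Qed.

End Cesaro.

(** * Sampling inequalities with aliasing error *)

Section Sampling.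
Context {R : realType}.
Notation mu := (@lebesgue_measure R).
Context (c : R) (F : R -> R[i]) (C s : R).
Hypothesis c0 : 0 < c.
Hypothesis s1 : 1 < s.
Hypothesis Fc : ccont F.
Hypothesis FC : forall t, cabs (F t) <= C * decay s t.

Definition aliasing_error : \bar R := (\int[mu]_x ((cabs (F x))%:E * alias_sum c F x))%E.

Definition sample_energy : \bar R :=
  \esum_(k in [set: int]) (cabs (fourier F (k%:~R * c)) ^+ 2)%:E.

Let F1 : cL1 F. Proof. by apply: decay_cL1 FC => //; exact: ccont_cmeas. Qed.

Let F_bounded t : cabs (F t) <= C.
Proof.
have C0 : 0 <= C.
  have := le_trans (cabs_ge0 _) (FC 0).
  by rewrite /decay normr0 addr0 powR1 mulr1.
by rewrite (le_trans (FC t))// ler_piMr// decay_le1// ltW// (lt_trans ltr01).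
Qed.

Lemma decay_cL2 : cL2 F.
Proof.
split; first exact: F1.1.
have [_ FFoo] := cL1_bM F1.1 F_bounded F1.
by rewrite /sqnorm; under eq_integral do rewrite expr2 -cabsM.
Qed.

Let u (m : int) : R := cabs (fourier F (m%:~R * c)) ^+ 2.

Let u0 m : 0 <= u m. Proof. exact: sqr_ge0. Qed.

Let A n : R := c * ((\sum_(0 <= k < n) \sum_(0 <= l < n) u (k%:Z - l%:Z)) / n%:R).

(** Pairing the character of frequency [m c] with [F] gives the conjugate of [fourier F (m c)], so
    each coefficient meets its own conjugate and only energies remain. *)
Lemma fejer_mean_pairing n :
  cintegral (fun x => fejer_mean c F n x * (F x)^*) = (A n)%:C.
Proof.
have i1 w : cL1 (fun x => fourier F w * (cexpi (- (2 * pi * x * w)) * F x)^*).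
  by apply/cL1Z/cL1J/cL1_char.
have E x : fejer_mean c F n x * (F x)^* = (c / n%:R)%:C *
    \sum_(0 <= k < n) \sum_(0 <= l < n)
      fourier F ((k%:R - l%:R) * c) * (cexpi (- (2 * pi * x * ((k%:R - l%:R) * c))) * F x)^*.
  rewrite /fejer_mean -mulrA mulr_suml; congr (_ * _); apply: eq_bigr => k _.
  rewrite mulr_suml; apply: eq_bigr => l _; rewrite -mulrA; congr (_ * _).
  transitivity (conjc (cexpi (- (2 * pi * x * ((k%:R - l%:R) * c)))) * conjc (F x)).
    by rewrite cexpiJ opprK; congr (_ * _); congr cexpi; ring.
  by rewrite -rmorphM.
under eq_cintegral do rewrite E.
rewrite cintegralZ; last by apply: cL1_sum => k; apply: cL1_sum => l; exact: i1.
rewrite cintegral_sum; last by move=> k; apply: cL1_sum => l; exact: i1.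
have -> : (A n)%:C = (c / n%:R)%:C *
    (\sum_(0 <= k < n) \sum_(0 <= l < n) u (k%:Z - l%:Z))%:C.
  by rewrite -rmorphM/=; congr (_%:C); rewrite /A; ring.
congr (_ * _); rewrite rmorph_sum/=; apply: eq_bigr => k _.
rewrite cintegral_sum; last by move=> l; exact: i1.
rewrite rmorph_sum/=; apply: eq_bigr => l _.
rewrite cintegralZ; last by apply: (@cL1J _ (fun x => _)); exact: cL1_char.
rewrite (@cintegralJ _ (fun x => _)); last exact: cL1_char.
by rewrite mulcJ /u rmorphB.
Qed.

Lemma aliasing_error_fin : aliasing_error \is a fin_num.
Proof.
have [B B0 BP] := alias_sum_le c0 s1 FC.
have as0 x : (0 <= alias_sum c F x)%E by exact: alias_sum_ge0.
have ma := measurable_alias_sum c Fc.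
have mF := measurable_cabsE F1.1.
rewrite ge0_fin_numE; last first.
  by apply: integral_ge0 => x _; rewrite mule_ge0// lee_fin cabs_ge0.
apply: (@le_lt_trans _ _ (\int[mu]_x (B%:E * (cabs (F x))%:E))%E).
  apply: ge0_le_integral => //.
  - by move=> x _; rewrite mule_ge0// lee_fin cabs_ge0.
  - exact: emeasurable_funM.
  - by apply: emeasurable_funM => //; exact: measurable_cst.
  - by move=> x _; rewrite muleC lee_wpmul2r ?lee_fin ?cabs_ge0.
rewrite ge0_integralZl ?lee_fin//; last by move=> x _; rewrite lee_fin cabs_ge0.
by rewrite (L1norm_fine F1) -EFinM ltry.
Qed.

(** The difference is the pairing of [fejer_mean - F] with [F], and the pointwise limsup bound is
    integrated against [|F|]. *)
Let A_limsup (e : R) : 0 < e -> \forall n \near \oo,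
  `|A n - fine (sqnorm F)| <= fine aliasing_error + e.
Proof.
move=> e0.
have [B B0 BP] := fejer_mean_bounded c0 s1 Fc FC.
have [B' B'0 B'P] := alias_sum_le c0 s1 FC.
pose r x := fine (alias_sum c F x).
have rE x : alias_sum c F x = (r x)%:E by exact: alias_sum_fine c0 s1 FC x.
have r0 x : 0 <= r x by rewrite /r fine_ge0// alias_sum_ge0.
have mr : measurable_fun [set: R] r.
  have := measurable_alias_sum c Fc; rewrite (funext rE) => ma.
  exact/measurable_EFinP.
(* The order is shifted to [n.+1] because the uniform bound on the means is stated for positive
   orders. *)
pose d n x := cabs (fejer_mean c F n.+1 x - F x).
have md n : measurable_fun [set: R] (d n).
  by apply: measurable_cabs; apply: cmeasB F1.1; exact: fejer_mean_cmeas.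
(* The excess over the alias sum is bounded and tends to 0, so dominated convergence applies to it
   although [d] itself has only a limsup bound. *)
pose en n x := Num.max 0 (d n x - r x).
have en0 n x : 0 <= en n x by rewrite le_max lexx.
have dre n x : d n x <= r x + en n x.
  by rewrite -lerBlDl le_max lexx orbT.
have men n : measurable_fun [set: R] (en n).
  by apply: measurable_maxr; [exact: measurable_cst|exact: measurable_funB].
have mF := measurable_cabs F1.1.
have mFe n : measurable_fun [set: R] (fun x => (cabs (F x) * en n x)%:E).
  by apply/measurable_EFinP; apply: measurable_funM => //; exact: men.
have mFa : measurable_fun [set: R] (fun x => (cabs (F x))%:E * alias_sum c F x)%E.
  by apply: emeasurable_funM; [exact/measurable_EFinP|exact: measurable_alias_sum].
have enB n x : en n x <= B + C.
  rewrite ge_max addr_ge0 ?(le_trans (cabs_ge0 _) (F_bounded x))//=.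
  rewrite (@le_trans _ _ (d n x))//; first by rewrite gerBl.
  by rewrite (le_trans (cabsB _ _))// lerD// BP.
have H0 : (fun n => \int[mu]_x (cabs (F x) * en n x)%:E)%E @ \oo --> (0 : \bar R).
  apply: (@cvg_integral0 _ _ (fun x => cabs (F x) * (B + C))) => //.
  - by move=> n; exact: measurable_funM.
  - by apply: measurable_funM => //; exact: measurable_cst.
  - by move=> n x; rewrite mulr_ge0 ?cabs_ge0//= ler_wpM2l ?cabs_ge0.
  - under eq_integral do rewrite EFinM muleC.
    rewrite ge0_integralZl//.
    + by rewrite (L1norm_fine F1) -EFinM ltry.
    + exact/measurable_EFinP.
    + by move=> x _; rewrite lee_fin cabs_ge0.
    + by rewrite lee_fin addr_ge0// (le_trans (cabs_ge0 _) (F_bounded 0)).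
  - move=> x _; rewrite -[X in _ --> X](mulr0 (cabs (F x))); apply: cvgM; first exact: cvg_cst.
    apply/cvgr0Pnorm_lt => f f0.
    have [N _ HN] := fejer_mean_limsup c0 s1 Fc FC x (divr_gt0 f0 (ltr0n _ 2)).
    exists N => // n /= Nn; have {}HN := HN n.+1 (leq_trans Nn (leqnSn n)).
    rewrite ger0_norm// gt_max f0/= (@le_lt_trans _ _ (f / 2))//; last first.
      by rewrite ltr_pdivrMr// ltr_pMr// ltr1n.
    by rewrite lerBlDl.
have [N _ HN] := cvge0_lt H0 e0.
exists N.+1 => // -[//|n] /= Nn; have {HN} hn := HN n Nn.
have iF : cL1 (fun x => (fejer_mean c F n.+1 x - F x) * (F x)^*).
  apply: (@cL1_bM _ _ _ (B + C)).
  - by apply: cmeasB F1.1; exact: fejer_mean_cmeas.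
  - by move=> x; rewrite (le_trans (cabsB _ _))// lerD// BP.
  - exact: cL1J.
have iM : cL1 (fun x => fejer_mean c F n.+1 x * (F x)^*).
  apply: (@cL1_bM _ _ _ B).
  - exact: fejer_mean_cmeas.
  - by move=> x; exact: BP.
  - exact: cL1J.
have E : (A n.+1 - fine (sqnorm F))%:C =
    cintegral (fun x => (fejer_mean c F n.+1 x - F x) * (F x)^*).
  rewrite rmorphB/= -fejer_mean_pairing -(inner_self decay_cL2) /inner -cintegralB//.
    by apply: eq_cintegral => x; rewrite mulrBl.
  exact: cL2MJ decay_cL2 decay_cL2.
rewrite -cabs_real E -lee_fin (le_trans (le_cabs_cintegral iF))//.
rewrite EFinD fineK ?aliasing_error_fin//.
apply: (@le_trans _ _ (\int[mu]_x ((cabs (F x))%:E * alias_sum c F x +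
   (cabs (F x) * en n x)%:E))%E).
  apply: ge0_le_integral => //.
  - by move=> x _; rewrite lee_fin cabs_ge0.
  - exact: measurable_cabsE iF.1.
  - by apply: emeasurable_funD; [exact: mFa|exact: mFe].
  - move=> x _; rewrite rE -EFinM -EFinD lee_fin cabsM cabs_conj -mulrDr mulrC.
    by apply: ler_wpM2l; [exact: cabs_ge0|exact: dre].
rewrite ge0_integralD//.
- by rewrite leeD2l// ltW.
- by move=> x _; rewrite rE -EFinM lee_fin mulr_ge0 ?cabs_ge0.
- by move=> x _; rewrite lee_fin mulr_ge0 ?cabs_ge0.
- exact: mFe.
Qed.

(** Nonnegativity lets a bound on the Cesaro means pass to the series; finiteness of the energy is a
    by-product. *)
Lemma sample_energy_le : (c%:E * sample_energy <= sqnorm F + aliasing_error)%E.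
Proof.
have H : (sample_energy <= (c^-1 * (fine (sqnorm F) + fine aliasing_error))%:E)%E.
  apply: (esum_le_double_sum u0) => e e0.
  have ce0 : 0 < c * e by rewrite mulr_gt0.
  have := A_limsup ce0; apply: filterS => n.
  rewrite ler_norml => /andP[_ h].
  rewrite -(ler_pM2l c0) mulrDr mulVKf ?gt_eqF// -/(A n); lra.
apply: (@le_trans _ _ (c%:E * (c^-1 * (fine (sqnorm F) + fine aliasing_error))%:E)%E).
  by rewrite lee_wpmul2l// lee_fin ltW.
rewrite -EFinM mulVKf ?gt_eqF// EFinD.
by rewrite fineK ?(cL2_fin_num decay_cL2)// fineK ?aliasing_error_fin.
Qed.

(** Each Cesaro mean is at most the full sum, so one sufficiently large order is enough for each
    [e]. *)
Lemma le_sample_energy : (sqnorm F <= c%:E * sample_energy + aliasing_error)%E.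
Proof.
rewrite -[sqnorm F]fineK ?(cL2_fin_num decay_cL2)// -[aliasing_error]fineK ?aliasing_error_fin//.
apply/lee_addgt0Pr => e e0.
have [N _ HN] := A_limsup e0.
have := HN N.+1 (leqnSn N); rewrite /= ler_norml => /andP[h _].
apply: (@le_trans _ _ ((A N.+1)%:E + (fine aliasing_error)%:E + e%:E)%E).
  by rewrite -!EFinD lee_fin; lra.
rewrite leeD2r// leeD2r// /A EFinM lee_wpmul2l ?lee_fin ?(ltW c0)//.
rewrite mulrC EFinM.
have N0 : 0 < N.+1%:R :> R by rewrite ltr0n.
apply: (@le_trans _ _ ((N.+1%:R^-1)%:E * (N.+1%:R%:E * sample_energy))%E).
  by rewrite lee_wpmul2l ?lee_fin ?invr_ge0//; exact: double_sum_le.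
by rewrite muleA -EFinM mulVf ?gt_eqF// mul1e.
Qed.

End Sampling.

(** * The Plancherel theorem *)

Section PlancherelCompact.
Context {R : realType}.
Notation mu := (@lebesgue_measure R).
Implicit Types (f g : R -> R[i]) (L M : R).

Lemma normr_int_ge1 (j : int) : j != 0 -> 1 <= `|j%:~R : R|.
Proof. by move=> j0; rewrite -intr_norm -[1]/(1%:~R) ler_int -gtz0_ge1 normr_gt0. Qed.

Lemma norm2_ge0 f : 0 <= norm2 f.
Proof. by rewrite fine_ge0// Lpnorm2E poweR_ge0. Qed.

Lemma norm2D f g : cL2 f -> cL2 g -> norm2 (fun x => f x + g x) <= norm2 f + norm2 g.
Proof.
move=> fi gi; have fgi := cL2D fi gi.
have fin h : cL2 h -> Lpnorm 2%:E h \is a fin_num.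
  by move=> hi; rewrite Lpnorm2E sqnorm_fine.
rewrite /norm2 -fineD ?fin// fine_le ?fin ?fin_numD ?fin//.
have m2 := @minkowski_EFin _ _ _ mu (fun x => cabs (f x)) (fun x => cabs (g x)) 2
  (measurable_cabs fi.1) (measurable_cabs gi.1) ltac:(by rewrite ler1n).
apply: le_trans m2; rewrite /Lpnorm unlock; apply: gt0_ler_poweR => //.
- by rewrite in_itv/= leey integral_ge0// => x _; rewrite poweR_ge0.
- by rewrite in_itv/= leey integral_ge0// => x _; rewrite poweR_ge0.
apply: ge0_le_integral => //.
- by move=> x _; rewrite poweR_ge0.
- apply: (measurableT_comp (measurable_poweR 2)).
  by apply: measurableT_comp => //; exact: measurable_cabsE fgi.1.
- apply: (measurableT_comp (measurable_poweR 2)).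
  apply: measurableT_comp => //; apply/measurable_EFinP.
  by apply: measurable_funD; [exact: measurable_cabs fi.1|exact: measurable_cabs gi.1].
- move=> x _; apply: gt0_ler_poweR => //; rewrite ?in_itv/= ?leey ?andbT ?lee_fin//.
  by rewrite !ger0_norm ?addr_ge0 ?cabs_ge0// cabsD.
Qed.

Lemma norm2_sqrt f : norm2 f = Num.sqrt (fine (sqnorm f)).
Proof. by rewrite -norm2_sqr sqrtr_sqr ger0_norm ?norm2_ge0. Qed.

Definition bounded_compact f L M :=
  (forall t, cabs (f t) <= M) /\ (forall t, L < `|t| -> f t = 0).

(** The exponent 2 is one choice above 1; it brings compactly supported functions under the sampling
    inequalities. *)
Lemma bounded_compact_decay f L M : 0 <= L -> bounded_compact f L M ->
  forall t, cabs (f t) <= M * (1 + L) `^ 2 * decay 2 t.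
Proof.
move=> L0 [fM fL] t; have M0 := le_trans (cabs_ge0 _) (fM t).
have [Lt|tL] := ltP L `|t|.
  by rewrite fL// cabs0 !mulr_ge0 ?powR_ge0 ?decay_ge0.
rewrite (le_trans (fM t))// -mulrA ler_peMr// /decay powRN.
rewrite ler_pdivlMr ?powR_gt0 ?ltr_pwDl// mul1r.
by apply: ge0_ler_powR; rewrite ?nnegrE ?addr_ge0// lerD2l.
Qed.

(** The period [b = 2 L + 1] exceeds the length of the support, so [x] and [x + j b] are never both
    in it and the aliasing error vanishes. The energy on the grid [th + c Z] is then the same for
    all offsets, and integrating over [th] in a cell reassembles the norm of the transform. *)
Lemma plancherel_compact f L M : 0 <= L -> ccont f -> bounded_compact f L M ->
  sqnorm (fourier f) = sqnorm f.
Proof.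
move=> L0 fc fLM; have fd := bounded_compact_decay L0 fLM.
have s2 : (1 : R) < 2 by rewrite ltr1n.
have f1 : cL1 f by apply: decay_cL1 fd => //; exact: ccont_cmeas.
pose b := 2 * L + 1; have b0 : 0 < b by rewrite ltr_wpDl// mulr_ge0.
pose c := b^-1; have c0 : 0 < c by rewrite invr_gt0.
have mf2 : measurable_fun [set: R] (fun w => (cabs (fourier f w) ^+ 2)%:E).
  by apply: measurable_sqcabsE; exact: cmeas_fourier.
have E (th : R) : \esum_(k in [set: int]) (cabs (fourier f (th + k%:~R * c)) ^+ 2)%:E =
    (b%:E * sqnorm f)%E.
  (* Modulation moves the grid by [th] and leaves all moduli, hence the absence of aliasing,
     unchanged. *)
  pose g t := cexpi (- (2 * pi * t * th)) * f t.
  have gc : ccont g.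
    apply: ccontM fc; apply: ccont_cexpi.
    rewrite (_ : (fun t => - (2 * pi * t * th)) = (fun t => - (2 * pi * th) * t)).
      exact: continuous_mull.
    by apply/funext => t; ring.
  have gabs t : cabs (g t) = cabs (f t) by rewrite cabsM cabs_cexpi mul1r.
  have gd t : cabs (g t) <= M * (1 + L) `^ 2 * decay 2 t by rewrite gabs.
  have ae : aliasing_error c g = 0%E.
    rewrite /aliasing_error; under eq_integral => x _.
      have -> : ((cabs (g x))%:E * alias_sum c g x = 0)%E; last over.
      have [Lx|xL] := ltP L `|x|; first by rewrite gabs fLM.2// cabs0 mul0e.
      rewrite /alias_sum esum1 ?mule0// => j j0; rewrite gabs fLM.2 ?cabs0//.
      rewrite /c invrK; have j1 := normr_int_ge1 j0.
      have := lerB_normD (j%:~R * b) x; rewrite normrM (gtr0_norm b0) => h.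
      by rewrite addrC (lt_le_trans _ h)//; move: j1 xL; rewrite /b; nra.
    by rewrite integral0.
  have EE : sample_energy c g = \esum_(k in [set: int]) (cabs (fourier f (th + k%:~R * c)) ^+ 2)%:E.
    apply: eq_esum => k _; congr ((cabs _ ^+ 2)%:E); apply: eq_cintegral => x.
    by rewrite /g mulrA -cexpiD; congr (cexpi _ * _); ring.
  have h1 := sample_energy_le c0 s2 gc gd; have h2 := le_sample_energy c0 s2 gc gd.
  rewrite ae !adde0 in h1 h2.
  have sg : sqnorm g = sqnorm f.
    by rewrite /sqnorm; under eq_integral do rewrite gabs.
  have h : (c%:E * sample_energy c g)%E = sqnorm f.
    by rewrite -sg; apply/eqP; rewrite eq_le h1 h2.
  have bc : b * c = 1 by rewrite mulfV// gt_eqF.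
  by rewrite -EE -h muleA -EFinM bc mul1e.
rewrite {1}/sqnorm (@ge0_integral_cells _ 0 c)//; last first.
  by move=> x; rewrite lee_fin sqr_ge0.
rewrite -ge0_integral_esum//.
- under eq_integral do rewrite E.
  rewrite integral_cst//= lebesgue_measure_itv/= add0r lte_fin c0 -EFinD subr0.
  by rewrite muleC muleA -EFinM mulVf ?gt_eqF// mul1e.
- move=> k; apply: (@measurable_funS _ _ _ _ setT) => //.
  exact: (measurableT_comp mf2 (measurable_shiftr _)).
- by move=> k x; rewrite lee_fin sqr_ge0.
Qed.

End PlancherelCompact.

(** * Approximation by continuous functions of compact support *)

Section Density.
Context {R : realType}.
Notation mu := (@lebesgue_measure R).

(** An approximant on [[-(L + 1), L + 1]] is clamped to [[-M, M]] and multiplied by the trapezoid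
    [chi]. Clamping does not increase the distance to [g] since [|g| <= M]; the cutoff acts only
    where [g] vanishes, and there it shrinks the approximant. *)
Lemma approx_compact_real (g : R -> R) (L M e : R) :
  measurable_fun [set: R] g -> (forall t, `|g t| <= M) -> 0 <= L ->
  (forall t, L < `|t| -> g t = 0) -> 0 < e ->
  exists h : R -> R, [/\ continuous h, (forall t, `|h t| <= M),
    (forall t, L + 1 < `|t| -> h t = 0) & (\int[mu]_t (`|g t - h t|)%:E < e%:E)%E].
Proof.
move=> mg gM L0 gL e0; have M0 := le_trans (normr_ge0 _) (gM 0).
pose E : set R := `[- (L + 1), L + 1]%classic.
have mE : measurable E by exact: measurable_itv.
have finE : (mu E < +oo)%E.
  by rewrite /E /= lebesgue_measure_itv/=; case: ifP => _; rewrite ?ltry// -EFinD ltry.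
have gi : mu.-integrable E (EFin \o g).
  apply: measurable_bounded_integrable => //; first exact: measurable_funS mg.
  by exists M; split; [exact: num_real|move=> x Mx y _; apply: (le_trans _ (ltW Mx))].
have [r [rc ri r0]] := approximation_continuous_integrable mE finE gi.
have [N _ /(_ N (leqnn N)) rN] := cvge0_lt r0 e0.
pose chi (t : R) : R := Num.max 0 (Num.min 1 (L + 1 - `|t|)).
have chi01 t : 0 <= chi t <= 1.
  by rewrite /chi le_max lexx/= ge_max ler01 ge_min lexx.
have chi1 t : `|t| <= L -> chi t = 1.
  move=> tL; rewrite /chi (min_idPl _); last by lra.
  by apply/max_idPr.
have chi0 t : L + 1 <= `|t| -> chi t = 0.
  move=> tL; rewrite /chi (min_idPr _); last by lra.
  by apply/max_idPl; lra.
pose cl (x : R) : R := Num.max (- M) (Num.min M x).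
have clM x : `|cl x| <= M.
  rewrite ler_norml /cl le_max lexx/= ge_max; apply/andP; split; first by lra.
  by rewrite ge_min lexx.
have cl_dist x y : `|x| <= M -> `|x - cl y| <= `|x - y|.
  rewrite ler_norml => /andP[h1 h2]; rewrite /cl.
  have [yM|yM] := ltP y (- M).
    rewrite (min_idPr _); last by lra.
    rewrite (max_idPl _); last by lra.
    by rewrite !ger0_norm; lra.
  have [My|My] := ltP M y.
    rewrite (max_idPr _); last by lra.
    by rewrite !ler0_norm; lra.
  by rewrite (max_idPr _).
have absc : continuous (fun t : R => `|t|) by move=> t; exact: norm_continuous.
pose h t := chi t * cl (r N t).
have hc : continuous h.
  move=> t; apply: cvgM.
    apply: (@continuous_max _ R (fun=> 0) (fun t : R => Num.min 1 (L + 1 - `|t|))); first exact: cvg_cst.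
    apply: (@continuous_min _ R (fun=> 1) (fun t : R => L + 1 - `|t|)); first exact: cvg_cst.
    by apply: cvgB; [exact: cvg_cst|exact: absc].
  apply: (@continuous_max _ R (fun=> - M) (fun t : R => Num.min M (r N t))); first exact: cvg_cst.
  apply: (@continuous_min _ R (fun=> M) (fun t : R => r N t)); first exact: cvg_cst.
  exact: rc.
exists h; split => //.
- move=> t; rewrite normrM -[leRHS]mul1r ler_pM//.
  by case/andP: (chi01 t) => ? ?; rewrite ger0_norm.
- by move=> t /ltW/chi0 ct; rewrite /h ct mul0r.
have mnorm (k : R -> R) : measurable_fun [set: R] k -> measurable_fun [set: R] (fun t => `|g t - k t|%:E).
  move=> mk; apply/measurable_EFinP; apply: measurableT_comp => //.
  exact: measurable_funB.
apply: (le_lt_trans _ rN); rewrite [leRHS]integral_mkcond.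
apply: ge0_le_integral => //.
- by apply: mnorm; exact: continuous_measurable_fun.
- apply/(measurable_restrictT _ _).1; first exact: mE.
  apply: (@measurable_funS _ _ _ _ setT) => //; apply: mnorm.
  by apply: continuous_measurable_fun; exact: rc.
have EP t : (t \in E) = (`|t| <= L + 1).
  by apply/idP/idP; rewrite inE /E/= in_itv/= -ler_norml.
move=> t _; rewrite patchE EP; case: ifPn => [tE|].
  rewrite lee_fin /h.
  have [tL|Lt] := leP `|t| L; first by rewrite chi1// mul1r cl_dist.
  rewrite gL// !sub0r !normrN normrM.
  have := cl_dist 0 (r N t); rewrite normr0 !sub0r !normrN => hh.
  rewrite -[leRHS]mul1r ler_pM// ?hh//.
  by case/andP: (chi01 t) => ? ?; rewrite ger0_norm.
rewrite -ltNge => Lt; rewrite /h chi0 ?(ltW Lt)// gL; last by lra.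
by rewrite mul0r subrr normr0.
Qed.

(** Truncating [f] in height as well as in place keeps [|g - h|] bounded, whence closeness in L1
    forces closeness in L2. *)
Lemma approx_compact (f : R -> R[i]) (e : R) : cL1 f -> cL2 f -> 0 < e ->
  exists h : R -> R[i], exists L : R, exists M : R,
    [/\ 0 <= L, ccont h, bounded_compact h L M,
        L1norm (fun t => f t - h t) < e & norm2 (fun t => f t - h t) < e].
Proof.
move=> f1 f2 e0; have e20 : 0 < e / 2 by rewrite divr_gt0.
have mf := measurable_cabs f1.1.
pose T n : set R := [set t | `|t| <= n%:R /\ cabs (f t) <= n%:R].
have mT n : measurable (T n).
  have -> : T n = [set t | `|t| <= n%:R] `&` [set t | cabs (f t) <= n%:R] by [].
  apply: measurableI.
    rewrite -[X in measurable X]setTI.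
    by apply: (measurable_fun_le (f := fun t : R => `|t|) (g := fun=> n%:R)) => //;
      exact: measurableT_comp.
  rewrite -[X in measurable X]setTI.
  exact: (measurable_fun_le (f := fun t => cabs (f t)) (g := fun=> n%:R)).
pose g n t : R[i] := (\1_(T n) t)%:C * f t.
have mg n : cmeas (g n).
  by apply: cmeasM f1.1; apply: cmeas_real; exact: measurable_indic.
have gE n t : g n t = if t \in T n then f t else 0.
  by rewrite /g indicE; case: (t \in T n); rewrite ?mul1r ?mul0r.
have dle n t : cabs (f t - g n t) <= cabs (f t).
  by rewrite gE; case: ifP => _; rewrite ?subrr ?cabs0 ?cabs_ge0// subr0.
have dcv t : (fun n => cabs (f t - g n t)) @ \oo --> (0 : R).
  pose K := Num.max `|t| (cabs (f t)).
  apply/cvgr0Pnorm_lt => z z0; near=> n.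
  rewrite gE mem_set ?subrr ?cabs0 ?normr0//=.
  have : K <= n%:R by near: n; exact: nbhs_infty_ger.
  by rewrite ge_max => /andP.
have c1 := @cvg_integral0 _ (fun n t => cabs (f t - g n t)) (fun t => cabs (f t)) setT
  measurableT (fun n => measurable_cabs (cmeasB f1.1 (mg n))) mf.
have {}c1 : (fun n => \int[mu]_t (cabs (f t - g n t))%:E)%E @ \oo --> (0 : \bar R).
  apply: c1; [by move=> n t; rewrite cabs_ge0 dle|exact: f1.2|by move=> t _; exact: dcv].
have c2 := @cvg_integral0 _ (fun n t => cabs (f t - g n t) ^+ 2) (fun t => cabs (f t) ^+ 2) setT
  measurableT (fun n => measurable_funX 2 (measurable_cabs (cmeasB f1.1 (mg n)))) (measurable_funX 2 mf).
have {}c2 : (fun n => sqnorm (fun t => f t - g n t)) @ \oo --> (0 : \bar R).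
  apply: c2; [|exact: f2.2|].
    by move=> n t; rewrite sqr_ge0/= ler_pXn2r ?nnegrE ?cabs_ge0// dle.
  move=> t _; rewrite -[X in _ --> X](mulr0 (0 : R)).
  by under eq_fun do rewrite expr2; apply: cvgM; exact: dcv.
have ee0 : 0 < (e / 2) ^+ 2 by rewrite exprn_gt0.
have [n [g1 g2]] : exists n, (\int[mu]_t (cabs (f t - g n t))%:E < (e / 2)%:E)%E /\
    (sqnorm (fun t => f t - g n t)%R < ((e / 2) ^+ 2)%:E)%E.
  near \oo => n; exists n; split; near: n; exact: cvge0_lt.
pose M : R := n%:R; have M0 : 0 <= M by [].
have gM t : cabs (g n t) <= M.
  by rewrite gE; case: ifPn => [|_]; [rewrite inE => -[]|rewrite cabs0].
have gL t : M < `|t| -> g n t = 0.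
  by move=> Mt; rewrite gE memNset// => -[]; rewrite leNgt Mt.
(* The first bound makes the L1 error [2 d] at most [e / 2]. The second serves L2: as
   [|g - h| <= 3 M], the squared error is below [6 M d <= (e / 2)^2]. *)
pose d := Num.min (e / 4) ((e / 2) ^+ 2 / (8 * (M + 1))).
have d0 : 0 < d by rewrite lt_min !divr_gt0// mulr_gt0// ltr_pwDr.
have [h1 [h1c h1M h1L h1d]] := @approx_compact_real (fun t => complex.Re (g n t)) M M d
  (mg n).1 (fun t => le_trans (cabs_Re _) (gM t)) M0 (fun t Mt => congr1 (@complex.Re R) (gL t Mt)) d0.
have [h2 [h2c h2M h2L h2d]] := @approx_compact_real (fun t => complex.Im (g n t)) M M d
  (mg n).2 (fun t => le_trans (cabs_Im _) (gM t)) M0 (fun t Mt => congr1 (@complex.Im R) (gL t Mt)) d0.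
pose h t : R[i] := h1 t +i* h2 t.
have hc : ccont h by split.
have mgh : cmeas (fun t => g n t - h t) by apply: cmeasB => //; exact: ccont_cmeas.
have I1 : (\int[mu]_t (cabs (g n t - h t))%:E < (2 * d)%:E)%E.
  apply: (@le_lt_trans _ _ (\int[mu]_t (`|complex.Re (g n t) - h1 t|%:E + `|complex.Im (g n t) - h2 t|%:E))%E).
    apply: ge0_le_integral => //.
    - by move=> t _; rewrite lee_fin cabs_ge0.
    - exact: measurable_cabsE.
    - apply: emeasurable_funD; apply/measurable_EFinP; apply: measurableT_comp => //;
        apply: measurable_funB; try exact: continuous_measurable_fun.
        exact: (mg n).1.
      exact: (mg n).2.
    - by move=> t _; rewrite -EFinD lee_fin (le_trans (cabs_le_ReIm _))// cReD cImD cReN cImN.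
  rewrite ge0_integralD//; first last.
  - apply/measurable_EFinP; apply: measurableT_comp => //; apply: measurable_funB.
      exact: (mg n).2.
    exact: continuous_measurable_fun.
  - apply/measurable_EFinP; apply: measurableT_comp => //; apply: measurable_funB.
      exact: (mg n).1.
    exact: continuous_measurable_fun.
  by rewrite mulr2n mulrDl mul1r EFinD lteD.
have hM t : cabs (h t) <= 2 * M.
  by rewrite (le_trans (cabs_le_ReIm _))//= mulr2n mulrDl mul1r lerD.
have gh1 : cL1 (fun t => g n t - h t) by split => //; exact: lt_trans I1 (ltry _).
have fg1 : cL1 (fun t => f t - g n t).
  by split; [exact: cmeasB f1.1 (mg n)|exact: lt_trans g1 (ltry _)].
have I2 : (sqnorm (fun t => g n t - h t)%R < ((e / 2) ^+ 2)%:E)%E.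
  apply: (@le_lt_trans _ _ (\int[mu]_t ((3 * M)%:E * (cabs (g n t - h t))%:E))%E).
    apply: ge0_le_integral => //.
    - by move=> t _; rewrite lee_fin sqr_ge0.
    - exact: measurable_sqcabsE.
    - by apply: emeasurable_funM; [exact: measurable_cst|exact: measurable_cabsE].
    - move=> t _; rewrite -EFinM lee_fin expr2 ler_wpM2r ?cabs_ge0//.
      by rewrite (le_trans (cabsB _ _))//; have := gM t; have := hM t; lra.
  rewrite ge0_integralZl//; last 3 first.
  - exact: measurable_cabsE.
  - by move=> t _; rewrite lee_fin cabs_ge0.
  - by rewrite lee_fin mulr_ge0.
  rewrite (L1norm_fine gh1) -EFinM lte_fin; move: I1; rewrite (L1norm_fine gh1) lte_fin => I1.
  have l0 := L1norm_ge0 (fun t => g n t - h t).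
  have dd : d * (8 * (M + 1)) <= (e / 2) ^+ 2.
    by rewrite -ler_pdivlMr ?mulr_gt0 ?ltr_pwDr// ge_min lexx orbT.
  apply: lt_le_trans dd; move: I1 l0 M0 d0; move: (L1norm _) => l; nra.
exists h, (M + 1), (2 * M); split => //.
- by rewrite addr_ge0.
- by split => // t Lt; apply: eq_complexP => /=; [exact: h1L|exact: h2L].
- rewrite -lte_fin -L1norm_fine; last first.
    by have := cL1D fg1 gh1; under eq_fun do rewrite addrA subrK.
  apply: (@le_lt_trans _ _ (\int[mu]_t ((cabs (f t - g n t))%:E + (cabs (g n t - h t))%:E))%E).
    apply: ge0_le_integral => //.
    - by move=> t _; rewrite lee_fin cabs_ge0.
    - by apply: measurable_cabsE; apply: cmeasB f1.1 _; exact: ccont_cmeas.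
    - by apply: emeasurable_funD; apply: measurable_cabsE; [exact: fg1.1|].
    - by move=> t _; rewrite -EFinD lee_fin -{1}(subrK (g n t) (f t)) -addrA cabsD.
  rewrite ge0_integralD//; last 4 first.
  - by move=> t _; rewrite lee_fin cabs_ge0.
  - exact: measurable_cabsE fg1.1.
  - by move=> t _; rewrite lee_fin cabs_ge0.
  - exact: measurable_cabsE.
  rewrite [e]splitr EFinD lteD// (lt_le_trans I1)// lee_fin.
  have : d <= e / 4 by rewrite ge_min lexx.
  by lra.
- have fg2 : cL2 (fun t => f t - g n t) by split; [exact: fg1.1|exact: lt_trans g2 (ltry _)].
  have gh2 : cL2 (fun t => g n t - h t) by split => //; exact: lt_trans I2 (ltry _).
  have -> : (fun t => f t - h t) = (fun t => (f t - g n t) + (g n t - h t)).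
    by apply/funext => t; rewrite addrA subrK.
  have sq k : cL2 k -> (sqnorm k < ((e / 2) ^+ 2)%:E)%E -> norm2 k < e / 2.
    move=> k2; rewrite (sqnorm_fine k2) lte_fin -norm2_sqr => h'.
    by rewrite -(@ltr_pXn2r _ 2)// ?nnegrE ?norm2_ge0// ltW.
  by rewrite (le_lt_trans (norm2D fg2 gh2))// [ltRHS]splitr ltrD// sq.
Unshelve. all: by end_near. Qed.

End Density.

(** * Plancherel and Parseval for integrable, square-integrable functions *)

Section Plancherel.
Context {R : realType}.
Notation mu := (@lebesgue_measure R).
Implicit Types (f g : R -> R[i]).

(** Fatou's lemma, with the bound assumed only for large [n]. *)
Lemma integral_le_limit (u : nat -> R -> R) (v : R -> R) (K : R) :
  (forall n, measurable_fun [set: R] (u n)) -> (forall n x, 0 <= u n x) ->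
  (forall x, (fun n => u n x) @ \oo --> v x) ->
  (\forall n \near \oo, (\int[mu]_x (u n x)%:E <= K%:E)%E) ->
  (\int[mu]_x (v x)%:E <= K%:E)%E.
Proof.
move=> mu_ u0 uv uK.
have E x : (v x)%:E = limn_einf (fun n => (u n x)%:E).
  have h : (fun n => (u n x)%:E) @ \oo --> (v x)%:E.
    by apply: cvg_EFin; [exact: nearW|exact: uv].
  by rewrite is_cvg_limn_einfE; [rewrite (cvg_lim _ h)|apply/cvg_ex; exists (v x)%:E].
under eq_integral do rewrite E.
apply: le_trans (fatou _ measurableT _ _) _.
- by move=> n; apply/measurable_EFinP; exact: mu_.
- by move=> n x _; rewrite lee_fin.
case: uK => N _ NK.
rewrite limn_einf_lim; apply: lime_le; first exact: is_cvg_einfs.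
apply: nearW => n; rewrite /einfs.
apply: (@le_trans _ _ (\int[mu]_x (u (maxn n N) x)%:E)%E).
  by apply: ereal_inf_lbound; exists (maxn n N) => //=; exact: leq_maxl.
by apply: NK => /=; exact: leq_maxr.
Qed.

(** L1 convergence gives uniform convergence of the transforms, and Fatou keeps one inequality; it
    suffices to make the transform contractive on differences. *)
Lemma fourier_sqnorm_le f : cL1 f -> cL2 f -> (sqnorm (fourier f) <= sqnorm f)%E.
Proof.
move=> f1 f2.
have hP n : { h | exists L M : R, [/\ 0 <= L, ccont h, bounded_compact h L M,
    L1norm (fun t => f t - h t) < n.+1%:R^-1 & norm2 (fun t => f t - h t) < n.+1%:R^-1] }.
  by apply: cid; apply: approx_compact.
pose h n := sval (hP n).
have h1 n : cL1 (h n).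
  rewrite /h; case: (hP n) => k /= [L [M [L0 kc kLM _ _]]].
  have k2 : (1 : R) < 2 by rewrite ltr1n.
  by apply: decay_cL1 (bounded_compact_decay L0 kLM) => //; exact: ccont_cmeas.
have h2 n : cL2 (h n).
  rewrite /h; case: (hP n) => k /= [L [M [L0 kc kLM _ _]]].
  have k2 : (1 : R) < 2 by rewrite ltr1n.
  exact: decay_cL2 k2 kc (bounded_compact_decay L0 kLM).
have hE n : sqnorm (fourier (h n)) = sqnorm (h n).
  rewrite /h; case: (hP n) => k /= [L [M [L0 kc kLM _ _]]].
  exact: plancherel_compact L0 kc kLM.
have hd1 n : L1norm (fun t => f t - h n t) < n.+1%:R^-1.
  by rewrite /h; case: (hP n) => k /= [L [M []]].
have hd2 n : norm2 (fun t => f t - h n t) < n.+1%:R^-1.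
  by rewrite /h; case: (hP n) => k /= [L [M []]].
have key (e : R) : 0 < e -> (sqnorm (fourier f) <= ((norm2 f + e) ^+ 2)%:E)%E.
  move=> e0; apply: (@integral_le_limit (fun n w => cabs (fourier (h n) w) ^+ 2)).
  - by move=> n; apply: measurable_funX; apply: measurable_cabs; exact: cmeas_fourier.
  - by move=> n x; exact: sqr_ge0.
  - move=> w; have hw : (fun n => cabs (fourier (h n) w)) @ \oo --> cabs (fourier f w).
      apply/cvgrPdist_lt => z z0; near=> n.
      rewrite (le_lt_trans (cabs_dist_le _ _))// -fourierB//.
      rewrite (le_lt_trans (fourier_le _ (cL1B f1 (h1 n))))// (lt_trans (hd1 n))//.
      by near: n; exact: (near_infty_natSinv_lt (PosNum z0)).
    by under eq_fun do rewrite expr2; rewrite expr2; apply: cvgM.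
  - near=> n.
    rewrite -[X in (X <= _)%E]/(sqnorm (fourier (h n))) hE (sqnorm_fine (h2 n)) -norm2_sqr lee_fin.
    rewrite ler_pXn2r// ?nnegrE ?norm2_ge0 ?addr_ge0 ?norm2_ge0 ?(ltW e0)//.
    have -> : h n = (fun t => f t + - (f t - h n t)).
      by apply/funext => t; rewrite opprB addrC subrK.
    have fh2 := cL2B f2 (h2 n).
    rewrite (le_trans (norm2D f2 (cL2N fh2)))// lerD2l.
    have -> : norm2 (fun x => - (f x - h n x)) = norm2 (fun x => f x - h n x).
      by rewrite !norm2_sqrt sqnormN.
    rewrite ltW// (lt_trans (hd2 n))//.
    by near: n; exact: (near_infty_natSinv_lt (PosNum e0)).
have fin : sqnorm (fourier f) \is a fin_num.
  by rewrite ge0_fin_numE ?sqnorm_ge0// (le_lt_trans (key 1 ltr01))// ltry.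
rewrite (sqnorm_fine f2) -norm2_sqr -(fineK fin) lee_fin.
rewrite -norm2_sqr ler_pXn2r// ?nnegrE ?norm2_ge0//.
apply/ler_addgt0Pr => e e0; have := key e e0.
rewrite -(fineK fin) lee_fin -norm2_sqr ler_pXn2r// nnegrE ?norm2_ge0// addr_ge0 ?norm2_ge0//.
exact: ltW.
Unshelve. all: by end_near. Qed.

Lemma cL2_fourier f : cL1 f -> cL2 f -> cL2 (fourier f).
Proof.
move=> f1 f2; split; first exact: cmeas_fourier.
exact: le_lt_trans (fourier_sqnorm_le f1 f2) f2.2.
Qed.

Lemma norm2_fourier_le f : cL1 f -> cL2 f -> norm2 (fourier f) <= norm2 f.
Proof.
move=> f1 f2; have f3 := cL2_fourier f1 f2.
rewrite -(@ler_pXn2r _ 2)// ?nnegrE ?norm2_ge0// !norm2_sqr.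
by rewrite fine_le ?cL2_fin_num// fourier_sqnorm_le.
Qed.

(** Equality holds for a compactly supported approximant [h], and the contraction applied to [f - h]
    carries it over with an error [e]. *)
Theorem plancherel f : cL1 f -> cL2 f -> norm2 (fourier f) = norm2 f.
Proof.
move=> f1 f2; apply/eqP; rewrite eq_le norm2_fourier_le//=.
apply/ler_addgt0Pr => e e0; have e20 : 0 < e / 2 by rewrite divr_gt0.
have [h [L [M [L0 hc hLM _ hd2]]]] := approx_compact f1 f2 e20.
have k2 : (1 : R) < 2 by rewrite ltr1n.
have h1 : cL1 h.
  by apply: decay_cL1 (bounded_compact_decay L0 hLM) => //; exact: ccont_cmeas.
have h2 : cL2 h by exact: decay_cL2 k2 hc (bounded_compact_decay L0 hLM).
have fh1 := cL1B f1 h1; have fh2 := cL2B f2 h2.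
have nN k : norm2 (fun x => - k x) = norm2 k :> R by rewrite !norm2_sqrt sqnormN.
have l1 : norm2 f <= norm2 h + norm2 (fun t => f t - h t).
  rewrite -{1}(_ : (fun t => h t + (f t - h t)) = f); first exact: norm2D.
  by apply/funext => t; rewrite addrC subrK.
have l2 : norm2 (fourier h) <= norm2 (fourier f) + norm2 (fun t => f t - h t).
  have -> : fourier h = (fun w => fourier f w + - fourier (fun t => f t - h t) w).
    by apply/funext => w; rewrite fourierB// opprB addrC subrK.
  apply: le_trans (norm2D (cL2_fourier f1 f2) (cL2N (cL2_fourier fh1 fh2))) _.
  by rewrite lerD2l nN norm2_fourier_le.
have l3 : norm2 (fourier h) = norm2 h by rewrite !norm2_sqrt (plancherel_compact L0 hc hLM).
lra.
Qed.

Lemma sqnormD_inner f g : cL2 f -> cL2 g ->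
  norm2 (fun x => f x + g x) ^+ 2 = norm2 f ^+ 2 + norm2 g ^+ 2 + 2 * complex.Re (inner f g).
Proof.
move=> f2 g2; have fg2 := cL2D f2 g2.
have := inner_self fg2; rewrite innerDl// (innerC fg2 f2) (innerC fg2 g2) !innerDl//.
rewrite -/(norm2 _) => /(congr1 (@complex.Re R)); rewrite cReD !cReJ !cReD.
rewrite (innerC f2 g2) cReJ !inner_self//= !norm2_sqr => <-; ring.
Qed.

(** Polarization: norms of sums determine the real part, and replacing [f] by ['i * f] gives the
    imaginary part. *)
Theorem parseval f g : cL1 f -> cL2 f -> cL1 g -> cL2 g ->
  inner (fourier f) (fourier g) = inner f g.
Proof.
have ReE k l : cL1 k -> cL2 k -> cL1 l -> cL2 l ->
    complex.Re (inner (fourier k) (fourier l)) = complex.Re (inner k l) :> R.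
  move=> k1 k2 l1 l2.
  have := sqnormD_inner (cL2_fourier k1 k2) (cL2_fourier l1 l2).
  have -> : (fun x => fourier k x + fourier l x) = fourier (fun t => k t + l t).
    by apply/funext => w; rewrite fourierD.
  rewrite !plancherel//; [|exact: cL1D|exact: cL2D].
  by rewrite sqnormD_inner//; lra.
move=> f1 f2 g1 g2; apply: eq_complexP; first exact: ReE.
have ImE k l : cL2 k -> cL2 l -> complex.Re (inner (fun x => 'i%C * k x) l) = - complex.Im (inner k l) :> R.
  by move=> k2 l2; rewrite innerZl// cReM /=; ring.
have := ReE _ _ (cL1Z 'i%C f1) (cL2Z 'i%C f2) g1 g2.
have -> : fourier (fun x => 'i%C * f x) = (fun w => 'i%C * fourier f w).
  by apply/funext => w; rewrite fourierZ.
rewrite !ImE//; [|exact: cL2_fourier..].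
by move/oppr_inj.
Qed.

End Plancherel.

(** * The alpha-covering and the frame bounds on L1 and L2 *)

Section Covering.
Context {R : realType}.
Context (alpha : R).
Hypothesis alpha0 : 0 <= alpha.

Lemma s_idx_gt0 n : (0 < s_idx alpha n)%N.
Proof. by elim: n => //= n ih; rewrite ltn_addr. Qed.

Lemma s_idx_le m n : (m <= n)%N -> (s_idx alpha m <= s_idx alpha n)%N.
Proof.
elim: n => [|n ih]; first by rewrite leqn0 => /eqP ->.
by rewrite leq_eqVlt => /predU1P[->//|/ih h]; rewrite (leq_trans h)//= leq_addr.
Qed.

Lemma beta_size p : (s_idx alpha `|p|%N - i_idx alpha `|p|%N)%N = beta alpha p.
Proof. by rewrite /beta; case: `|p|%N => //= n; rewrite addnC addnK. Qed.

Lemma beta_gt0 p : (0 < beta alpha p)%N.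
Proof.
rewrite /beta; case: `|p|%N => //= n; rewrite truncn_gt0.
have h : 1 <= (s_idx alpha n)%:R :> R by rewrite ler1n s_idx_gt0.
by rewrite -[leLHS](powRr0 (s_idx alpha n)%:R); exact: ler_powR.
Qed.

Lemma size_I_seq p : size (I_seq alpha p) = beta alpha p.
Proof. by rewrite size_map size_iota beta_size. Qed.

Lemma mem_I_seq p (m : int) : m \in I_seq alpha p ->
  [/\ (i_idx alpha `|p|%N <= `|m|%N)%N, (`|m|%N < s_idx alpha `|p|%N)%N &
      m = if 0 <= p then `|m|%N%:Z else - `|m|%N%:Z].
Proof.
move=> /mapP[k]; rewrite mem_index_iota => /andP[ik ks] ->.
by case: ifP => _; rewrite ?abszN absz_nat.
Qed.

Lemma I_seq_dist p (m m' : int) : m \in I_seq alpha p -> m' \in I_seq alpha p ->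
  `|(m' - m)%:~R| <= (beta alpha p)%:R :> R.
Proof.
move=> /mem_I_seq[h1 h2 h3] /mem_I_seq[h4 h5 h6].
rewrite -intr_norm -[X in _ <= X]/((beta alpha p)%:Z%:~R) ler_int -beta_size.
by move: h3 h6; case: ifP => _; lia.
Qed.

Lemma I_seq_uniq p : uniq (I_seq alpha p).
Proof.
rewrite map_inj_uniq ?iota_uniq// => m n.
by case: ifP => _; [case|move=> /oppr_inj[]].
Qed.

(** Blocks with different [|p|] are separated by monotonicity of the endpoints; for [|p| >= 1] a
    block avoids 0, so its sign determines that of [p]. *)
Lemma I_seq_disjoint p q (m : int) : m \in I_seq alpha p -> m \in I_seq alpha q -> p = q.
Proof.
move=> /mem_I_seq[h1 h2 h3] /mem_I_seq[h4 h5 h6].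
have lt k l : (k < l)%N -> (s_idx alpha k <= i_idx alpha l)%N.
  by case: l => //= l; rewrite ltnS; exact: s_idx_le.
have E : `|p|%N = `|q|%N.
  case: (ltngtP `|p|%N `|q|%N) => // /lt h.
    by have := leq_trans h2 (leq_trans h h4); rewrite ltnn.
  by have := leq_trans h5 (leq_trans h h1); rewrite ltnn.
have [p0|p0] := eqVneq `|p|%N 0%N.
  by move: (p0); rewrite E => /eqP; rewrite absz_eq0 => /eqP ->; apply/eqP; rewrite -absz_eq0 p0.
have i1 : (0 < i_idx alpha `|p|%N)%N by case: `|p|%N p0 => //= n _; exact: s_idx_gt0.
have m0 : (0 < `|m|%N)%N by exact: leq_trans i1 h1.
by move: h3 h6; case: ifP => pp; case: ifP => qq; lia.
Qed.

(** Disjointness makes [(p, m) |-> m] injective on the blocks, so the double sum is a subsum of the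
    right-hand side. *)
Lemma esum_I_seq_le (a : int -> \bar R) : (forall m, 0 <= a m)%E ->
  (\esum_(p in [set: int]) (\sum_(m <- I_seq alpha p) a m)%E <= \esum_(m in [set: int]) a m)%E.
Proof.
move=> a0; have E p : (\sum_(m <- I_seq alpha p) a m)%E = \esum_(m in [set` I_seq alpha p]) a m.
  rewrite esum_fset//; last exact: finite_seq.
  by rewrite fsbig_seq// I_seq_uniq.
under eq_esum do rewrite E.
rewrite esum_esum//.
pose P : set (int * int) := [set: int] `*`` (fun p => [set` I_seq alpha p]).
rewrite -(@esum_image _ _ _ P (fun k => k.2) a); first exact: esum_subset.
move=> [p m] [q n]; rewrite !inE /= => -[_ mp] [_ nq] /= mn.
by move: mp nq => /=; rewrite mn => mp /(I_seq_disjoint mp) ->.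
Qed.

End Covering.

(** * The aliasing error as a weighted energy *)

Section AliasingBound.
Context {R : realType}.
Notation mu := (@lebesgue_measure R).
Context (c : R) (u v : R -> R[i]).
Hypothesis mu_ : cmeas u.
Hypothesis mv : cmeas v.

Let F w := u w * (v w)^*.

Let absF w : cabs (F w) = cabs (u w) * cabs (v w).
Proof. by rewrite cabsM cabs_conj. Qed.

(* AM-GM on [|u(x)||u(x + j/c)|]; the two resulting sums agree after translating by [j/c]. *)
Lemma aliasing_error_le : (aliasing_error c F <= \int[mu]_x
  ((cabs (u x) ^+ 2)%:E * ((cabs (v x))%:E * alias_sum c v x)))%E.
Proof.
pose A := [set j : int | j != 0].
pose b (j : int) : R := j%:~R * c^-1.
pose t (j : int) x := (cabs (u x) ^+ 2 / 2 * (cabs (v x) * cabs (v (x + b j))))%:E.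
pose t' (j : int) x := (cabs (u (x + b j)) ^+ 2 / 2 * (cabs (v x) * cabs (v (x + b j))))%:E.
have msh (h : R -> R) (a : R) : measurable_fun [set: R] h -> measurable_fun [set: R] (fun x => h (x + a)).
  by move=> mh; exact: (measurableT_comp mh (measurable_shiftr a)).
have mau := measurable_cabs mu_; have mav := measurable_cabs mv.
have mt j : measurable_fun [set: R] (t j).
  apply/measurable_EFinP; apply: measurable_funM.
    by apply: measurable_funM; [exact: measurable_funX|exact: measurable_cst].
  by apply: measurable_funM => //; exact: (msh (fun x => cabs (v x))).
have mt' j : measurable_fun [set: R] (t' j).
  apply/measurable_EFinP; apply: measurable_funM.
    by apply: measurable_funM; [apply: measurable_funX; exact: (msh (fun x => cabs (u x)))|exact: measurable_cst].
  by apply: measurable_funM => //; exact: (msh (fun x => cabs (v x))).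
have t0 j x : (0 <= t j x)%E by rewrite lee_fin !mulr_ge0 ?sqr_ge0 ?cabs_ge0.
have t'0 j x : (0 <= t' j x)%E by rewrite lee_fin !mulr_ge0 ?sqr_ge0 ?cabs_ge0.
have iD (f g : R -> \bar R) : (forall x, 0 <= f x)%E -> (forall x, 0 <= g x)%E ->
    measurable_fun [set: R] f -> measurable_fun [set: R] g ->
    (\int[mu]_x (f x + g x) = \int[mu]_x f x + \int[mu]_x g x)%E.
  by move=> f0 g0 mf mg; rewrite ge0_integralD.
have tt' j : (\int[mu]_x t' j x = \int[mu]_x t (- j)%R x)%E.
  rewrite -(ge0_integral_shiftrT (b j) (mt (- j)) (t0 (- j))).
  apply: eq_integral => x _; rewrite /t /t' /b rmorphN/= mulNr addrK.
  by rewrite [cabs (v x) * _]mulrC.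
apply: (@le_trans _ _ (\esum_(j in A) (\int[mu]_x (t j x + t' j x))%E)).
  have -> : aliasing_error c F = \esum_(j in A) (\int[mu]_x (cabs (F x) * cabs (F (x + b j)))%:E)%E.
    rewrite -ge0_integral_esum//.
    - apply: eq_integral => x _; rewrite /alias_sum -esumZ ?cabs_ge0//.
      by move=> j; rewrite lee_fin cabs_ge0.
    - move=> j; apply/measurable_EFinP.
      have mF : measurable_fun [set: R] (fun x => cabs (F x)).
        by under eq_fun do rewrite absF; exact: measurable_funM.
      by apply: measurable_funM => //; exact: (msh (fun x => cabs (F x))).
    - by move=> j x; rewrite lee_fin mulr_ge0 ?cabs_ge0.
  apply: le_esum => j _; apply: ge0_le_integral => //.
  - by move=> x _; rewrite lee_fin mulr_ge0 ?cabs_ge0.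
  - apply/measurable_EFinP.
    have mF : measurable_fun [set: R] (fun x => cabs (F x)).
      by under eq_fun do rewrite absF; exact: measurable_funM.
    by apply: measurable_funM => //; exact: (msh (fun x => cabs (F x))).
  - by apply: emeasurable_funD; [exact: mt|exact: mt'].
  - move=> x _; rewrite -EFinD lee_fin !absF.
    set a := cabs (u x); set a' := cabs (u _); set d := cabs (v x); set d' := cabs (v _).
    have dd : 0 <= d * d' by rewrite mulr_ge0 ?cabs_ge0.
    by have := sqr_ge0 (a - a'); nra.
under eq_esum => j _ do rewrite (iD (t j) (t' j) (t0 j) (t'0 j) (mt j) (mt' j)) tt'.
rewrite esumD; [|by move=> j _; exact: integral_ge0..].
(* The set of nonzero integers is symmetric, so the translated half, indexed by [-j], equals the
   other one. *)
rewrite (esum_int_opp (A := A) (fun j => \int[mu]_x t j x)%E); last first.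
  by move=> j; rewrite /A/= oppr_eq0.
rewrite -esumD; [|by move=> j _; exact: integral_ge0..].
under eq_esum => j _ do rewrite -(iD (t j) (t j) (t0 j) (t0 j) (mt j) (mt j)).
rewrite -ge0_integral_esum//; last 2 first.
- by move=> j; apply: emeasurable_funD; exact: mt.
- by move=> j x; rewrite adde_ge0.
rewrite le_eqVlt; apply/orP; left; apply/eqP; apply: eq_integral => x _.
rewrite muleA -EFinM /alias_sum -esumZ.
- apply: eq_esum => j _; rewrite /t -EFinD -EFinM; congr EFin; rewrite /b; by field.
- by rewrite mulr_ge0 ?sqr_ge0 ?cabs_ge0.
- by move=> j; rewrite lee_fin cabs_ge0.
Qed.

End AliasingBound.

(** * Uniform smallness of the aliasing weight *)

Section OffDiagonal.
Context {R : realType}.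
Notation decay := (@decay R).

(** One factor [decay s x] is set aside; the rest is bounded through
    [1 + |y - x| <= (1 + |x|) (1 + |y|)]. *)
Lemma decay_pair (s x y : R) : 0 <= s ->
  decay (s + s) x * decay (s + s) y <= decay s x * decay s (y - x).
Proof.
move=> s0; have E t : decay (s + s) t = decay s t * decay s t.
  by rewrite /decay opprD powRD//; apply/implyP => _; rewrite gt_eqF// ltr_pwDl.
rewrite E -mulrA ler_wpM2l ?decay_ge0//.
apply: (@le_trans _ _ (decay s x * decay s y)).
  rewrite ler_wpM2l ?decay_ge0// decay_lerD// lerDl//.
have p t : 0 < 1 + `|t| by rewrite ltr_pwDl.
rewrite /decay -powRM ?(ltW (p _))// powRN_le// ?ltr_pwDl//.
by have := ler_normB y x; have := mulr_ge0 (normr_ge0 x) (normr_ge0 y); lra.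
Qed.

Context (alpha mu C N : R) (phi : R -> R[i]).
Hypothesis alpha0 : 0 <= alpha.
Hypothesis mu_gt0 : 0 < mu.
Hypothesis N2 : 2 < N.
Hypothesis phiC : forall w, cabs (fourier phi w) <= C * decay N w.

Let s := N / 2.
Let s1 : 1 < s. Proof. by rewrite ltr_pdivlMr ?mul1r. Qed.

Let s0 : 0 <= s. Proof. exact: ltW (lt_trans ltr01 s1). Qed.

Let C0 : 0 <= C.
Proof.
have h := phiC 0; have := le_trans (cabs_ge0 _) h.
by rewrite /decay normr0 addr0 powR1 mulr1.
Qed.

Lemma decay_lattice_le (b nu x : R) (j : int) : 1 <= b -> 0 < nu -> nu * mu <= 1 / 2 ->
  j != 0 -> `|x| <= mu * b -> decay s (j%:~R * (b / nu) + x) <= (4 * nu) `^ s * b^-1 * decay s j%:~R.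
Proof.
move=> b1 nu0 numu j0 xb.
have j1 := @normr_int_ge1 R j j0.
have b0 : 0 < b by lra.
have h : (1 + `|j%:~R|) * b / (4 * nu) <= 1 + `|j%:~R * (b / nu) + x| :> R.
  have h1 : `|j%:~R : R| * (b / nu) <= `|j%:~R * (b / nu) + x| + `|x|.
    rewrite -[X in _ * X]gtr0_norm ?divr_gt0// -normrM.
    by rewrite -{1}[j%:~R * (b / nu)](addrK x) ler_normB.
  have h2 : mu * b <= b / nu / 2.
    rewrite -subr_ge0 (_ : _ - _ = b / nu * (1 / 2 - nu * mu)); last by field; rewrite gt_eqF.
    by rewrite mulr_ge0 ?subr_ge0// ltW// divr_gt0.
  have h3 : 0 < b / nu by rewrite divr_gt0.
  rewrite (_ : _ / (4 * nu) = (1 + `|j%:~R|) * (b / nu) / 4); last by field; rewrite gt_eqF.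
  nra.
have p0 : 0 < (1 + `|j%:~R : R|) by rewrite ltr_pwDl.
rewrite /decay; apply: le_trans (powRN_le _ _ h) _; [exact: s0|by rewrite !mulr_gt0 ?invr_gt0 ?mulr_gt0 ?ltr_pwDl|].
have n0 : 0 < 4 * nu by rewrite mulr_gt0.
have -> : ((1 + `|j%:~R|) * b / (4 * nu)) `^ (- s) =
    (4 * nu) `^ s * b `^ (- s) * (1 + `|j%:~R|) `^ (- s).
  have n1 : 0 <= (4 * nu)^-1 by rewrite invr_ge0 ltW.
  rewrite (powRM _ (mulr_ge0 (ltW p0) (ltW b0)) n1) (powRM _ (ltW p0) (ltW b0)).
  rewrite -(powR_inv1 (ltW n0)) -powRrM mulrNN mul1r; ring.
rewrite ler_wpM2r ?powR_ge0// ler_wpM2l ?powR_ge0//.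
by rewrite -(powR_inv1 (ltW b0)) ler_powR// lerN2 ltW.
Qed.

(** For each [m], the estimate is the same for all [m'] in the block; their number [beta p] cancels
    the factor [b^-1]. *)
Lemma Phi_alias_le (nu w : R) (p j : int) : 0 < nu -> nu * mu <= 1 / 2 -> j != 0 ->
  cabs (Phi alpha mu phi p w) *
    cabs (Phi alpha mu phi p (w + j%:~R * (nu / (beta alpha p)%:R)^-1)) <=
  C ^+ 2 * (4 * nu) `^ s * decay s j%:~R * \sum_(m <- I_seq alpha p) decay s (w - mu * m%:~R).
Proof.
move=> nu0 numu j0; set b : R := (beta alpha p)%:R.
have b1 : 1 <= b by rewrite ler1n beta_gt0.
have b0 : 0 < b by lra.
have NE : N = s + s by rewrite /s; field.
have bP t : cabs (Phi alpha mu phi p t) <= \sum_(m <- I_seq alpha p) C * decay N (t - mu * m%:~R).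
  by apply: le_trans (cabs_sum _ _ _) _; apply: ler_sum.
apply: le_trans (ler_pM (cabs_ge0 _) (cabs_ge0 _) (bP _) (bP _)) _.
rewrite mulr_suml mulr_sumr big_seq [leRHS]big_seq; apply: ler_sum => m mI.
rewrite mulr_sumr.
apply: (@le_trans _ _ (\sum_(m' <- I_seq alpha p)
   (C ^+ 2 * decay s (w - mu * m%:~R) * ((4 * nu) `^ s * b^-1 * decay s j%:~R)))).
  rewrite big_seq [leRHS]big_seq; apply: ler_sum => m' m'I.
  rewrite mulrACA -expr2 -mulrA ler_wpM2l ?sqr_ge0// NE.
  apply: le_trans (decay_pair _ _ s0) _.
  rewrite ler_wpM2l ?decay_ge0//.
  (* The separation of the two arguments is the alias shift, perturbed by a frequency difference
     within one block. *)
  rewrite (_ : _ - _ = j%:~R * (b / nu) + - (mu * (m' - m)%:~R)); last first.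
    by rewrite rmorphB/=; field; rewrite !gt_eqF.
  apply: decay_lattice_le => //.
  by rewrite normrN normrM (gtr0_norm mu_gt0) ler_wpM2l ?(ltW mu_gt0)// (I_seq_dist _ mI).
rewrite big_const_seq count_predT size_I_seq iter_addr_0 -mulr_natl -/b.
by rewrite le_eqVlt; apply/orP; left; apply/eqP; field; rewrite gt_eqF.
Qed.

(** Summation over [j] costs [D1]; summation over [p] costs [D2], because the blocks together form
    part of a single lattice of step [mu]. *)
Lemma off_diagonal_le (e : R) : 0 < e -> exists2 nu0 : R, 0 < nu0 & forall nu w : R, 0 < nu < nu0 ->
  (\esum_(p in [set: int]) ((cabs (Phi alpha mu phi p w))%:E *
     alias_sum (nu / (beta alpha p)%:R) (Phi alpha mu phi p) w) <= e%:E)%E.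
Proof.
move=> e0.
have [D1 D10 D1P] := lattice_sum_decay ltr01 s1.
have [D2 D20 D2P] := lattice_sum_decay mu_gt0 s1.
pose K := C ^+ 2 * D1 * D2 * 4 + 1.
have K0 : 0 < K by rewrite ltr_wpDl// !mulr_ge0 ?sqr_ge0// ltW.
exists (Num.min (Num.min 4^-1 (2 * mu)^-1) (e / K)).
  by rewrite !lt_min !invr_gt0 mulr_gt0// divr_gt0//= andbT ltr0n.
move=> nu w /andP[nu0]; rewrite !lt_min => /andP[/andP[nu4 numu] nue].
have numu2 : nu * mu <= 1 / 2.
  have h : nu * (2 * mu) < 1 by rewrite -ltr_pdivlMr ?mulr_gt0// div1r.
  by lra.
have nup : (4 * nu) `^ s <= 4 * nu.
  have h4 : 4 * nu <= 1 by lra.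
  have n0 : 0 < 4 * nu by rewrite mulr_gt0.
  by rewrite -[leRHS](powRr1 (ltW n0)) ger_powR ?n0// ltW.
pose L := C ^+ 2 * (4 * nu) `^ s.
have L0 : 0 <= L by rewrite mulr_ge0 ?sqr_ge0 ?powR_ge0.
have step p : ((cabs (Phi alpha mu phi p w))%:E *
     alias_sum (nu / (beta alpha p)%:R) (Phi alpha mu phi p) w <=
   (L * D1)%:E * \sum_(m <- I_seq alpha p) (decay s (w - mu * m%:~R))%:E)%E.
  rewrite /alias_sum -esumZ ?cabs_ge0//; last by move=> j; rewrite lee_fin cabs_ge0.
  rewrite sumEFin -EFinM mulrAC EFinM.
  set S := \sum_(_ <- _) _.
  have S0 : 0 <= S by rewrite sumr_ge0// => m _; exact: decay_ge0.
  have LS0 := mulr_ge0 L0 S0.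
  apply: (@le_trans _ _ (\esum_(j in [set: int]) ((L * S)%:E * (decay s (0 + j%:~R * 1))%:E)%E)).
    apply: (@le_trans _ _ (\esum_(j in [set j : int | j != 0]) ((L * S)%:E * (decay s (0 + j%:~R * 1))%:E)%E)).
      apply: le_esum => j /= j0; rewrite -!EFinM lee_fin add0r mulr1.
      by apply: le_trans (Phi_alias_le _ _ _ _ _) _ => //; rewrite /L -/S; lra.
    apply: esum_subset => //.
    by move=> j; rewrite mule_ge0// lee_fin ?decay_ge0.
  rewrite (esumZ _ LS0); last by move=> j; rewrite lee_fin decay_ge0.
  by apply: lee_wpmul2l; rewrite ?lee_fin.
apply: (@le_trans _ _ (\esum_(p in [set: int]) ((L * D1)%:E * \sum_(m <- I_seq alpha p) (decay s (w - mu * m%:~R))%:E)%E)).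
  by apply: le_esum.
have LD0 : 0 <= L * D1 by rewrite mulr_ge0// ltW.
rewrite esumZ//; last by move=> p; apply: sume_ge0 => m _; rewrite lee_fin decay_ge0.
have h : (\esum_(p in [set: int]) (\sum_(m <- I_seq alpha p) (decay s (w - mu * m%:~R))%:E)%E <= D2%:E)%E.
  apply: le_trans (esum_I_seq_le alpha0 _) _; first by move=> m; rewrite lee_fin decay_ge0.
  apply: le_trans (D2P w).
  rewrite -(esum_int_opp (A := [set: int]) (fun j => (decay s (w + j%:~R * mu))%:E))//.
  by apply: le_esum => m _; rewrite rmorphN/= mulNr mulrC.
apply: le_trans (lee_wpmul2l _ h) _; first by rewrite lee_fin.
rewrite -EFinM lee_fin.
have nuK : nu * K < e by rewrite -ltr_pdivlMr.
apply: le_trans (ltW nuK); rewrite /L /K.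
have q : 0 <= C ^+ 2 * D1 * D2 by rewrite !mulr_ge0 ?sqr_ge0// ltW.
by have := ler_wpM2l q nup; lra.
Qed.

End OffDiagonal.

(** * Frame inequalities for integrable, square-integrable functions *)

Section FrameL1L2.
Context {R : realType}.
Notation mu := (@lebesgue_measure R).
Context (alpha mu0 C N : R) (phi : R -> R[i]).
Hypothesis alpha0 : 0 <= alpha.
Hypothesis phi1 : cL1 phi.
Hypothesis phi2 : cL2 phi.
Hypothesis N2 : 2 < N.
Hypothesis phiC : forall w, cabs (fourier phi w) <= C * decay N w.

Notation Phi := (Phi alpha mu0 phi).

(** The atom before translation and normalization; its transform is [Phi p]. *)
Let packet p u : R[i] := \sum_(m <- I_seq alpha p) cexpi (2 * pi * (mu0 * m%:~R) * u) * phi u.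

Let cmeas_mod (x : R) : cmeas (fun u => cexpi (2 * pi * x * u)).
Proof. by apply: cmeas_cexpi; exact: measurable_mull. Qed.

Let packet1 p : cL1 (packet p).
Proof.
by apply: cL1_sum => m; apply: (@cL1_bM _ _ _ 1) => // x; rewrite cabs_cexpi.
Qed.

Let packet2 p : cL2 (packet p).
Proof. by apply: cL2_sum => m; apply: cL2_bM => // x; rewrite cabs_cexpi. Qed.

Lemma cL2_atom nu p k : cL2 (atom alpha mu0 nu phi p k).
Proof. exact: cL2Z (cL2_shiftr _ (packet2 p)). Qed.

Let fourier_packet p : fourier (packet p) = Phi p.
Proof.
apply/funext => w; rewrite fourier_sum; last first.
  by move=> m; apply: (@cL1_bM _ _ _ 1) => // x; rewrite cabs_cexpi.
by apply: eq_bigr => m _; rewrite fourier_modulation.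
Qed.

Let ccont_Phi p : ccont (Phi p).
Proof. by rewrite -fourier_packet; exact: ccont_fourier. Qed.

Let C0 : 0 <= C.
Proof.
have h := phiC 0; have := le_trans (cabs_ge0 _) h.
by rewrite /decay normr0 addr0 powR1 mulr1.
Qed.

(** The constant may depend on [p]: it only qualifies each product [F p] for the sampling
    inequalities, while uniformity is supplied by the hypothesis [off]. *)
Let Phi_decay p : exists2 K, 0 <= K & forall w, cabs (Phi p w) <= K * decay N w.
Proof.
exists (\sum_(m <- I_seq alpha p) C * (1 + `|- (mu0 * m%:~R)|) `^ N).
  by rewrite sumr_ge0// => m _; rewrite mulr_ge0// powR_ge0.
move=> w; apply: le_trans (cabs_sum _ _ _) _; rewrite mulr_suml; apply: ler_sum => m _.
by rewrite (le_trans (phiC _))// -mulrA ler_wpM2l// decayD// ltW// (lt_trans _ N2).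
Qed.

Section OneFunction.
Context (f : R -> R[i]) (nu : R).
Hypothesis f1 : cL1 f.
Hypothesis f2 : cL2 f.
Hypothesis nu0 : 0 < nu.

Let F p w := fourier f w * (Phi p w)^*.
Let c p := nu / (beta alpha p)%:R.

Let b0 p : 0 < (beta alpha p)%:R :> R.
Proof. by rewrite ltr0n beta_gt0. Qed.

Let c0 p : 0 < c p.
Proof. by rewrite divr_gt0. Qed.

Let ccont_F p : ccont (F p).
Proof. by apply: ccontM; [exact: ccont_fourier|exact: ccontJ]. Qed.

Let N1 : 1 < N.
Proof. by rewrite (lt_trans _ N2)// ltr1n. Qed.

Let F_decay p : exists K, forall w, cabs (F p w) <= K * decay N w.
Proof.
have [K K0 KP] := Phi_decay p; exists (L1norm f * K) => w.
by rewrite cabsM cabs_conj -mulrA ler_pM ?cabs_ge0// fourier_le.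
Qed.

(** Parseval turns the translation by [k c] into a character; the sign of [-k] disappears when
    summing over all integers. *)
Let inner_atom p k : inner f (atom alpha mu0 nu phi p k) =
  ((Num.sqrt (beta alpha p)%:R)^-1)%:C * fourier (F p) ((- k)%:~R * c p).
Proof.
have t1 : cL1 (fun t => packet p (t - k%:~R * c p)) by exact: cL1_shiftr.
have t2 : cL2 (fun t => packet p (t - k%:~R * c p)) by exact: cL2_shiftr.
rewrite (innerC (cL2_atom nu p k) f2) (innerZl _ t2 f2) -[LHS]/(conjc (_ * _)) (rmorphM (@conjc R)).
congr (_ * _); first by rewrite /= oppr0.
apply: (eq_trans (esym (innerC t2 f2))).
have E : fourier (fun t => packet p (t - k%:~R * c p)) =
    (fun w => cexpi (- (2 * pi * (k%:~R * c p) * w)) * Phi p w).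
  by apply/funext => w; rewrite fourier_translation// fourier_packet.
rewrite -parseval// E.
rewrite /inner [RHS]/fourier; congr cintegral; apply/funext => w.
transitivity (fourier f w *
  (conjc (cexpi (- (2 * pi * (k%:~R * c p) * w))) * conjc (Phi p w))).
  by congr (_ * _); exact: (rmorphM (@conjc R)).
rewrite cexpiJ opprK mulrCA /F; congr (cexpi _ * _).
by rewrite rmorphN/=; ring.
Qed.

(** The squared normalization [1 / beta p] turns [nu] into the step [c p] of the sampling
    inequality, so one factor [nu] serves all [p]. *)
Let energy_scale p :
  (nu%:E * \esum_(k in [set: int]) ((cabs (inner f (atom alpha mu0 nu phi p k))) ^+ 2)%:E)%E =
  ((c p)%:E * sample_energy (c p) (F p))%E.
Proof.
have -> : \esum_(k in [set: int]) ((cabs (inner f (atom alpha mu0 nu phi p k))) ^+ 2)%:E =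
    (((beta alpha p)%:R^-1)%:E * sample_energy (c p) (F p))%E.
  rewrite /sample_energy -esumZ ?invr_ge0 ?ltW//; last by move=> j; rewrite lee_fin sqr_ge0.
  rewrite -[RHS](esum_int_opp (A := [set: int]) (fun j =>
    ((beta alpha p)%:R^-1)%:E * (cabs (fourier (F p) (j%:~R * c p)%R) ^+ 2)%:E)%E)//.
  apply: eq_esum => k _; rewrite inner_atom cabsM exprMn EFinM; congr (_%:E * _)%E.
  by rewrite cabs_real real_normK ?num_real// exprVn sqr_sqrtr// ltW.
by rewrite muleA -EFinM.
Qed.

Context (a b e : R).
Hypothesis a0 : 0 <= a.
Hypothesis b_ge0 : 0 <= b.
Hypothesis e0 : 0 <= e.
Hypothesis PhiP : forall w : R,
  (a%:E <= \esum_(p in [set: int]) ((cabs (Phi p w)) ^+ 2)%:E <= b%:E)%E.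
Hypothesis off : forall w, (\esum_(p in [set: int]) ((cabs (Phi p w))%:E *
  alias_sum (c p) (Phi p) w) <= e%:E)%E.

Let mf : cmeas (fourier f). Proof. exact: cmeas_fourier. Qed.

Let mPhi p : cmeas (Phi p). Proof. exact: ccont_cmeas. Qed.

Let energyE : sqnorm (fourier f) = sqnorm f.
Proof.
by rewrite (sqnorm_fine f2) (sqnorm_fine (cL2_fourier f1 f2)) -!norm2_sqr plancherel.
Qed.

Let weighted_le (r : R) (W : R -> \bar R) : 0 <= r -> measurable_fun [set: R] W ->
  (forall w, 0 <= W w)%E -> (forall w, W w <= r%:E)%E ->
  (\int[mu]_w ((cabs (fourier f w) ^+ 2)%:E * W w) <= r%:E * sqnorm f)%E.
Proof.
move=> r0 mW W0 Wr; rewrite -energyE /sqnorm -ge0_integralZl//; last 2 first.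
- exact: measurable_sqcabsE.
- by move=> x _; rewrite lee_fin sqr_ge0.
apply: ge0_le_integral => //.
- by move=> x _; rewrite mule_ge0// lee_fin sqr_ge0.
- by apply: emeasurable_funM => //; exact: measurable_sqcabsE.
- by apply: emeasurable_funM => //; exact: measurable_sqcabsE.
- by move=> x _; rewrite muleC lee_wpmul2r// lee_fin sqr_ge0.
Qed.

Let weighted_ge (r : R) (W : R -> \bar R) : 0 <= r -> measurable_fun [set: R] W ->
  (forall w, 0 <= W w)%E -> (forall w, r%:E <= W w)%E ->
  (r%:E * sqnorm f <= \int[mu]_w ((cabs (fourier f w) ^+ 2)%:E * W w))%E.
Proof.
move=> r0 mW W0 Wr; rewrite -energyE /sqnorm -ge0_integralZl//; last 2 first.
- exact: measurable_sqcabsE.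
- by move=> x _; rewrite lee_fin sqr_ge0.
apply: ge0_le_integral => //.
- by move=> x _; rewrite mule_ge0// lee_fin sqr_ge0.
- by apply: emeasurable_funM => //; exact: measurable_sqcabsE.
- by apply: emeasurable_funM => //; exact: measurable_sqcabsE.
- by move=> x _; rewrite muleC lee_wpmul2l// lee_fin sqr_ge0.
Qed.

Let D w := \esum_(p in [set: int]) ((cabs (Phi p w)) ^+ 2)%:E.

Let D0 w : (0 <= D w)%E.
Proof. by apply: esum_ge0 => p _; rewrite lee_fin sqr_ge0. Qed.

Let mD : measurable_fun [set: R] D.
Proof.
by apply: measurable_esum => // p; [exact: measurable_sqcabsE|move=> x; rewrite lee_fin sqr_ge0].
Qed.

Let sum_sqnorm : \esum_(p in [set: int]) sqnorm (F p) =
  (\int[mu]_w ((cabs (fourier f w) ^+ 2)%:E * D w))%E.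
Proof.
rewrite /sqnorm -ge0_integral_esum//.
- apply: eq_integral => w _; rewrite /D -esumZ ?sqr_ge0//.
    by apply: eq_esum => p _; rewrite /F cabsM cabs_conj exprMn EFinM.
  by move=> p; rewrite lee_fin sqr_ge0.
- by move=> p; apply: measurable_sqcabsE; exact: ccont_cmeas.
- by move=> p x; rewrite lee_fin sqr_ge0.
Qed.

Let alias_term p w : \bar R := ((cabs (Phi p w))%:E * alias_sum (c p) (Phi p) w)%E.

Let alias_term0 p w : (0 <= alias_term p w)%E.
Proof. by rewrite mule_ge0 ?lee_fin ?cabs_ge0// alias_sum_ge0. Qed.

Let malias_term p : measurable_fun [set: R] (alias_term p).
Proof.
by apply: emeasurable_funM; [exact: measurable_cabsE|exact: measurable_alias_sum].
Qed.

(** The sum over [p] is taken under the integral, where the pointwise bound [off] applies, before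
    Plancherel is used. *)
Let sum_aliasing : (\esum_(p in [set: int]) aliasing_error (c p) (F p) <= e%:E * sqnorm f)%E.
Proof.
apply: (@le_trans _ _ (\esum_(p in [set: int])
   (\int[mu]_w ((cabs (fourier f w) ^+ 2)%:E * alias_term p w))%E)).
  by apply: le_esum => p _; exact: aliasing_error_le.
rewrite -ge0_integral_esum//; last 2 first.
- by move=> p; apply: emeasurable_funM; [exact: measurable_sqcabsE|exact: malias_term].
- by move=> p x; rewrite mule_ge0// lee_fin sqr_ge0.
pose W w := \esum_(p in [set: int]) alias_term p w.
have WE : (fun w => \esum_(p in [set: int]) ((cabs (fourier f w) ^+ 2)%:E * alias_term p w)%E) =
    (fun w => ((cabs (fourier f w) ^+ 2)%:E * W w)%E).
  by apply/funext => w; rewrite /W esumZ ?sqr_ge0.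
rewrite WE; apply: weighted_le => //; first exact: measurable_esum.
by move=> w; apply: esum_ge0.
Qed.

Let aliasing_ge0 p : (0 <= aliasing_error (c p) (F p))%E.
Proof.
by apply: integral_ge0 => x _; rewrite mule_ge0 ?lee_fin ?cabs_ge0// alias_sum_ge0.
Qed.

Let X := \esum_(i in [set: int * int])
  ((cabs (inner f (atom alpha mu0 nu phi i.1 i.2))) ^+ 2)%:E.

Let energy_sum : (nu%:E * X)%E =
  \esum_(p in [set: int]) ((c p)%:E * sample_energy (c p) (F p))%E.
Proof.
have -> : X = \esum_(p in [set: int]) \esum_(k in [set: int])
    ((cabs (inner f (atom alpha mu0 nu phi p k))) ^+ 2)%:E.
  rewrite esum_esum; last by move=> *; rewrite lee_fin sqr_ge0.
  by congr (esum _ _); apply/seteqP; split.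
rewrite -(esumZ _ (ltW nu0)); last by move=> p; apply: esum_ge0 => k _; rewrite lee_fin sqr_ge0.
by apply: eq_esum => p _; exact: energy_scale.
Qed.

Lemma energy_le : (nu%:E * X <= (b + e)%:E * sqnorm f)%E.
Proof.
rewrite energy_sum.
apply: (@le_trans _ _ (\esum_(p in [set: int]) (sqnorm (F p) + aliasing_error (c p) (F p))%E)).
  by apply: le_esum => p _; have [K KP] := F_decay p; exact: sample_energy_le KP.
rewrite esumD; [|by move=> p _; exact: sqnorm_ge0|by move=> p _].
rewrite EFinD ge0_muleDl ?lee_fin//; apply: leeD => //.
rewrite sum_sqnorm; apply: weighted_le => // w.
by have /andP[] := PhiP w.
Qed.

(** The error stays on the right because [X] is an extended real; it is absorbed once [energy_le]
    has shown finiteness. *)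
Lemma le_energy : (a%:E * sqnorm f <= nu%:E * X + e%:E * sqnorm f)%E.
Proof.
apply: (@le_trans _ _ (\esum_(p in [set: int]) sqnorm (F p))).
  by rewrite sum_sqnorm; apply: weighted_ge => // w; have /andP[] := PhiP w.
rewrite energy_sum.
apply: (@le_trans _ _ (\esum_(p in [set: int])
    ((c p)%:E * sample_energy (c p) (F p) + aliasing_error (c p) (F p))%E)).
  by apply: le_esum => p _; have [K KP] := F_decay p; exact: le_sample_energy KP.
rewrite esumD; [|move=> p _|by move=> p _]; first by apply: leeD.
rewrite mule_ge0 ?lee_fin ?(ltW (c0 p))//; apply: esum_ge0 => k _.
by rewrite lee_fin sqr_ge0.
Qed.

End OneFunction.
End FrameL1L2.
(** * Frame bounds on L2 *)

Section BesselExtension.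
Context {R : realType}.
Notation mu := (@lebesgue_measure R).
Implicit Types (f g : R -> R[i]).

(** Restriction to a bounded interval: the product with an indicator in L2 is integrable by
    Cauchy-Schwarz, and the norm does not grow. *)
Lemma approx_L1L2 f (e : R) : cL2 f -> 0 < e -> exists g, [/\ cL1 g, cL2 g,
  (sqnorm g <= sqnorm f)%E & (sqnorm (fun t => f t - g t)%R < e%:E)%E].
Proof.
move=> f2 e0; pose T (n : nat) : set R := `[- n%:R, n%:R]%classic.
have mT n : measurable (T n) by exact: measurable_itv.
pose k n t : R[i] := (\1_(T n) t)%:C.
have mk n : cmeas (k n) by apply: cmeas_real; exact: measurable_indic.
have k1 n t : cabs (k n t) ^+ 2 = \1_(T n) t.
  by rewrite cabs_real real_normK ?num_real// indicE; case: (t \in _); rewrite ?expr1n ?expr0n.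
have k2 n : cL2 (k n).
  split=> //; rewrite /sqnorm; under eq_integral do rewrite k1.
  rewrite (integral_indic mu measurableT (mT n)) setIT.
  by rewrite /T /= lebesgue_measure_itv/=; case: ifP => _; rewrite ?ltry// -EFinD ltry.
pose g n t := k n t * f t.
have gE n t : g n t = if t \in T n then f t else 0.
  by rewrite /g /k indicE; case: (t \in T n); rewrite ?mul1r ?mul0r.
have mg n : cmeas (g n) by exact: cmeasM (mk n) f2.1.
have gle n : (sqnorm (g n) <= sqnorm f)%E.
  apply: le_sqnorm => //; first exact: f2.1.
  by move=> x; rewrite gE; case: ifP => _ //; rewrite cabs0 cabs_ge0.
have dle n t : cabs (f t - g n t) <= cabs (f t).
  by rewrite gE; case: ifP => _; rewrite ?subrr ?cabs0 ?cabs_ge0// subr0.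
have mf := measurable_cabs f2.1.
have c2 := @cvg_integral0 _ (fun n t => cabs (f t - g n t) ^+ 2) (fun t => cabs (f t) ^+ 2) setT
  measurableT (fun n => measurable_funX 2 (measurable_cabs (cmeasB f2.1 (mg n)))) (measurable_funX 2 mf).
have {}c2 : (fun n => sqnorm (fun t => f t - g n t)) @ \oo --> (0 : \bar R).
  apply: c2; [|exact: f2.2|].
    by move=> n t; rewrite sqr_ge0/= ler_pXn2r ?nnegrE ?cabs_ge0// dle.
  move=> t _; apply/cvgr0Pnorm_lt => z z0; near=> n.
  rewrite gE mem_set ?subrr ?cabs0 ?expr0n ?normr0//.
  rewrite /T/= in_itv/= -ler_norml.
  by near: n; exact: nbhs_infty_ger.
have [n _ /(_ n (leqnn n)) gn] := cvge0_lt c2 e0.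
exists (g n); split => //; first exact: cL2M (k2 n) f2.
by split=> //; exact: le_lt_trans (gle n) f2.2.
Unshelve. all: by end_near. Qed.

Context (I : countType) (u : I -> R -> R[i]) (A B : R).
Hypothesis u2 : forall i, cL2 (u i).
Hypothesis A0 : 0 <= A.
Hypothesis B0 : 0 < B.

Definition frame_energy f := \esum_(i in [set: I]) ((cabs (inner f (u i))) ^+ 2)%:E.

Hypothesis energyP : forall f, cL1 f -> cL2 f ->
  (A%:E * sqnorm f <= frame_energy f <= B%:E * sqnorm f)%E.

(** A finite partial sum is continuous in [f] for the L2 norm, so it suffices to bound finite sums
    uniformly. The factor 2 comes from [|z + w|^2 <= 2 |z|^2 + 2 |w|^2]. *)
Lemma bessel_L2 f : cL2 f -> (frame_energy f <= (2 * B)%:E * sqnorm f)%E.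
Proof.
move=> f2; apply: ub_ereal_sup => _ [J [Jfin _] <-].
rewrite fsbig_finite//=; set s := finmap.enum_fset _.
rewrite (sqnorm_fine f2) sumEFin -EFinM lee_fin.
pose D := \sum_(i <- s) fine (sqnorm (u i)).
have D0 : 0 <= D by rewrite sumr_ge0// => i _; exact: fine_sqnorm_ge0.
(* The precision [d] is chosen after the finite index set, since [D] depends on it; [D + 1] avoids a
   zero divisor. *)
apply/ler_addgt0Pr => e e0; pose d := e / (2 * (D + 1)).
have d0 : 0 < d by rewrite divr_gt0// mulr_gt0// ltr_wpDl.
have [g [g1 g2 gf fg]] := approx_L1L2 f2 d0.
have h2 := cL2B f2 g2.
have split_ i : cabs (inner f (u i)) ^+ 2 <=
    2 * cabs (inner g (u i)) ^+ 2 + 2 * (fine (sqnorm (u i)) * d).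
  have -> : inner f (u i) = inner g (u i) + inner (fun t => f t - g t) (u i).
    by rewrite innerBl// addrC subrK.
  apply: le_trans (sqr_cabsD _ _) _; rewrite lerD2l ler_wpM2l//.
  apply: le_trans (cauchy_schwarz h2 (u2 i)) _; rewrite mulrC ler_wpM2l ?fine_sqnorm_ge0//.
  by rewrite -lee_fin -sqnorm_fine// ltW.
apply: (@le_trans _ _ (\sum_(i <- s) (2 * cabs (inner g (u i)) ^+ 2 + 2 * (fine (sqnorm (u i)) * d)))).
  by apply: ler_sum => i _.
rewrite big_split /= -!mulr_sumr -mulr_suml -/D.
have l1 : \sum_(i <- s) cabs (inner g (u i)) ^+ 2 <= B * fine (sqnorm f).
  rewrite -lee_fin -sumEFin.
  have /andP[_ h] := energyP g1 g2.
  apply: (@le_trans _ _ (B%:E * sqnorm g)%E); last first.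
    by rewrite EFinM -(sqnorm_fine f2) lee_wpmul2l// lee_fin ltW.
  apply: le_trans h; apply: ereal_sup_ubound; exists J; first by split.
  by rewrite fsbig_finite.
have l2 : 2 * (D * d) <= e.
  rewrite /d; have -> : 2 * (D * (e / (2 * (D + 1)))) = e * (D / (D + 1)).
    by field; rewrite gt_eqF// ltr_wpDl.
  by rewrite ler_piMr ?(ltW e0)// ler_pdivrMr ?ltr_wpDl// mul1r lerDl.
by apply: lerD => //; rewrite -mulrA ler_wpM2l.
Qed.

Lemma frame_energy_fin f : cL2 f -> frame_energy f = (fine (frame_energy f))%:E.
Proof.
move=> f2; rewrite fineK// ge0_fin_numE; last by apply: esum_ge0 => i _; rewrite lee_fin sqr_ge0.
by rewrite (le_lt_trans (bessel_L2 f2))// (sqnorm_fine f2) -EFinM ltry.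
Qed.

Lemma frame_energyB f g : cL2 f -> cL2 g -> (frame_energy g <=
  2%:E * frame_energy f + 2%:E * frame_energy (fun t => (f t - g t)%R))%E.
Proof.
move=> f2 g2; have h2 := cL2B f2 g2.
rewrite /frame_energy -!esumZ//; [|by move=> i; rewrite lee_fin sqr_ge0..].
rewrite -esumD; [|by move=> i _; rewrite -EFinM lee_fin mulr_ge0 ?sqr_ge0..].
apply: le_esum => i _; rewrite -!EFinM -EFinD lee_fin.
have -> : inner g (u i) = inner f (u i) + - inner (fun t => f t - g t) (u i).
  by rewrite innerBl// opprB addrC subrK.
by rewrite -[X in _ <= _ + _ * X ^+ 2]cabsN sqr_cabsD.
Qed.

(** Passing from [f] to [g] loses a factor 2 in the norm and another in the energy, hence [A / 4];
    the energy of [f - g] is controlled by [bessel_L2]. *)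
Lemma lower_bound_L2 f : cL2 f -> ((A / 4)%:E * sqnorm f <= frame_energy f)%E.
Proof.
move=> f2; rewrite (frame_energy_fin f2) (sqnorm_fine f2) -EFinM lee_fin.
(* Chosen so that [2 K H = A H + 2 B H], with [H] the squared norm of [f - g], covers both error
   terms. *)
apply/ler_addgt0Pr => e e0; pose K := A / 2 + B.
have K0 : 0 < K by rewrite ltr_wpDl// divr_ge0.
have d0 : 0 < e / (2 * K) by rewrite divr_gt0// mulr_gt0.
have [g [g1 g2 gf fg]] := approx_L1L2 f2 d0.
have h2 := cL2B f2 g2.
have /andP[lo _] := energyP g1 g2.
have l1 : A * fine (sqnorm g) <=
    2 * fine (frame_energy f) + 2 * fine (frame_energy (fun t => f t - g t)).
  rewrite -lee_fin EFinD !EFinM -(sqnorm_fine g2) -(frame_energy_fin f2) -(frame_energy_fin h2).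
  exact: le_trans lo (frame_energyB f2 g2).
have l2 : fine (frame_energy (fun t => f t - g t)) <= 2 * B * fine (sqnorm (fun t => f t - g t)).
  by rewrite -lee_fin (EFinM (2 * B)) -(sqnorm_fine h2) -(frame_energy_fin h2); exact: bessel_L2.
have l3 : fine (sqnorm f) <= 2 * fine (sqnorm g) + 2 * fine (sqnorm (fun t => f t - g t)).
  rewrite -lee_fin EFinD !EFinM -!sqnorm_fine//.
  have := le_sqnormD g2.1 h2.1.
  by rewrite (_ : (fun x => g x + (f x - g x)) = f)//; apply/funext => t; rewrite addrC subrK.
move: fg; rewrite (sqnorm_fine h2) lte_fin ltr_pdivlMr ?mulr_gt0// => l4.
set F := fine (sqnorm f) in l3 *; set G := fine (sqnorm g) in l1 l3.
set H := fine (sqnorm _) in l2 l3 l4; set XF := fine (frame_energy f) in l1 *.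
set XH := fine (frame_energy _) in l1 l2.
have l5 : A * F <= A * (2 * G + 2 * H) by rewrite ler_wpM2l.
have l6 : H * (2 * K) = A * H + 2 * B * H by rewrite /K; field.
have l7 : 0 <= A * H by rewrite mulr_ge0// fine_sqnorm_ge0.
lra.
Qed.

End BesselExtension.
(** * Unconditional convergence of the frame series *)

Section RieszFischer.
Context {R : realType}.
Notation mu := (@lebesgue_measure R).

Lemma bounded_variation_cvg (r : nat -> R) (M : R) :
  (forall n, \sum_(0 <= k < n) `|r k.+1 - r k| <= M) -> cvgn r.
Proof.
move=> rM; have -> : r = (fun n => r 0%N + series (telescope r) n).
  by apply/funext => n; exact: eq_sum_telescope.
apply: is_cvgD; first exact: is_cvg_cst.
apply: normed_cvg; apply: nondecreasing_is_cvgn.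
  by apply/nondecreasing_seqP => n; rewrite /= !seriesEnat/= big_nat_recr//= lerDl.
by exists M => _ [n _ <-]; exact: rM.
Qed.

Lemma sum_half_le n : \sum_(0 <= k < n) (2^-1 : R) ^+ k <= 2.
Proof.
suff -> : \sum_(0 <= k < n) (2^-1 : R) ^+ k = 2 - 2 * 2^-1 ^+ n.
  by rewrite lerBlDr lerDl mulr_ge0// exprn_ge0.
elim: n => [|n ih]; first by rewrite big_geq// expr0; ring.
by rewrite big_nat_recr//= ih exprS; field.
Qed.

(** Riesz-Fischer for a geometrically fast Cauchy sequence: almost everywhere convergence comes from
    a weighted sum of squared increments, the rate from Fatou. *)
Lemma L2_fast_limit (S : nat -> R -> R[i]) (K : R) : (forall n, cL2 (S n)) ->
  (forall m n, (n <= m)%N -> (sqnorm (fun t => S m t - S n t)%R <= (K * 4^-1 ^+ n)%:E)%E) ->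
  exists2 g, cL2 g & forall n, (sqnorm (fun t => g t - S n t)%R <= (K * 4^-1 ^+ n)%:E)%E.
Proof.
move=> S2 SK.
have K0 : 0 <= K.
  by have := le_trans (sqnorm_ge0 _) (SK 0%N 0%N (leqnn _)); rewrite lee_fin expr0 mulr1.
(* The weight [2 ^+ k] is affordable because the increments decay like [4^-1 ^+ k], and it makes the
   increments themselves summable where [W] is finite. *)
pose d k x : R := 2 ^+ k * cabs (S k.+1 x - S k x) ^+ 2.
have d0 k x : 0 <= d k x by rewrite mulr_ge0 ?sqr_ge0 ?exprn_ge0.
have md k : measurable_fun [set: R] (fun x => (d k x)%:E).
  apply/measurable_EFinP; apply: measurable_funM; first exact: measurable_cst.
  by apply: measurable_funX; apply: measurable_cabs; exact: cmeasB (S2 _).1 (S2 _).1.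
pose W x := (\sum_(k <oo) (d k x)%:E)%E.
have W0 x : (0 <= W x)%E by apply: nneseries_ge0 => k _ _; rewrite lee_fin.
have mW : measurable_fun [set: R] W.
  have := @ge0_emeasurable_sum _ _ _ setT (fun k x => (d k x)%:E) predT
    (fun k x _ _ => d0 k x) (fun k _ => md k).
  by [].
have iW : (\int[mu]_x W x < +oo)%E.
  rewrite /W integral_nneseries//; last by move=> k x _; rewrite lee_fin.
  apply: (@le_lt_trans _ _ ((K * 2)%:E)); last exact: ltry.
  apply: lime_le.
    by apply: is_cvg_nneseries => k _ _; apply: integral_ge0 => x _; rewrite lee_fin.
  apply: nearW => n; apply: (@le_trans _ _ (\sum_(0 <= k < n) (K * 2^-1 ^+ k)%:E)%E).
    apply: lee_sum => k _.
    under eq_integral do rewrite EFinM.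
    rewrite ge0_integralZl//; last 2 first.
    - by apply: measurable_sqcabsE; exact: cmeasB (S2 _).1 (S2 _).1.
    - by move=> x _; rewrite lee_fin sqr_ge0.
    apply: le_trans (lee_wpmul2l _ (SK k.+1 k (leqnSn k))) _; first by rewrite lee_fin exprn_ge0.
    rewrite -EFinM lee_fin mulrCA -exprMn le_eqVlt; apply/orP; left; apply/eqP.
    by congr (_ * _ ^+ _); field.
  by rewrite sumEFin lee_fin -mulr_sumr ler_wpM2l// sum_half_le.
(* Setting the sequence to 0 off [G] makes it converge everywhere, so the limit is measurable; only
   a null set is altered. *)
pose G := [set x | W x \is a fin_num].
have mG : measurable G.
  by rewrite -[G]setTI; apply: emeasurable_fin_num.
pose h n x : R[i] := (\1_G x)%:C * S n x.
have hE n x : h n x = if x \in G then S n x else 0.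
  by rewrite /h indicE; case: (x \in G); rewrite ?mul1r ?mul0r.
have mh n : cmeas (h n).
  by apply: cmeasM (S2 n).1; apply: cmeas_real; exact: measurable_indic.
have bv x n : \sum_(0 <= k < n) cabs (h k.+1 x - h k x) <= 2 + fine (W x).
  have [xG|xG] := boolP (x \in G); last first.
    rewrite big1 ?addr_ge0 ?fine_ge0// => k _.
    by rewrite !hE (negbTE xG) subrr cabs0.
  apply: (@le_trans _ _ (\sum_(0 <= k < n) (2^-1 ^+ k + d k x))).
    apply: ler_sum => k _; rewrite !hE xG /d exprVn.
    set y := cabs _; have y0 : 0 <= y by exact: cabs_ge0.
    set z := 2 ^+ k; have z0 : 0 < z by rewrite exprn_gt0.
    (* Completing the square gives [y <= 1 / z + z * y^2], which trades an increment for its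
       weighted square. *)
    rewrite -subr_ge0 (_ : _ - y = ((z * y - 1) ^+ 2 + z * y) / z); last by field; rewrite gt_eqF.
    by rewrite divr_ge0 ?addr_ge0 ?sqr_ge0 ?mulr_ge0// ltW.
  rewrite big_split lerD ?sum_half_le// -lee_fin fineK; last by move: xG; rewrite inE.
  rewrite -sumEFin; apply: nneseries_lim_ge => k _ _.
  by rewrite lee_fin.
pose g x : R[i] := limn (fun n => complex.Re (h n x)) +i* limn (fun n => complex.Im (h n x)).
have cRe x : (fun n => complex.Re (h n x)) @ \oo --> complex.Re (g x).
  apply: (@bounded_variation_cvg _ (2 + fine (W x))) => n; apply: le_trans (bv x n).
  by apply: ler_sum => k _; rewrite -cReN -cReD; exact: cabs_Re.
have cIm x : (fun n => complex.Im (h n x)) @ \oo --> complex.Im (g x).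
  apply: (@bounded_variation_cvg _ (2 + fine (W x))) => n; apply: le_trans (bv x n).
  by apply: ler_sum => k _; rewrite -cImN -cImD; exact: cabs_Im.
have mg : cmeas g.
  split.
    apply: (measurable_fun_cvg (h := fun n x => complex.Re (h n x))) => [n|x _]; last exact: cRe.
    exact: (mh n).1.
  apply: (measurable_fun_cvg (h := fun n x => complex.Im (h n x))) => [n|x _]; last exact: cIm.
  exact: (mh n).2.
have gS n : (\int[mu]_x (cabs (g x - h n x) ^+ 2)%:E <= (K * 4^-1 ^+ n)%:E)%E.
  apply: (@integral_le_limit _ (fun m x => cabs (h m x - h n x) ^+ 2)).
  - by move=> m; apply: measurable_funX; apply: measurable_cabs; exact: cmeasB.
  - by move=> m x; exact: sqr_ge0.
  - move=> x; rewrite cabs_sqr; under eq_fun do rewrite cabs_sqr cReD cReN cImD cImN.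
    rewrite cReD cReN cImD cImN; apply: cvgD.
      under eq_fun do rewrite expr2; rewrite expr2.
      by apply: cvgM; apply: cvgB (cRe x) _; exact: cvg_cst.
    under eq_fun do rewrite expr2; rewrite expr2.
    by apply: cvgM; apply: cvgB (cIm x) _; exact: cvg_cst.
  - exists n => //= m nm; apply: le_trans (SK m n nm).
    apply: le_sqnorm => [| |x].
    + exact: cmeasB.
    + exact: cmeasB (S2 _).1 (S2 _).1.
    + by rewrite !hE; case: ifP => // _; rewrite subrr cabs0 cabs_ge0.
have gSn n : (sqnorm (fun t => g t - S n t)%R <= (K * 4^-1 ^+ n)%:E)%E.
  apply: le_trans (gS n); rewrite le_eqVlt; apply/orP; left; apply/eqP.
  apply: ge0_ae_eq_integral => //.
  - by apply: measurable_sqcabsE; exact: cmeasB mg (S2 _).1.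
  - by apply: measurable_sqcabsE; exact: cmeasB.
  - by move=> x _; rewrite lee_fin sqr_ge0.
  - by move=> x _; rewrite lee_fin sqr_ge0.
  have Wi : mu.-integrable setT W.
    apply/integrableP; split => //.
    by under eq_integral do rewrite gee0_abs//.
  have := integrable_ae measurableT Wi; apply: filterS => x Wx _.
  by rewrite hE mem_set//; exact: Wx.
exists g => //; split=> //.
have -> : g = (fun t => (g t - S 0%N t) + S 0%N t).
  by apply/funext => t; rewrite subrK.
have mgS : cmeas (fun t => g t - S 0%N t) by exact: cmeasB mg (S2 _).1.
apply: le_lt_trans (le_sqnormD mgS (S2 _).1) _.
by rewrite lte_add_pinfty ?lte_mul_pinfty// ?(S2 _).2// (le_lt_trans (gSn 0%N))// ltry.
Qed.

End RieszFischer.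

(** * Synthesis bound and summation of the frame series *)

Section FrameOperator.
Context {R : realType}.
Notation mu := (@lebesgue_measure R).

Lemma big_fsetS (I : choiceType) (V : nmodType) (J J' : {fset I}) (x : I -> V) :
  (J `<=` J')%fset ->
  \sum_(i <- J') x i = \sum_(i <- J) x i + \sum_(i <- (J' `\` J)%fset) x i.
Proof.
move=> JJ'; rewrite -big_cat; apply: perm_big; apply: uniq_perm; first exact: fset_uniq.
  rewrite cat_uniq !fset_uniq/= andbT; apply/hasPn => i.
  by rewrite in_fsetD => /andP[].
move=> i; rewrite mem_cat in_fsetD.
by case: (boolP (i \in J)) => //= iJ; rewrite (fsubsetP JJ').
Qed.

Lemma sum_le_esum (I : choiceType) (s : seq I) (a : I -> \bar R) : uniq s ->
  (forall i, 0 <= a i)%E -> (\sum_(i <- s) a i <= \esum_(i in [set: I]) a i)%E.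
Proof.
move=> us a0; have -> : (\sum_(i <- s) a i)%E = \esum_(i in [set` s]) a i.
  by rewrite esum_fset//; rewrite fsbig_seq.
exact: esum_subset.
Qed.

Lemma esum_net (I : choiceType) (x : I -> R) (X e : R) : (forall i, 0 <= x i) ->
  \esum_(i in [set: I]) (x i)%:E = X%:E -> 0 < e ->
  exists J0 : {fset I}, forall J : {fset I}, (J0 `<=` J)%fset -> X - e < \sum_(i <- J) x i <= X.
Proof.
move=> x0 xX e0.
have fin : ereal_sup [set (\sum_(i \in A) (x i)%:E)%E | A in fsets [set: I]] \is a fin_num.
  by rewrite -[X in X \is a _]/(esum _ _) xX.
have [_ [A [Afin _] <-]] := ub_ereal_sup_adherent e0 fin.
rewrite -[X in (X - _ < _)%E]/(esum _ _) xX => h.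
exists (fset_set A) => J AJ; rewrite -!lte_fin -lee_fin EFinB -sumEFin.
have -> : (\sum_(i <- J) (x i)%:E <= X%:E)%E.
  by rewrite -xX sum_le_esum ?fset_uniq// => i; rewrite lee_fin.
rewrite andbT; apply: (lt_le_trans h); rewrite fsbig_finite//= !sumEFin lee_fin.
rewrite (big_fsetS x AJ) lerDl; exact: sumr_ge0.
Qed.

Context (I : countType) (u : I -> R -> R[i]) (K : R).
Hypothesis u2 : forall i, cL2 (u i).
Hypothesis K0 : 0 < K.
Hypothesis bessel : forall f, cL2 f -> (frame_energy u f <= K%:E * sqnorm f)%E.

(** The dual form of Bessel: expand one factor of the squared norm of [h], apply weighted AM-GM
    termwise, and use Bessel for [h] itself to absorb half of that norm. *)
Lemma synthesis_le (d : I -> R[i]) (s : seq I) : uniq s ->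
  (sqnorm (fun t => (\sum_(i <- s) d i * u i t)%R) <= (K * \sum_(i <- s) cabs (d i) ^+ 2)%R%:E)%E.
Proof.
move=> us; set h := fun t => _.
have du2 i : cL2 (fun t => d i * u i t) by exact: cL2Z.
have h2 : cL2 h by exact: cL2_sum.
set D := \sum_(i <- s) _; rewrite (sqnorm_fine h2) lee_fin.
set q := fine (sqnorm h).
have b1 : \sum_(i <- s) cabs (inner h (u i)) ^+ 2 <= K * q.
  rewrite -lee_fin -sumEFin EFinM -(sqnorm_fine h2); apply: le_trans (bessel h2).
  by apply: sum_le_esum => // i; rewrite lee_fin sqr_ge0.
have b2 : q <= \sum_(i <- s) (K / 2 * cabs (d i) ^+ 2 + (2 * K)^-1 * cabs (inner h (u i)) ^+ 2).
  have -> : q = cabs (inner h h).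
    by rewrite inner_self// cabs_real ger0_norm// fine_sqnorm_ge0.
  rewrite {1}/h inner_suml//; apply: le_trans (cabs_sum _ _ _) _.
  apply: ler_sum => i _; rewrite innerZl// cabsM.
  have -> : cabs (inner (u i) h) = cabs (inner h (u i)) by rewrite (innerC h2 (u2 i)) cabs_conj.
  set p := cabs (d i); set r := cabs _.
  rewrite -subr_ge0 (_ : _ - _ = (K * p - r) ^+ 2 / (2 * K)); last by field; rewrite gt_eqF.
  by rewrite divr_ge0 ?sqr_ge0// mulr_ge0// ltW.
move: b2; rewrite big_split/= -!mulr_sumr -/D => b2.
have b3 : (2 * K)^-1 * \sum_(i <- s) cabs (inner h (u i)) ^+ 2 <= q / 2.
  rewrite (_ : q / 2 = (2 * K)^-1 * (K * q)); last by field; rewrite gt_eqF.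
  by rewrite ler_wpM2l// invr_ge0 mulr_ge0// ltW.
lra.
Qed.

Context (f : R -> R[i]).
Hypothesis f2 : cL2 f.

Let c i := inner f (u i).
Let X := fine (frame_energy u f).
Let S (s : seq I) t := \sum_(i <- s) c i * u i t.

Let XE : \esum_(i in [set: I]) (cabs (c i) ^+ 2)%:E = X%:E.
Proof.
rewrite fineK// ge0_fin_numE; last by apply: esum_ge0 => i _; rewrite lee_fin sqr_ge0.
by rewrite (le_lt_trans (bessel f2))// (sqnorm_fine f2) -EFinM ltry.
Qed.

Let cu2 i : cL2 (fun t => c i * u i t). Proof. exact: cL2Z. Qed.

Let S2 s : cL2 (S s). Proof. exact: cL2_sum. Qed.

(** Nested partial sums differ by a sum over the set difference, so the synthesis bound reduces the
    claim to a tail of the finite energy. *)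
Let S_cauchy (e : R) : 0 < e -> exists J0 : {fset I}, forall J J' : {fset I},
  (J0 `<=` J)%fset -> (J `<=` J')%fset -> (sqnorm (fun t => S J' t - S J t)%R <= e%:E)%E.
Proof.
move=> e0; have eK0 : 0 < e / K by rewrite divr_gt0.
have [J0 J0P] := esum_net (fun i => sqr_ge0 (cabs (c i))) XE eK0.
exists J0 => J J' JJ0 JJ'.
rewrite (_ : (fun t => _) = S (J' `\` J)%fset); last first.
  by apply/funext => t; rewrite /S (big_fsetS (fun i => c i * u i t) JJ') addrAC subrr add0r.
apply: le_trans (synthesis_le c (fset_uniq _)) _; rewrite lee_fin.
have /andP[h1 _] := J0P _ JJ0.
have /andP[_ h2] := J0P _ (fsubset_trans JJ0 JJ').
rewrite (big_fsetS (fun i => cabs (c i) ^+ 2) JJ') in h2.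
rewrite mulrC -ler_pdivlMr//; lra.
Qed.

Lemma Lpnorm2_lt (g : R -> R[i]) (e : R) : cL2 g -> 0 <= e ->
  (Lpnorm 2%:E g < e%:E)%E = (sqnorm g < (e ^+ 2)%:E)%E.
Proof.
move=> g2 e0; rewrite (sqnorm_fine g2) -norm2_sqr.
have -> : Lpnorm 2%:E g = (norm2 g)%:E.
  by rewrite /norm2 Lpnorm2E (sqnorm_fine g2) poweR_EFin.
by rewrite !lte_fin ltr_pXn2r// nnegrE norm2_ge0.
Qed.

(** An increasing chain of finite sets gives a sequence to which completeness applies; the estimate
    for all supersets of [J n] then upgrades the limit to an unconditional sum. *)
Lemma frame_sum_ex : exists g, L2_has_sum (fun i t => c i * u i t) g.
Proof.
have rate0 (n : nat) : 0 < (4^-1 : R) ^+ n by rewrite exprn_gt0.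
have TP n := cid (S_cauchy (rate0 n)).
pose T n := sval (TP n); pose J := fix J n := if n is m.+1 then (J m `|` T m.+1)%fset else T 0%N.
have TJ n : (T n `<=` J n)%fset by case: n => [|n] //=; exact: fsubsetUr.
have JJ n m : (n <= m)%N -> (J n `<=` J m)%fset.
  elim: m => [|m ih]; first by rewrite leqn0 => /eqP ->.
  rewrite leq_eqVlt => /predU1P[-> //|/ih h] /=.
  by apply: fsubset_trans h _; exact: fsubsetUl.
have SJ n J' : (J n `<=` J')%fset ->
    (sqnorm (fun t => S J' t - S (J n) t)%R <= (4^-1 ^+ n)%:E)%E.
  by move=> h; apply: (svalP (TP n)) => //; exact: TJ.
have [g g2 gP] := @L2_fast_limit _ (fun n => S (J n)) 1 (fun n => S2 (J n))
  (fun m n nm => ltac:(rewrite mul1r; exact: SJ (JJ _ _ nm))).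
exists g; split; first exact/in_Lp2P.
(* The two squared errors are each at most [4^-1 ^+ n] and enter with a factor 2, so
   [4^-1 ^+ n < e ^+ 2 / 4] suffices. *)
move=> e e0; have e20 : 0 < e ^+ 2 / 4 by rewrite divr_gt0// exprn_gt0.
have r1 : `|4^-1 : R| < 1 by rewrite gtr0_norm// invf_lt1// ltr1n.
have /cvgr0Pnorm_lt/(_ _ e20)[n _ /(_ n (leqnn n))/= rn] := cvg_expr r1.
exists (J n) => J' JJ'.
have d1 := cL2B (S2 J') (S2 (J n)); have d2 := cL2B g2 (S2 (J n)).
rewrite (_ : (fun t => _) = (fun t => (S J' t - S (J n) t) + - (g t - S (J n) t))); last first.
  by apply/funext => t; rewrite opprB addrA subrK.
rewrite Lpnorm2_lt ?(ltW e0)//; last by apply: cL2D => //; exact: cL2N.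
apply: le_lt_trans (le_sqnormD d1.1 (cL2N d2).1) _; rewrite sqnormN.
have h1 := SJ _ _ JJ'; have h2 := gP n.
rewrite (sqnorm_fine d1) lee_fin in h1; rewrite (sqnorm_fine d2) lee_fin mul1r in h2.
rewrite (sqnorm_fine d1) (sqnorm_fine d2) -!EFinM -EFinD lte_fin.
move: rn; rewrite ger0_norm ?exprn_ge0//; lra.
Qed.

(** Both limits, of the partial sums in L2 and of the energies, are compared at a common finite set.
    Valid for every sum [h], hence for the one selected by [frame_op]. *)
Lemma inner_frame_sum h : L2_has_sum (fun i t => c i * u i t) h -> inner h f = X%:C.
Proof.
move=> [/in_Lp2P h2 hP]; apply/eqP; rewrite -subr_eq0; apply/eqP/cabs0_eq0.
apply/eqP; rewrite eq_le cabs_ge0 andbT; apply/ler_addgt0Pr => e e0; rewrite add0r.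
set q := fine (sqnorm f); have q0 : 0 <= q by exact: fine_sqnorm_ge0.
have q10 : 0 < q + 1 by rewrite ltr_wpDl.
(* By Cauchy-Schwarz the L2 error is multiplied by the norm of [f], whose square is [q]; dividing by
   [q + 1] keeps the product within [e / 2], even for [q = 0]. *)
have d0 : 0 < e / 2 / (q + 1) by rewrite !divr_gt0.
have e20 : 0 < e / 2 by rewrite divr_gt0.
have [J1 J1P] := hP _ d0.
have [J2 J2P] := esum_net (fun i => sqr_ge0 (cabs (c i))) XE e20.
pose J := (J1 `|` J2)%fset.
have := J1P J (fsubsetUl _ _); rewrite (Lpnorm2_lt (cL2B (S2 J) h2) (ltW d0)) => l1.
have /andP[l2 l3] := J2P J (fsubsetUr _ _).
have E : inner (S J) f = (\sum_(i <- J) cabs (c i) ^+ 2)%:C.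
  rewrite /S inner_suml// (rmorph_sum (@real_complex R))/=; apply: eq_bigr => i _.
  by rewrite innerZl// (innerC f2 (u2 i)) mulcJ.
have -> : inner h f - X%:C = (inner (S J) f - X%:C) - inner (fun t => S J t - h t) f.
  by rewrite innerBl//; ring.
rewrite (le_trans (cabsB _ _))// [leRHS](_ : e = e / 2 + e / 2); last by field.
apply: lerD.
  rewrite E -(rmorphB (@real_complex R))/= cabs_real ler_norml; apply/andP; split; lra.
rewrite -(@ler_pXn2r _ 2)// ?nnegrE ?cabs_ge0// ?(ltW e20)//.
apply: le_trans (cauchy_schwarz (cL2B (S2 J) h2) f2) _.
move: l1; rewrite (sqnorm_fine (cL2B (S2 J) h2)) lte_fin => l1.
apply: (@le_trans _ _ ((e / 2 / (q + 1)) ^+ 2 * q)); first by rewrite ler_wpM2r// ltW.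
rewrite [leLHS](_ : _ = (e / 2) ^+ 2 * (q / (q + 1) ^+ 2)); last by field; rewrite gt_eqF.
rewrite ler_piMr ?sqr_ge0// ler_pdivrMr ?exprn_gt0// mul1r.
by have := sqr_ge0 q; rewrite !expr2; lra.
Qed.

End FrameOperator.

(* The frame bounds for small [nu] *)
Local Close Scope complex_scope.

(** [B] is chosen after [nu] because the energy grows like [1 / nu] as [nu] tends to 0; [A] and
    [nu0] are uniform. *)
Theorem theorem4p13 (R : realType) (alpha mu : R) (phi : R -> R[i])
  (a b N CN : R)
  (halpha : 0 <= alpha <= 1) (hmu : 0 < mu)
  (hphi2 : in_Lp 2%:E phi) (hphi1 : in_Lp 1%:E phi)
  (ha : 0 < a) (hb : 0 < b)
  (hPhi : forall w : R,
     (a%:E <= \esum_(p in [set: int]) ((cabs (Phi alpha mu phi p w)) ^+ 2)%:E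
           <= b%:E)%E)
  (hN : 2 < N) (hCN : 0 < CN)
  (hdecay : forall w : R, cabs (fourier phi w) <= CN / (1 + `|w|) `^ N) :
  exists A nu0 : R, [/\ 0 < A, 0 < nu0 &
    forall nu : R, 0 < nu < nu0 ->
    exists2 B : R, 0 < B &
    forall f : R -> R[i], in_Lp 2%:E f ->
      A * norm2 f ^+ 2 <= cabs (inner (frame_op alpha mu nu phi f) f)
                       <= B * norm2 f ^+ 2].
Proof.
have alpha0 : 0 <= alpha by case/andP: halpha.
have phi1 : cL1 phi by apply/in_Lp1P.
have phi2 : cL2 phi by apply/in_Lp2P.
have phiC w : cabs (fourier phi w) <= CN * decay N w.
  by rewrite (le_trans (hdecay w))// /decay powRN.
(* Aliasing is allowed to consume half of the lower bound [a]. *)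
have e0 : 0 < a / 2 by rewrite divr_gt0.
have [nu0 nu00 nu0P] := off_diagonal_le alpha0 hmu hN phiC e0.
(* The remaining [a / 2] loses a factor 4 in the passage to L2; capping [nu] at 1 lets the factor
   [1 / nu] be dropped, so that [A] does not depend on [nu]. *)
exists (a / 8), (Num.min nu0 1); split; [by rewrite divr_gt0|by rewrite lt_min nu00 ltr01|].
move=> nu /andP[nu_gt0]; rewrite lt_min => /andP[nu_lt nu1].
pose u (pk : int * int) := atom alpha mu nu phi pk.1 pk.2.
have u2 pk : cL2 (u pk) by exact: cL2_atom.
pose B := (b + a / 2) / nu; have B0 : 0 < B by rewrite divr_gt0// addr_gt0.
have A0 : 0 <= a / 2 / nu by rewrite divr_ge0// ltW.
have off w := nu0P nu w (introT andP (conj nu_gt0 nu_lt)).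
have energyP f : cL1 f -> cL2 f ->
    ((a / 2 / nu)%:E * sqnorm f <= frame_energy u f <= B%:E * sqnorm f)%E.
  move=> f1 f2.
  have up := energy_le alpha0 phi1 phi2 hN phiC f1 f2 nu_gt0 (ltW hb) (ltW e0) hPhi off.
  have lo := le_energy alpha0 phi1 phi2 hN phiC f1 f2 nu_gt0 (ltW ha) (ltW e0) hPhi off.
  rewrite -/(frame_energy u f) in up lo.
  have X0 : (0 <= frame_energy u f)%E by apply: esum_ge0 => i _; rewrite lee_fin sqr_ge0.
  (* The upper bound makes the energy finite, so that both estimates can be rearranged in the
     reals. *)
  have XE : frame_energy u f = (fine (frame_energy u f))%:E.
    rewrite fineK// ge0_fin_numE// ltNge leye_eq; apply/eqP => Xoo.
    by move: up; rewrite Xoo gt0_muley ?lte_fin// (sqnorm_fine f2) -EFinM leye_eq.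
  move: up lo; rewrite XE (sqnorm_fine f2) -!EFinM -EFinD !lee_fin /B => up lo.
  rewrite -!mulrA !(mulrC nu^-1) !mulrA ler_pdivrMr// ler_pdivlMr//.
  by apply/andP; split; lra.
exists (2 * B); first by rewrite mulr_gt0.
move=> f /in_Lp2P f2.
have bessel := bessel_L2 u2 B0 energyP.
have lower := lower_bound_L2 u2 A0 B0 energyP f2.
have B20 : 0 < 2 * B by rewrite mulr_gt0.
(* Since the series has a sum, the choice operator returns one rather than its default 0. *)
have sumf : L2_has_sum (fun pk t => inner f (u pk) * u pk t) (frame_op alpha mu nu phi f).
  exact: (xgetPex (fun=> 0) (frame_sum_ex u2 B20 bessel f2)).
rewrite (inner_frame_sum u2 bessel f2 sumf) cabs_real ger0_norm; last first.
  by rewrite fine_ge0//; apply: esum_ge0 => i _; rewrite lee_fin sqr_ge0.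
have upper := bessel f f2.
have XE := frame_energy_fin u2 B0 energyP f2.
rewrite XE (sqnorm_fine f2) -EFinM lee_fin in upper.
rewrite XE (sqnorm_fine f2) -EFinM lee_fin in lower.
rewrite norm2_sqr upper andbT; apply: le_trans lower.
rewrite ler_wpM2r ?fine_sqnorm_ge0//.
rewrite (_ : a / 2 / nu / 4 = a / 8 / nu); last by field; rewrite gt_eqF.
by rewrite ler_pdivlMr// ler_piMr ?divr_ge0// ltW.
Qed.
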